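(* Let $n$ be a positive integer and $q$ a prime power with $n\equiv 2\pmod 4$ and $q\equiv 3\pmod 4$. Then the total number of real conjugacy classes in $SL_n(q)$ is equal to $$\sum_{|\nu|=n}h_\nu\, sl_\nu-\sum_{|\mu|=n}h_\mu\, sl_\mu,$$ where the first sum is over all partitions $\nu=(1^{n_1}2^{n_2}\cdots)$ of $n$ and the second sum is over all partitions of $n$ of the form $\mu=(2^{d_2}4^{d_4}\cdots)$, i.e. all of whose parts are even.
   Context: An element $g$ of a group $G$ is real if $hgh^{-1}=g^{-1}$ for some $h\in G$; a class is real if its elements are. A partition $\nu=\{\nu_1,\dots,\nu_r\}$ of $n$ (parts $\nu_j\ge1$ with sum $|\nu|=n$) is also written $\nu=1^{n_1}2^{n_2}\cdots$, where $n_i$ is the number of parts equal to $i$. Put $h_\nu=\gcd(q-1,\nu_1,\dots,\nu_r)$. Here $q$ is odd. For $d\ge 1$: $n_{q,d}=2q^{(d-1)/2}$ if $d$ is odd; $n_{q,d}=(q+1)q^{d/2-1}$ if $d$ is even. The number $sl_\nu$ is defined by: - $sl_\nu=\prod_{n_i>0}n_{q,n_i}$ if $n_i=0$ for all odd $i$; - $sl_\nu=\frac12\prod_{n_i>0}n_{q,n_i}$ if there exists $i$ with $i n_i$ odd; - $sl_\nu=f_\nu(q)\prod_{i\text{ odd},\,n_i>0}q^{n_i/2-1}\prod_{i\text{ even},\,n_i>0}n_{q,n_i}$ otherwise, where $f_\nu(q)=\frac{(q+1)^r+(q-1)^r}{2}$ and $r$ here is the number of odd $i$ with $n_i>0$.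 *)

(* Defs.v *)
From HB Require Import structures.
From mathcomp Require Import all_boot all_order all_algebra all_fingroup.

Set Implicit Arguments.
Unset Strict Implicit.
Unset Printing Implicit Defensive.

Import GRing.Theory.

Section RealClasses.
Local Open Scope group_scope.

Definition real_elt (gT : finGroupType) (G : {set gT}) (g : gT) : bool :=
  [exists h in G, h * g * h^-1 == g^-1].

Definition real_classes (gT : finGroupType) (G : {set gT}) : {set {set gT}} :=
  [set C in classes G | [forall g in C, real_elt G g]].

(* {'GL_n[F]} consists of matrices of size n.-1.+1, so SL is only meaningful
   for 0 < n. *)
Definition SL (n : nat) (F : finFieldType) : {set {'GL_n[F]}} :=
  [set g : {'GL_n[F]} | (\det (GLval g) == 1)%R].

Lemma SL_group_set n F : group_set (SL n F).
Proof.
apply/group_setP; split=> [|x y]; first by rewrite inE GL_1E det1.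
by rewrite !inE GL_ME det_mulmx => /eqP-> /eqP->; rewrite mulr1.
Qed.

Canonical SL_group n F := Group (SL_group_set n F).

End RealClasses.

Section Partitions.
Local Open Scope nat_scope.

(* Partitions in exponential notation 1^{n_1} 2^{n_2} ... : nu i is the number
   of parts equal to i.  The unused index 0 gets the value 0, so that each
   partition has exactly one encoding; parts and multiplicities of a partition
   of n are at most n. *)
Definition multiplicities (n : nat) := {ffun 'I_n.+1 -> 'I_n.+1}.

Definition is_intpart (n : nat) (nu : multiplicities n) : bool :=
  (nu ord0 == 0 :> nat) && (\sum_(i < n.+1) i * nu i == n).

Definition all_parts_even (n : nat) (nu : multiplicities n) : bool :=
  [forall i : 'I_n.+1, (0 < nu i) ==> ~~ odd i].

(* Only the distinct part sizes matter for the gcd. *)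
Definition h_part (q n : nat) (nu : multiplicities n) : nat :=
  gcdn (q - 1) (\big[gcdn/0]_(i < n.+1 | 0 < nu i) i).

(* Used only for 0 < d. *)
Definition n_sr (q d : nat) : nat :=
  if odd d then 2 * q ^ ((d - 1) %/ 2) else (q + 1) * q ^ (d %/ 2 - 1).

End Partitions.

Section SelfReciprocalCount.
Local Open Scope ring_scope.

Definition f_part (q n : nat) (nu : multiplicities n) : rat :=
  let r := #|[set i : 'I_n.+1 | odd i & (0 < nu i)%N]| in
  ((q%:R + 1) ^+ r + (q%:R - 1) ^+ r) / 2.

(* In the last branch nu i is even for every odd i, so the halved exponents
   are exact. *)
Definition sl_part (q n : nat) (nu : multiplicities n) : rat :=
  if [forall i : 'I_n.+1, odd i ==> (nu i == 0 :> nat)%N] then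
    \prod_(i < n.+1 | (0 < nu i)%N) (n_sr q (nu i))%:R
  else if [exists i : 'I_n.+1, odd (i * nu i)] then
    2^-1 * \prod_(i < n.+1 | (0 < nu i)%N) (n_sr q (nu i))%:R
  else
    f_part q nu *
    (\prod_(i < n.+1 | odd i && (0 < nu i)%N) q%:R ^+ (nu i %/ 2 - 1)) *
    (\prod_(i < n.+1 | ~~ odd i && (0 < nu i)%N) (n_sr q (nu i))%:R).

End SelfReciprocalCount.

(* Main.v *)
From HB Require Import structures.
Require Import Defs.
From mathcomp Require Import all_boot all_order all_algebra all_fingroup.
From mathcomp Require Import all_solvable all_field.
From mathcomp Require Import zify ring.

(* A class of GL_n(q) is determined by its invariant factors D_1, ..., D_n with
   D_(j+1) | D_j, hence by the arbitrary monic quotients w_j = D_j / D_(j+1)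
   subject to sum_j j deg w_j = n.  It is real iff all w_j are self-reciprocal.
   Inside SL_n(q) it splits into h = [F^* : det C(g)] classes, and a divisor d
   of q - 1 divides h iff all w_j are d-th powers.
   - If the w_j are not all squares, h is odd.  A reversing element has its
     square in C(g), so modulo det C(g) its determinant has order at most 2 in a
     group of odd order: it can be corrected to determinant 1.
   - If the w_j are all squares, the anti-diagonal reversing matrix has
     determinant (-1)^(n/2) = -1, a non-square since q = 3 mod 4, whereas
     det C(g) consists of squares: no reversing element lies in SL_n(q).
   Thus the number of real classes is the sum of h over the self-reciprocal
   tuples w of determinant 1 which are not all squares.  Writing h as the sum of
   phi(d) over d | h, both this sum and the right-hand side become
   sum_(d | q - 1) phi(d) (N_d - N_lcm(2, d)), where N_d counts the tuples w of
   d-th powers on one side, the tuples u with u_i = 1 unless d | i (that is, the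
   partitions with all parts divisible by d) on the other; w_j = u_(d j) ^ d is
   a bijection between the two. *)

Set Implicit Arguments.
Unset Strict Implicit.
Unset Printing Implicit Defensive.

Import GRing.Theory.
Local Open Scope ring_scope.

(** * Polynomials in a matrix, companion matrices *)

(** Partitions cannot be matched with class types one by one. The degrees of the w_j do form a
    partition of n, but its h_nu need not be the index h of the class: for n = 2 and w_1 = (X - 1)^2
    the partition is 1^2 with h_nu = 1, while h = 2. The two sides agree only after the expansion
    over d. That d divides h when all w_j are d-th powers is proved without describing the
    centralizer. For p the product of the primes of the characteristic polynomial, a commuting X
    acts on the layers ker p(A) cap im p(A)^k, which change only at multiples of d; each layer
    determinant is thus repeated d times. Conversely, a generator of the units of F[X]/(f) has a
    norm that generates the units of F, which forces d to divide every exponent of f. On the side of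
    partitions, the u_i of prescribed degrees are independent except for the condition det = 1. All
    signs being 1 or -1, this condition is an average of two products over i, and the three cases of
    sl_nu are the three behaviours of the second product. *)

Section PolyMx.

Variable F : fieldType.
Implicit Types (p q D : {poly F}) (s t : seq {poly F}).

(* [horner_mx] is only available in dimension [n.+1]; empty blocks occur here. *)
Definition polymx n : 'M[F]_n -> {poly F} -> 'M[F]_n :=
  if n is n'.+1 then fun A => horner_mx A else fun _ _ => 0.

Lemma polymxD n (A : 'M_n) p q : polymx A (p + q) = polymx A p + polymx A q.
Proof. by case: n A => [|n] A /=; rewrite ?addr0 // rmorphD. Qed.

Lemma polymxM n (A : 'M_n) p q : polymx A (p * q) = polymx A p *m polymx A q.
Proof. by case: n A => [|n] A /=; rewrite ?mulmx0 // rmorphM. Qed.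

Lemma polymxC n (A : 'M_n) a : polymx A a%:P = a%:M.
Proof. by case: n A => [|n] A /=; rewrite ?[RHS]flatmx0 // horner_mx_C. Qed.

Lemma polymx1 n (A : 'M_n) : polymx A 1 = 1%:M.
Proof. exact: polymxC. Qed.

Lemma polymx0 n (A : 'M_n) : polymx A 0 = 0.
Proof. by rewrite -[0 in LHS]polyC0 polymxC raddf0. Qed.

Lemma polymxX n (A : 'M_n) : polymx A 'X = A.
Proof. by case: n A => [|n] A /=; rewrite ?[RHS]flatmx0 // horner_mx_X. Qed.

Lemma polymxXn n (A : 'M_n) p k : polymx A (p ^+ k) = polymx A p ^+ k.
Proof.
by elim: k => [|k IH]; rewrite ?expr0 ?polymx1 // !exprS polymxM IH.
Qed.

Lemma polymx_comm n (A : 'M_n) p q : polymx A p *m polymx A q = polymx A q *m polymx A p.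
Proof. by rewrite -!polymxM mulrC. Qed.

Lemma polymx_intertwine m n (A : 'M_m) (B : 'M_n) (P : 'M_(m, n)) p :
  A *m P = P *m B -> polymx A p *m P = P *m polymx B p.
Proof.
move=> AP; elim/poly_ind: p => [|p c IH]; first by rewrite !polymx0 mul0mx mulmx0.
rewrite !polymxD !polymxM !polymxC !polymxX mulmxDl mulmxDr -mulmxA AP mulmxA IH.
by rewrite mul_scalar_mx mul_mx_scalar !mulmxA.
Qed.

Lemma polymx_block m n (A : 'M_m) (B : 'M_n) p :
  polymx (block_mx A 0 0 B) p = block_mx (polymx A p) 0 0 (polymx B p).
Proof.
elim/poly_ind: p => [|p c IH]; first by rewrite !polymx0 block_mx_const.
rewrite !polymxD !polymxM !polymxC !polymxX IH mulmx_block.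
by rewrite !mulmx0 !mul0mx !addr0 !add0r scalar_mx_block add_block_mx !addr0.
Qed.

(** Builds the linear structure locally, so that a plain function with a proof of linearity can be
    turned into a matrix. *)
Lemma mul_lin1 k n (f : 'rV[F]_k -> 'rV[F]_n) u : linear f -> u *m lin1_mx f = f u.
Proof.
move=> lf; pose H := GRing.isLinear.Build F _ _ _ f lf.
pose L : {linear 'rV[F]_k -> 'rV[F]_n} := HB.pack f H.
exact: (mul_rV_lin1 L u).
Qed.

(* Row vectors of length [deg D] represent the residues modulo [D], and the
   companion matrix acts as multiplication by 'X. *)
Section Companion.

Variable D : {poly F}.
Hypothesis monD : D \is monic.
Let k := (size D).-1.
Let C : 'M_k := companionmx D.

Lemma size_monicS : size D = k.+1.
Proof. by rewrite /k prednK // size_poly_gt0 monic_neq0. Qed.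

Lemma rVpoly_modp (v : 'rV[F]_k) : rVpoly v %% D = rVpoly v.
Proof. by rewrite modp_small // size_monicS ltnS size_poly. Qed.

Lemma poly_rV_modpK p : rVpoly (poly_rV (p %% D) : 'rV_k) = p %% D.
Proof.
by apply: poly_rV_K; rewrite -ltnS -size_monicS ltn_modp monic_neq0.
Qed.

Lemma rVpoly_mulX_companion (v : 'rV[F]_k) :
  rVpoly (v *m C) = (rVpoly v * 'X) %% D.
Proof.
have szD := size_monicS.
have [k0|k_gt0] := posnP k.
  have -> : rVpoly v = 0 by apply/size_poly_leq0P; rewrite -k0 size_poly.
  have -> : v *m C = 0 by move: (v *m C); rewrite k0 => u; exact: thinmx0.
  by rewrite mul0r mod0p linear0.
(* [z] is the coefficient of X^(k-1), so subtracting [z%:P * D] cancels the term in X^k and leaves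
   the reduced remainder. *)
pose z := (rVpoly v)`_k.-1.
apply/esym/eqP.
have -> : rVpoly v * 'X = z%:P * D + (rVpoly v * 'X - z%:P * D).
  by rewrite addrC subrK.
rewrite modpD modp_mull add0r modp_small.
  apply/eqP/polyP=> i; rewrite coefB coefCM coefMX coef_rVpoly.
  case: insubP => [j _ <-|]; last first.
    rewrite -leqNgt => le_ki; rewrite coef_rVpoly.
    move: le_ki; rewrite leq_eqVlt => /predU1P[<-|lt_ki].
      rewrite -/k eqn0Ngt k_gt0 /= -[k in D`_k]/((size D).-1) -lead_coefE.
      rewrite (monicP monD) mulr1 -/k /z coef_rVpoly; apply/subr0_eq.
      by rewrite subr0; apply/eqP; rewrite subr_eq0.
    rewrite nth_default ?szD // mulr0 subr0; case: eqP => // _.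
    by case: insubP => // j; lia.
  rewrite mxE (bigD1 (Ordinal (_ : k.-1 < k)%N)) /= ?prednK // => ltk.
  rewrite mxE /= eqxx mulrN addrC; congr (_ + _); last first.
    rewrite /z coef_rVpoly; case: insubP => [j' _ ej'|]; last by rewrite ltk.
    by congr (- (v _ _ * _)); apply: val_inj.
  rewrite coef_rVpoly.
  have [j0|j_gt0] := posnP j.
    rewrite big1 // => j' /negPf nej'; rewrite mxE j0.
    by case: ifP => [/eqP e|_]; [rewrite -val_eqE /= e eqxx in nej'
      | rewrite mulr0].
  case: insubP => [j1 _ ej1|]; last by rewrite (leq_ltn_trans (leq_pred _)) ?ltn_ord.
  rewrite (bigD1 j1) /=; last first.
    by rewrite -val_eqE /= ej1 -eqSS !prednK // neq_ltn ltn_ord.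
  rewrite mxE ej1; case: ifP => [/eqP e|_].
    by move: (ltn_ord j); rewrite -[nat_of_ord j]prednK // e prednK // ltnn.
  rewrite prednK // eqxx mulr1 big1 ?addr0 // => j' /andP[/negPf ne1 /negPf ne2].
  rewrite mxE; case: ifP => [/eqP e|_].
    by rewrite -val_eqE /= e eqxx in ne1.
  case: eqP => [e|_]; last by rewrite mulr0.
  by rewrite -val_eqE /= ej1 -eqSS prednK // e eqxx in ne2.
rewrite szD ltnS; apply/leq_sizeP => i; rewrite leq_eqVlt => /predU1P[<-|lt_ki].
  rewrite coefB coefCM coefMX eqn0Ngt k_gt0 /= -/z.
  by rewrite -[k in D`_k]/((size D).-1) -lead_coefE (monicP monD) mulr1 subrr.
rewrite coefB coefCM coefMX [D`_i]nth_default ?szD // mulr0 subr0.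
case: eqP => // _; rewrite nth_default //.
by rewrite (leq_trans (size_poly _ _)) // -ltnS (ltn_predK lt_ki).
Qed.

Lemma rVpoly_mul_polymx (v : 'rV[F]_k) p :
  rVpoly (v *m polymx C p) = (rVpoly v * p) %% D.
Proof.
elim/poly_ind: p v => [|p c IH] v.
  by rewrite polymx0 mulmx0 mulr0 mod0p linear0.
rewrite polymxD polymxM polymxX polymxC mulmxDr mulmxA linearD /= rVpoly_mulX_companion.
rewrite IH mul_mx_scalar linearZ /= mulrDr modpD; congr (_ + _).
  by rewrite mulrC modp_mul mulrC mulrA.
by rewrite mulrC mul_polyC modpZl rVpoly_modp.
Qed.

Lemma polymx_companion_eq0 p : (polymx C p == 0) = (D %| p).
Proof.
apply/eqP/idP => [C0|/dvdpP[q ->]].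
  have [k0|k_gt0] := posnP k.
    have /eqP: size D = 1%N by rewrite size_monicS k0.
    by rewrite size_poly_eq1 => /eqp_dvdl ->; rewrite dvd1p.
  have s1: (size (1%R : {poly F}) <= k)%N by rewrite size_poly1.
  have := rVpoly_mul_polymx (poly_rV 1) p.
  by rewrite C0 mulmx0 linear0 poly_rV_K // mul1r => /esym/modp_eq0P.
apply/row_matrixP=> i; rewrite row0 rowE; apply: (can_inj rVpolyK).
by rewrite rVpoly_mul_polymx mulrA modp_mull linear0.
Qed.

(** The image of p(C) is the ideal generated by g = gcd(D, p) in F[X]/(D), of dimension deg D - deg
    g. For a divisor g of D the bound [lower] counts the multiples of g; the opposite bound is
    [lower] for the cofactor h, because g(C) h(C) = 0. *)
Lemma rank_polymx_companion p :
  (\rank (polymx C p) + (size (gcdp D p)).-1)%N = k.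
Proof.
have szD := size_monicS; have nzD := monic_neq0 monD.
have lower g : g %| D -> (k <= \rank (polymx C g) + (size g).-1)%N.
  move=> gD; have nzg : g != 0 by apply: dvdpN0 gD nzD.
  pose r := (k - (size g).-1)%N.
  pose f (u : 'rV[F]_r) : 'rV[F]_k := poly_rV (rVpoly u * g).
  have sz_f (u : 'rV_r) : (size (rVpoly u * g)%R <= k)%N.
    have [->|nzu] := eqVneq (rVpoly u) 0; first by rewrite mul0r size_poly0.
    rewrite size_mul //; have : (size (rVpoly u) <= r)%N by rewrite size_poly.
    by have := dvdp_leq nzD gD; rewrite /r szD; lia.
  pose M := lin1_mx f.
  have fE u : u *m M = f u.
    by apply: mul_lin1 => c x y; rewrite /f !linearP /= mulrDl -scalerAl linearP.
  have freeM : row_free M.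
    apply/inj_row_free => u; rewrite fE => /(congr1 rVpoly).
    rewrite /f poly_rV_K // linear0 => /eqP; rewrite mulf_eq0 (negPf nzg) orbF.
    by move=> /eqP u0; rewrite -[u]rVpolyK u0 linear0.
  suff : (r <= \rank (polymx C g))%N by rewrite /r; lia.
  rewrite -(eqP freeM) mxrankS //.
  apply/row_subP => i; rewrite rowE fE.
  suff -> : f (delta_mx 0 i) = poly_rV (rVpoly (delta_mx 0 i)) *m polymx C g.
    exact: submxMl.
  apply: (can_inj rVpolyK); rewrite rVpoly_mul_polymx /f poly_rV_K // poly_rV_K.
    by rewrite modp_small // szD ltnS.
  by rewrite (leq_trans (size_poly _ _)) // leq_subr.
have exact g : g %| D -> (\rank (polymx C g) + (size g).-1)%N = k.
  move=> gD; apply/eqP; rewrite eqn_leq lower // andbT.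
  have /dvdpP[h Dh] := gD.
  have hD : h %| D by rewrite Dh dvdp_mulr.
  have nzh : h != 0 by apply: dvdpN0 hD nzD.
  have nzg : g != 0 by apply: dvdpN0 gD nzD.
  have /mulmx0_rank_max le_k : polymx C g *m polymx C h = 0.
    by rewrite -polymxM mulrC -Dh; apply/eqP; rewrite polymx_companion_eq0.
  have kE : k = ((size h).-1 + (size g).-1)%N.
    rewrite /k Dh size_mul //.
    by move: nzh nzg; rewrite -!size_poly_gt0; case: (size h) (size g) => [|a] [|b] //; rewrite addSn addnS.
  have := lower h hD; rewrite {1}kE addnC leq_add2r => le_g.
  by rewrite (leq_trans _ le_k) // leq_add2l.
rewrite -[RHS](exact _ (dvdp_gcdl D p)); congr (_ + _)%N; apply/eqP.
rewrite eqn_leq; apply/andP; split.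
  by have /dvdpP[u {1}->] := dvdp_gcdr D p; rewrite polymxM mxrankM_maxr.
(* Since D(C) = 0, the Bezout relation makes gcd(D, p)(C) a multiple of p(C) up to nonzero
   scalars. *)
have [[u v] /= /eqpP [[c1 c2] /= /andP[nz1 nz2] e]] := Bezoutp D p.
rewrite -(mxrank_scale_nz _ nz2) -[c2 *: polymx _ _]mul_scalar_mx -(polymxC C) -polymxM mul_polyC -e -mul_polyC.
rewrite polymxM polymxC mul_scalar_mx mxrank_scale_nz // polymxD !polymxM.
have /eqP-> : polymx C D == 0 by rewrite polymx_companion_eq0.
by rewrite mulmx0 add0r mxrankM_maxr.
Qed.

End Companion.

End PolyMx.

(** * Frobenius normal form *)

Section Similarity.

Variable F : fieldType.
Implicit Types (p q D : {poly F}) (s t : seq {poly F}).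

(* The sizes [m] and [n] are allowed to be only propositionally equal. *)
Definition simmx m n (A : 'M[F]_m) (B : 'M[F]_n) :=
  exists P : 'M_(m, n), exists Q : 'M_(n, m),
    [/\ P *m Q = 1%:M, Q *m P = 1%:M & A *m P = P *m B].

Lemma simmx_refl n (A : 'M_n) : simmx A A.
Proof. by exists 1%:M, 1%:M; rewrite !mulmx1 mul1mx. Qed.

Lemma simmx_sym m n (A : 'M_m) (B : 'M_n) : simmx A B -> simmx B A.
Proof.
move=> [P [Q [PQ QP AP]]]; exists Q, P; split=> //.
by rewrite -[RHS]mulmx1 -PQ mulmxA -(mulmxA Q) AP !mulmxA QP mul1mx.
Qed.

Lemma simmx_trans m n r (A : 'M_m) (B : 'M_n) (C : 'M_r) :
  simmx A B -> simmx B C -> simmx A C.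
Proof.
move=> [P [Q [PQ QP AP]]] [P' [Q' [PQ' QP' BP]]].
exists (P *m P'), (Q' *m Q); split.
- by rewrite mulmxA -(mulmxA P) PQ' mulmx1.
- by rewrite mulmxA -(mulmxA Q') QP mulmx1.
- by rewrite mulmxA AP -mulmxA BP mulmxA.
Qed.

Lemma simmx_size m n (A : 'M_m) (B : 'M_n) : simmx A B -> m = n.
Proof.
move=> [P [Q [PQ QP _]]]; apply/eqP; rewrite eqn_leq.
have le_rank k l (X : 'M[F]_(k, l)) Y : X *m Y = 1%:M -> (k <= l)%N.
  move=> XY; rewrite -(@mxrank1 F k) -XY (leq_trans (mxrankM_maxl _ _)) //.
  exact: rank_leq_col.
by rewrite (le_rank _ _ P Q) ?(le_rank _ _ Q P).
Qed.

Lemma simmx_conj n (A B : 'M_n) : simmx A B ->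
  exists2 P : 'M_n, P \in unitmx & A *m P = P *m B.
Proof. by move=> [P [Q [/mulmx1_unit[uP _] _ AP]]]; exists P. Qed.

Lemma conj_sim n (A B P : 'M_n) : P \in unitmx -> A *m P = P *m B -> simmx A B.
Proof.
by move=> uP AP; exists P, (invmx P); rewrite mulmxV ?mulVmx.
Qed.

Lemma simmx_rank_polymx m n (A : 'M_m) (B : 'M_n) p :
  simmx A B -> \rank (polymx A p) = \rank (polymx B p).
Proof.
move=> [P [Q [PQ QP /polymx_intertwine AP]]].
have eA : polymx A p = P *m polymx B p *m Q by rewrite -AP -mulmxA PQ mulmx1.
have eB : polymx B p = Q *m polymx A p *m P by rewrite -mulmxA AP mulmxA QP mul1mx.
apply/eqP; rewrite eqn_leq; apply/andP; split.
  by rewrite eA (leq_trans (mxrankM_maxl _ _)) ?mxrankM_maxr.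
by rewrite eB (leq_trans (mxrankM_maxl _ _)) ?mxrankM_maxr.
Qed.

Lemma simmx_block m1 m2 n1 n2 (A : 'M_m1) (B : 'M_m2) (A' : 'M_n1) (B' : 'M_n2) :
  simmx A A' -> simmx B B' -> simmx (block_mx A 0 0 B) (block_mx A' 0 0 B').
Proof.
move=> [P [Q [PQ QP AP]]] [P' [Q' [PQ' QP' BP]]].
exists (block_mx P 0 0 P'), (block_mx Q 0 0 Q').
rewrite !mulmx_block !mulmx0 !mul0mx !addr0 !add0r PQ PQ' QP QP' AP BP.
by rewrite -!scalar_mx_block.
Qed.

Lemma simmx_block0l n (B : 'M_n) : simmx (block_mx (0 : 'M_0) 0 0 B) B.
Proof.
suff -> : block_mx (0 : 'M_0) 0 0 B = B :> 'M_n by exact: simmx_refl.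
apply/matrixP=> i j; have e (k : 'I_n) : k = rshift 0 k by apply: val_inj.
apply: etrans (block_mxEdr (0 : 'M_0) 0 0 B i j).
by rewrite -(e i) -(e j).
Qed.

Fixpoint frobdim s : nat := if s is D :: s' then (size D).-1 + frobdim s' else 0%N.

Fixpoint frobmx s : 'M[F]_(frobdim s) :=
  match s return 'M_(frobdim s) with
  | D :: s' => block_mx (companionmx D) 0 0 (frobmx s')
  | [::] => 0
  end.

Lemma frobdimE s : frobdim s = (\sum_(D <- s) (size D).-1)%N.
Proof. by elim: s => [|D s IH]; rewrite ?big_nil // big_cons -IH. Qed.

(** The coranks of p(A) are similarity invariants, and they are the only link from a matrix to its
    chain: uniqueness of the chain and the rank hypothesis of [det_comm_power] are both read off
    from this formula. *)
Lemma corank_frobmx s p : {in s, forall D, D \is monic} ->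
  (\rank (polymx (frobmx s) p) + \sum_(D <- s) (size (gcdp D p)).-1)%N = frobdim s.
Proof.
elim: s => [|D s IH] mon; first by rewrite big_nil addn0 /= mxrank0.
rewrite big_cons /= polymx_block rank_diag_block_mx addnACA.
rewrite rank_polymx_companion ?mon ?mem_head // IH // => E sE.
by rewrite mon // inE sE orbT.
Qed.

Definition dvd_chain s := sorted (fun a b => b %| a) s.

Lemma dvd_chain_head D s E : dvd_chain (D :: s) -> E \in s -> E %| D.
Proof.
move=> /order_path_min h /(allP (h _)); apply => a b c /= ba cb.
exact: dvdp_trans cb ba.
Qed.

(* With [p] the first term of [s], equality of the degree sums forces the first
   term of [t] to divide it, and symmetrically. *)
Lemma dvd_chain_uniq s t :
    {in s, forall D, D \is monic} -> {in t, forall D, D \is monic} ->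
    dvd_chain s -> dvd_chain t -> size s = size t ->
    (forall p, \sum_(D <- s) (size (gcdp D p)).-1
               = \sum_(D <- t) (size (gcdp D p)).-1)%N ->
  s = t.
Proof.
elim: s t => [|D s IH] [|E t] // ms mt cs ct /= [sz] eq_corank.
have head_dvd a a' u u' : {in a :: u, forall D, D \is monic} ->
    {in a' :: u', forall D, D \is monic} -> dvd_chain (a :: u) ->
    (forall p, \sum_(D <- a :: u) (size (gcdp D p)).-1
             = \sum_(D <- a' :: u') (size (gcdp D p)).-1)%N -> a' %| a.
  (* [p = 0] yields the full degrees, as gcd(D, 0) = D; [p = a] yields the same left-hand sum, since
     every term of [a :: u] divides [a]. On the right no gcd can then lose degree. *)
  move=> mu mu' cu eqc; have := eqc a; have := eqc 0.
  have -> : (\sum_(D0 <- a :: u) (size (gcdp D0 0%R)).-1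
      = \sum_(D0 <- a :: u) (size (gcdp D0 a)).-1)%N.
    apply: eq_big_seq => x xu; have xa : x %| a.
      by move: xu; rewrite inE => /predU1P[->|/(dvd_chain_head cu)].
    congr _.-1; apply: eqp_size; rewrite eqp_sym.
    apply: eqp_trans (dvdp_gcd_idl xa) _; rewrite eqp_sym.
    exact: dvdp_gcd_idl.
  move=> -> /esym; rewrite !big_cons => e.
  have le_sum : (\sum_(j <- u') (size (gcdp j a)).-1
                  <= \sum_(j <- u') (size (gcdp j 0%R)).-1)%N.
    rewrite big_seq [X in (_ <= X)%N]big_seq leq_sum // => j ju.
    have nzj : j != 0 by rewrite monic_neq0 // mu' // inE ju orbT.
    have -> : size (gcdp j 0) = size j.
      by apply: eqp_size; exact: dvdp_gcd_idl.
    have := dvdp_leq nzj (dvdp_gcdl j a); rewrite -!subn1 => h; rewrite leq_sub2r //.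
  have nza : a' != 0 by rewrite monic_neq0 // mu' // mem_head.
  have sz0 : size (gcdp a' 0) = size a' by apply: eqp_size; exact: dvdp_gcd_idl.
  have gt0 : (0 < size (gcdp a' a))%N by rewrite size_poly_gt0 gcdp_eq0 (negPf nza).
  have le1 := dvdp_leq nza (dvdp_gcdl a' a).
  have : (size a' <= size (gcdp a' a))%N by move: e le_sum gt0; rewrite sz0; move: (size (gcdp a' a)) (size a') => x y; do 2!move: (\sum_(j <- u') _)%N => ?; lia.
  move=> le2; have : gcdp a' a %= a'.
    by rewrite -dvdp_size_eqp ?dvdp_gcdl // eqn_leq le1.
  by move=> /eqp_dvdl <-; exact: dvdp_gcdr.
have DE : D = E.
  have [mD mE] : D \is monic /\ E \is monic.
    by split; [apply: ms | apply: mt]; rewrite mem_head.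
  apply/eqP; rewrite -eqp_monic // /eqp; apply/andP; split.
    by apply: (head_dvd E D t s).
  by apply: (head_dvd D E s t).
rewrite -DE; congr (_ :: _).
apply: IH => //.
- by move=> x xs; rewrite ms // inE xs orbT.
- by move=> x xs; rewrite mt // inE xs orbT.
- exact: path_sorted cs.
- exact: path_sorted ct.
by move=> p; have := eq_corank p; rewrite !big_cons DE => /addnI.
Qed.

Lemma simmx_frobmx_uniq s t :
    {in s, forall D, D \is monic} -> {in t, forall D, D \is monic} ->
    dvd_chain s -> dvd_chain t -> size s = size t -> simmx (frobmx s) (frobmx t) ->
  s = t.
Proof.
move=> ms mt cs ct sz st; apply: dvd_chain_uniq => // p.
have := corank_frobmx p ms; have := corank_frobmx p mt.
have := simmx_size st; rewrite (simmx_rank_polymx p st); lia.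
Qed.

(** Used to pad every list of invariant factors to length exactly n. *)
Lemma simmx_frobmx_cat1 s k : simmx (frobmx (s ++ nseq k 1)) (frobmx s).
Proof.
elim: s => [|D s IH] /=; last exact/simmx_block/IH/simmx_refl.
elim: k => [|k IH]; first exact: simmx_refl.
apply: simmx_trans IH => /=.
move: (companionmx _); rewrite size_poly1 => C; rewrite [C]flatmx0.
exact: simmx_block0l.
Qed.

End Similarity.

Section CyclicDecomposition.

Variable F : finFieldType.
Implicit Types (p q D : {poly F}).

(** The annihilator is a monic polynomial of least degree killing [v]. Encoding such polynomials as
    X^d plus a row vector over a finite field makes the search decidable, and Cayley-Hamilton makes
    it succeed. *)
Lemma vector_annihilator n (A : 'M[F]_n) (v : 'rV_n) :
  exists2 mu : {poly F}, mu \is monic &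
    forall p, (v *m polymx A p == 0) = (mu %| p).
Proof.
pose P d := [exists c : 'rV[F]_d, v *m polymx A ('X^d + rVpoly c) == 0].
have exP : exists d, P d.
  exists n; apply/existsP; exists (poly_rV (char_poly A - 'X^n)).
  rewrite poly_rV_K; last first.
    apply/leq_sizeP => i le_ni; rewrite coefB coefXn.
    have /monicP := char_poly_monic A; rewrite lead_coefE size_char_poly /=.
    move: le_ni; rewrite leq_eqVlt => /predU1P[<- ->|lt_ni _].
      by rewrite eqxx subrr.
    by rewrite nth_default ?size_char_poly // (gtn_eqF lt_ni) subr0.
  rewrite addrC subrK; suff -> : polymx A (char_poly A) = 0 by rewrite mulmx0.
  by case: n A {v P} => // n A; exact: Cayley_Hamilton.
pose d := ex_minn exP; pose dP := ex_minnP exP.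
have [c /eqP vc] : exists c : 'rV[F]_d, v *m polymx A ('X^d + rVpoly c) == 0.
  by rewrite /d; case: ex_minnP => m /existsP.
have d_min e (w : 'rV[F]_e) : v *m polymx A ('X^e + rVpoly w) = 0 -> (d <= e)%N.
  by rewrite /d; case: ex_minnP => m _ mP w0; apply/mP/existsP; exists w; apply/eqP.
pose mu := 'X^d + rVpoly c.
have szc : (size (rVpoly c) < size ('X^d : {poly F}))%N.
  by rewrite size_polyXn ltnS size_poly.
have mon : mu \is monic.
  by rewrite monicE lead_coefDl // lead_coefXn.
have szmu : size mu = d.+1 by rewrite size_polyDl // size_polyXn.
exists mu => // p; apply/eqP/idP => [vp|/dvdpP[q ->]]; last first.
  by rewrite mulrC polymxM mulmxA vc mul0mx.
apply/modp_eq0P; apply/eqP/negPn/negP => nzr.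
set r := p %% mu in nzr.
have vr : v *m polymx A r = 0.
  move: vp; rewrite (divp_eq p mu) -/r polymxD polymxM mulmxDr polymx_comm mulmxA vc.
  by rewrite mul0mx add0r.
have lt_r : (size r <= d)%N by rewrite -ltnS -szmu ltn_modp monic_neq0.
pose r1 := (lead_coef r)^-1 *: r.
have szr1 : size r1 = size r by rewrite size_scale // invr_eq0 lead_coef_eq0.
have mr1 : r1 \is monic by rewrite monicE lead_coefZ mulVf ?lead_coef_eq0.
pose e := (size r).-1.
have szr : size r = e.+1 by rewrite prednK // size_poly_gt0.
have : (d <= e)%N.
  apply: (d_min e (poly_rV (r1 - 'X^e))); rewrite poly_rV_K; last first.
    apply/leq_sizeP => i le_ni; rewrite coefB coefXn.
    have /monicP := mr1; rewrite lead_coefE szr1 szr /=.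
    move: le_ni; rewrite leq_eqVlt => /predU1P[<- ->|lt_ni _].
      by rewrite eqxx subrr.
    by rewrite nth_default ?szr1 ?szr // (gtn_eqF lt_ni) subr0.
  rewrite addrC subrK /r1 -mul_polyC polymxM polymxC mul_scalar_mx -scalemxAr vr.
  by rewrite scaler0.
by move: lt_r; rewrite szr; lia.
Qed.

End CyclicDecomposition.

(** * Irreducible factors and prime powers of polynomials *)

Section PolyFactor.

Variable F : finFieldType.
Implicit Types (p q f a b : {poly F}).

(** A nonconstant divisor of least degree is irreducible; the finite types of polynomials of bounded
    size make its choice constructive. *)
Lemma irreducible_divisor p : (1 < size p)%N ->
  exists f, [/\ irreducible_poly f, f \is monic & f %| p].
Proof.
move=> p_gt1.
pose P k := [exists q : {poly_k F}, (1 < size q)%N && (val q %| p)].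
have exP : exists k, P k.
  by exists (size p); apply/existsP; exists (npolyp (size p) p); rewrite /= npolypK // p_gt1 dvdpp.
have [q [q_gt1 qp q_min]] : exists q, [/\ (1 < size q)%N, q %| p &
    forall r : {poly F}, (1 < size r)%N -> r %| p -> (size q <= size r)%N].
  case: (ex_minnP exP) => k /existsP[q /andP[q_gt1 qp] kP].
  exists q; split=> // r r_gt1 rp; apply: leq_trans (size_npoly q) _.
  by apply/kP/existsP; exists (npolyp (size r) r); rewrite /= npolypK // r_gt1.
have nzq : q != 0 by rewrite -size_poly_gt0 ltnW.
have nzl : (lead_coef q)^-1 != 0 by rewrite invr_eq0 lead_coef_eq0.
have ef : (lead_coef q)^-1 *: q %= q by rewrite eqp_scale.
exists ((lead_coef q)^-1 *: q); split.
- split=> [|r r1 rq]; first by rewrite size_scale.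
  rewrite (eqp_dvdr _ ef) in rq; rewrite (eqp_rtrans ef).
  have nzr : r != 0 by apply: dvdpN0 rq nzq.
  rewrite -dvdp_size_eqp // eqn_leq dvdp_leq //= q_min //.
    by move: r1 nzr; rewrite -size_poly_gt0; case: size => [|[]].
  exact: dvdp_trans rq qp.
- by rewrite monicE lead_coefZ mulVf // lead_coef_eq0.
- by rewrite (eqp_dvdl _ ef).
Qed.

Lemma coprimep_irreducible f g : irreducible_poly f -> irreducible_poly g ->
  f \is monic -> g \is monic -> f != g -> coprimep f g.
Proof.
move=> irf irg mf mg nefg; rewrite irreducible_poly_coprime //.
apply: contra nefg => fg; rewrite -eqp_monic //.
by case: irg => _; apply=> //; case: irf; rewrite neq_ltn orbC => ->.
Qed.

Lemma prime_power_factor f p : irreducible_poly f -> p != 0 ->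
  exists k r, p = f ^+ k * r /\ ~~ (f %| r).
Proof.
move=> irf; have [m] := ubnP (size p); elim: m p => // m IH p le_m nzp.
have [/dvdpP[r pE]|] := boolP (f %| p); last by exists 0%N, p; rewrite mul1r.
have nzr : r != 0 by apply: contraNneq nzp => r0; rewrite pE r0 mul0r.
have f_gt1 : (1 < size f)%N by case: irf.
have szp : size p = (size r + size f).-1 by rewrite pE size_mul // irredp_neq0.
have [|//|k [r' [rE nfr']]] := IH r.
  by move: le_m szp f_gt1; move: (size p) (size r) (size f); lia.
by exists k.+1, r'; split=> //; rewrite pE rE exprSr mulrAC.
Qed.

(** Strip a common irreducible factor [f] from [a] and [b]. The prime power found for the quotients
    gains one factor if its base is [f]; otherwise it is kept, its base being coprime to [f]. *)
Lemma not_dvdp_prime_power a b : a != 0 -> ~~ (a %| b) ->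
  exists f k, [/\ irreducible_poly f, f \is monic, f ^+ k %| a & ~~ (f ^+ k %| b)].
Proof.
have [m] := ubnP (size a); elim: m a b => // m IH a b le_m nza nab.
have a_gt1 : (1 < size a)%N.
  rewrite ltnNge; apply: contra nab => a_le1.
  have : (size a == 1)%N.
    by move: nza a_le1; rewrite -size_poly_gt0; move: (size a); lia.
  by rewrite size_poly_eq1 => /eqp_dvdl ->; rewrite dvd1p.
have [f [irf mf fa]] := irreducible_divisor a_gt1.
have f_gt1 : (1 < size f)%N by case: irf.
have [fb|nfb] := boolP (f %| b); last by exists f, 1%N; rewrite expr1.
have /dvdpP[a' aE] := fa; have /dvdpP[b' bE] := fb.
have nza' : a' != 0 by apply: contraNneq nza => e; rewrite aE e mul0r.
have nzf := irredp_neq0 irf.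
have sza : size a = (size a' + size f).-1 by rewrite aE size_mul.
have [|//||g [k [irg mg gka ngkb]]] := IH a' b'.
- by move: le_m sza f_gt1; move: (size a) (size a') (size f); lia.
- by apply: contra nab => h; rewrite aE bE dvdp_mul2r.
have [efg|nefg] := eqVneq f g.
  exists f, k.+1; rewrite exprSr aE bE !dvdp_mul2r // efg; split=> //.
exists g, k; split=> //;  first by rewrite aE dvdp_mulr.
rewrite bE Gauss_dvdpl //; apply: coprimep_expl.
by rewrite coprimep_sym coprimep_irreducible.
Qed.

End PolyFactor.

(** * Existence of the invariant factors *)

Section InvariantFactors.

Variable F : finFieldType.
Implicit Types (p q D mu : {poly F}).

Lemma polymx_char_poly n (A : 'M[F]_n) : polymx A (char_poly A) = 0.
Proof. by case: n A => // n A; exact: Cayley_Hamilton. Qed.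

(* As long as some prime power [f ^+ k] divides the annihilator of [u] but not
   that of [v], a combination of [u] and [v] has a larger annihilator. *)
Lemma vector_full_annihilator n (A : 'M[F]_n) :
  exists v : 'rV_n, exists mu : {poly F}, [/\ mu \is monic, polymx A mu = 0 &
    forall p, (v *m polymx A p == 0) = (mu %| p)].
Proof.
suff step m (v : 'rV_n) mu : (n.+1 - size mu < m)%N -> mu \is monic ->
    (forall p, (v *m polymx A p == 0) = (mu %| p)) ->
    exists v : 'rV_n, exists mu : {poly F}, [/\ mu \is monic, polymx A mu = 0 &
    forall p, (v *m polymx A p == 0) = (mu %| p)].
  by have [mu mon muP] := vector_annihilator A 0; apply: (step _ 0 mu (leqnn _)).
elim: m v mu => // m IH v mu le_m mon muP.
have [mu0|nz] := eqVneq (polymx A mu) 0; first by exists v, mu.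
have [i nzi] : exists i, row i (polymx A mu) != 0.
  apply/existsP; apply: contra_neqT nz; rewrite negb_exists => /forallP h.
  by apply/row_matrixP => i; rewrite row0; have := h i; rewrite negbK => /eqP.
pose u : 'rV[F]_n := delta_mx 0 i.
have [a mona aP] := vector_annihilator A u.
have na : ~~ (a %| mu) by rewrite -aP -rowE.
have [f [k [irf monf fka nfk]]] := not_dvdp_prime_power (monic_neq0 mona) na.
have nzmu := monic_neq0 mon.
have [j [m0 [muE nfm0]]] := prime_power_factor irf nzmu.
have lt_jk : (j < k)%N.
  by rewrite ltnNge; apply: contra nfk => le_kj; rewrite muE dvdp_mulr // dvdp_exp2l.
have nzf : f != 0 := irredp_neq0 irf.
have nzm0 : m0 != 0 by apply: contraNneq nzmu => e; rewrite muE e mulr0.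
have /dvdpP[a1 aE] := fka.
have cop : coprimep (f ^+ k) m0.
  by rewrite coprimep_expl // irreducible_poly_coprime.
(* The two summands have the coprime annihilators [f ^+ k] and [m0], so [w] is only killed by
   multiples of their product, which has larger degree than [mu = f ^+ j * m0]. *)
pose w := u *m polymx A a1 + v *m polymx A (f ^+ j).
have [nu monnu nuP] := vector_annihilator A w.
have wnu : w *m polymx A nu = 0 by apply/eqP; rewrite nuP.
have fk_nu : f ^+ k %| nu.
  rewrite -(Gauss_dvdpl _ cop) -(@dvdp_mul2l _ a1); last first.
    by apply: contraNneq (monic_neq0 mona) => e; rewrite aE e mul0r.
  rewrite -aE -aP; apply/eqP.
  have : w *m polymx A (nu * m0) = 0 by rewrite polymxM mulmxA wnu mul0mx.
  rewrite mulmxDl -!mulmxA -!polymxM [f ^+ j * _]mulrCA -muE.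
  have /eqP-> : v *m polymx A (nu * mu) == 0 by rewrite muP dvdp_mulIr.
  by rewrite addr0.
have m0_nu : m0 %| nu.
  rewrite -(@Gauss_dvdpr _ _ (f ^+ k)) 1?coprimep_sym //.
  rewrite -(@dvdp_mul2l _ (f ^+ j)) ?expf_neq0 // -muE -muP.
  have : w *m polymx A (nu * f ^+ k) = 0 by rewrite polymxM mulmxA wnu mul0mx.
  rewrite mulmxDl -!mulmxA -!polymxM.
  have /eqP-> : u *m polymx A (a1 * (nu * f ^+ k)) == 0.
    by rewrite aP mulrCA -aE dvdp_mulIr.
  by rewrite add0r [nu * _]mulrC => ->.
have lt_sz : (size mu < size nu)%N.
  have : f ^+ k * m0 %| nu by rewrite Gauss_dvdp // fk_nu.
  move=> /(dvdp_leq (monic_neq0 monnu)); apply: leq_trans.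
  rewrite muE !size_mul ?expf_neq0 //.
  have f_gt1 : (1 < size f)%N by case: irf.
  have szf e : size (f ^+ e) = ((size f).-1 * e).+1.
    by rewrite -size_exp prednK // size_poly_gt0 expf_neq0.
  have m0_gt0 : (0 < size m0)%N by rewrite size_poly_gt0.
  have lt_fjk : ((size f).-1 * j < (size f).-1 * k)%N.
    by rewrite ltn_pmul2l // -subn1 subn_gt0.
  rewrite !szf; move: lt_fjk m0_gt0.
  move: ((size f).-1 * j)%N ((size f).-1 * k)%N (size m0) => x y z.
  by rewrite !addSn /= ltn_add2r.
apply: (IH w nu) => //.
have : (size nu <= n.+1)%N.
  rewrite -(size_char_poly A) dvdp_leq ?monic_neq0 ?char_poly_monic //.
  by rewrite -nuP polymx_char_poly mulmx0.
by move: le_m lt_sz; move: (size mu) (size nu); clear; lia.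
Qed.

(* The complement of the cyclic subspace generated by [v] is the common kernel
   of [phi], [A phi], [A^2 phi], ..., where the functional [phi] vanishes on all
   [v A^i] with [i < k - 1] and is [1] on [v A^(k-1)]. *)
Lemma cyclic_decomposition n (A : 'M[F]_n) :
  exists mu : {poly F}, exists r, exists B : 'M_r,
    [/\ mu \is monic, (0 < n)%N -> (1 < size mu)%N, polymx A mu = 0, polymx B mu = 0 &
        simmx A (block_mx (companionmx mu) 0 0 B)].
Proof.
have [v [mu [mon mu0 muP]]] := vector_full_annihilator A.
have szmu := size_monicS mon; set k := (size mu).-1 in szmu.
pose R : 'M[F]_(k, n) := lin1_mx (fun u => v *m polymx A (rVpoly u)).
have RE u : u *m R = v *m polymx A (rVpoly u).
  apply: mul_lin1 => c x y; rewrite linearP /= -mul_polyC polymxD polymxM polymxC.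
  by rewrite mul_scalar_mx mulmxDr scalemxAr.
have modE q : polymx A (q %% mu) = polymx A q.
  by rewrite [in RHS](divp_eq q mu) polymxD polymxM mu0 mulmx0 add0r.
have RA : R *m A = companionmx mu *m R.
  apply/row_matrixP=> i; rewrite !row_mul !rowE !RE.
  by rewrite rVpoly_mulX_companion // modE polymxM polymxX mulmxA.
have freeR : row_free R.
  apply: inj_row_free => u /eqP; rewrite RE muP => /modp_eq0P.
  by rewrite rVpoly_modp // => u0; rewrite -[u]rVpolyK u0 linear0.
(* [e] selects the last coordinate, so [phi] sends v q(A) to the coefficient of X^(k-1) in q. *)
pose e : 'cV[F]_k := \col_i (i.+1 == k)%:R.
pose phi := pinvmx R *m e.
have phiE q : (size q <= k)%N -> v *m polymx A q *m phi = (q`_k.-1)%:M.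
  move=> szq; rewrite -(poly_rV_K szq) -RE /phi mulmxA -(mulmxA _ R) mulmxVp //.
  rewrite mulmx1 coef_rVpoly; apply/matrixP=> x y; rewrite !ord1 !mxE eqxx mulr1n.
  case: insubP => [j _ ej|]; last first.
    rewrite -leqNgt => k0; rewrite big1 // => j; move: (ltn_ord j) k0; clear; lia.
  rewrite (bigD1 j) //= !mxE ej prednK ?eqxx ?mulr1; last by move: (ltn_ord j); clear; lia.
  rewrite big1 ?addr0 // => j' ne; rewrite !mxE.
  case: eqP => [e'|_]; last by rewrite mulr0.
  by case/eqP: ne; apply: val_inj; rewrite /= ej; exact: (congr1 predn e').
pose L : 'M[F]_(k, n) := lin1_mx (fun u => (polymx A (rVpoly u) *m phi)^T).
have LE u : u *m L = (polymx A (rVpoly u) *m phi)^T.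
  apply: mul_lin1 => c x y; rewrite linearP /= -mul_polyC polymxD polymxM polymxC.
  by rewrite mul_scalar_mx mulmxDl -scalemxAl linearP.
have LP m (W : 'M_(m, n)) :
    (W *m L^T == 0) <-> (forall q, W *m polymx A q *m phi = 0).
  split=> [/eqP WL q|h].
    have := congr1 (fun M => M *m (poly_rV (q %% mu))^T) WL.
    rewrite /= -(mulmxA W L^T) -trmx_mul LE trmxK poly_rV_modpK // modE mul0mx => h.
    by rewrite -mulmxA.
  rewrite -trmx_eq0 trmx_mul trmxK; apply/eqP/row_matrixP => i.
  rewrite row_mul rowE LE -trmx_mul mulmxA h trmx0 row0 //.
pose K := kermx L^T; pose r := \rank K; pose W : 'M_(r, n) := row_base K.
have WL q : W *m polymx A q *m phi = 0.
  by apply: (LP _ W).1; rewrite -sub_kermx eq_row_base.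
have WA : (W *m A <= W)%MS.
  apply: submx_trans (_ : (K <= W)%MS); last by rewrite eq_row_base.
  rewrite sub_kermx; apply/LP => q.
  by rewrite -(mulmxA W) -{1}(polymxX A) -polymxM WL.
pose B := W *m A *m pinvmx W.
have BW : B *m W = W *m A by rewrite mulmxKpV.
have freeW : row_free W by exact: row_base_free.
pose P := col_mx R W.
have freeP : row_free P.
  apply: inj_row_free => x; rewrite -[x]hsubmxK mul_row_col.
  set u := lsubmx x; set w := rsubmx x => x0.
  have u0 : u = 0.
    apply: contraTeq isT => nzu; have nzp : rVpoly u != 0.
      by apply: contra nzu => /eqP p0; rewrite -[u]rVpolyK p0 linear0.
    have szp : (size (rVpoly u) <= k)%N by rewrite size_poly.
    set m := (size (rVpoly u)).-1.
    have szpm : size (rVpoly u) = m.+1 by rewrite prednK // size_poly_gt0.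
    (* The shift moves the leading coefficient of [u] to degree k - 1, where [phi] reads it; the
       part coming from [W] is invisible to [phi]. *)
    have := congr1 (fun M => M *m polymx A 'X^(k.-1 - m) *m phi) x0.
    rewrite /= !mulmxDl -(mulmxA w W) -(mulmxA w _ phi) WL mulmx0 addr0 RE -(mulmxA v) -polymxM phiE; last first.
      by rewrite size_mulXn //; move: szp; rewrite szpm; clear; lia.
    rewrite coefMXn !mul0mx ltnNge leq_subr /= subKn; last first.
      by move: szp; rewrite szpm; clear; lia.
    move=> /matrixP/(_ 0 0); rewrite !mxE eqxx mulr1n => /eqP.
    by rewrite -[m]/(_.-1) -lead_coefE lead_coef_eq0 (negPf nzp).
  rewrite u0; move: x0; rewrite u0 mul0mx add0r => /eqP.
  by rewrite mulmx_free_eq0 // => /eqP->; rewrite row_mx0.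
have kr : (k + r)%N = n.
  apply/eqP; rewrite eqn_leq -{1}(eqP freeP) rank_leq_col /=.
  have := mxrank_ker L^T; rewrite -/K -/r.
  move: (rank_leq_col L^T) (rank_leq_row L^T).
  by move: (\rank L^T) (\rank K); clear; lia.
have fullP : row_full P by rewrite /row_full (eqP freeP) kr.
exists mu, r, B; split=> //.
- move=> n_gt0; rewrite ltnNge; apply/negP => mu_le1.
  have /eqP : size mu == 1%N by move: mu_le1; rewrite szmu; lia.
  move/eqP; rewrite size_poly_eq1 => mu1.
  have : 1%:M = 0 :> 'M[F]_n.
    by rewrite -(polymx1 A); move: mu1; rewrite eqp_monic ?monic1 // => /eqP <-.
  by move/matrixP/(_ (Ordinal n_gt0) (Ordinal n_gt0))/eqP; rewrite !mxE eqxx oner_eq0.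
- have := polymx_intertwine mu BW; rewrite mu0 mulmx0 => /eqP.
  by rewrite mulmx_free_eq0 // => /eqP.
apply: simmx_sym; exists P, (pinvmx P); split; first exact: mulmxVp.
  exact: mulVpmx.
by rewrite mul_block_col !mul0mx addr0 add0r mul_col_mx BW RA.
Qed.

(** The last clause carries the induction: the complement [B] also satisfies mu(B) = 0, hence every
    invariant factor of [B] divides mu, which is the chain condition for the new head. *)
Lemma invariant_factors n (A : 'M[F]_n) :
  exists s : seq {poly F}, [/\ {in s, forall D, D \is monic}, dvd_chain s,
    (size s <= n)%N, simmx A (frobmx s) &
    forall mu, polymx A mu = 0 -> {in s, forall D, D %| mu}].
Proof.
have [m] := ubnP n; elim: m n A => // m IH n A lt_nm.
have [n0|n_gt0] := posnP n.
  subst n; exists [::]; split=> //; rewrite [A]flatmx0 /=; exact: simmx_refl.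
have [mu [r [B [mon mu_gt1 mu0 Bmu0 simAB]]]] := cyclic_decomposition A.
have nE := simmx_size simAB; have szmu := mu_gt1 n_gt0.
have [|s [ms cs szs simB sP]] := IH r B.
  by move: nE szmu lt_nm; move: (size mu); clear; lia.
exists (mu :: s); split.
- by move=> D; rewrite inE => /predU1P[->|/ms].
- rewrite /dvd_chain /=; case: s {ms szs simB} sP cs => //= D s sP cs.
  by rewrite cs andbT sP ?mem_head.
- by move: nE szmu szs => /=; move: (size mu) (size s); clear; lia.
- by apply: simmx_trans simAB _; apply: simmx_block => //; exact: simmx_refl.
move=> p p0; have mup : mu %| p.
  rewrite -polymx_companion_eq0 //; move: simAB => [P [Q [PQ QP /polymx_intertwine AP]]].
  have := AP p; rewrite p0 mul0mx => /(congr1 (mulmx Q)).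
  rewrite mulmx0 mulmxA QP mul1mx polymx_block => /(congr1 ulsubmx).
  by rewrite block_mxKul => <-; apply/eqP/matrixP => i j; rewrite !mxE.
by move=> D; rewrite inE => /predU1P[->//|/(sP _ Bmu0) h]; apply: dvdp_trans mup.
Qed.

End InvariantFactors.

(** * Determinants of the centralizer *)

Section RestrictedDet.

Variable F : fieldType.
Implicit Types (p q D : {poly F}).

(** The determinant of [X] acting on the row space of [U], meaningful when that space is stable
    under [X]. *)
Definition restrict_det k n (X : 'M[F]_n) (U : 'M_(k, n)) : F :=
  \det (restrictmx U X).

Lemma restrict_detE n (X : 'M[F]_n) k (U : 'M_(k, n)) r (W : 'M_(r, n)) (Y : 'M_r) :
  row_free W -> (W :=: U)%MS -> W *m X = Y *m W -> restrict_det X U = \det Y.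
Proof.
move=> freeW eqWU WX; rewrite /restrict_det /conjmx.
have freeU := row_base_free U.
have eqU : (row_base U :=: W)%MS by apply: eqmx_trans (eq_row_base U) (eqmx_sym eqWU).
have er : \rank U = r by rewrite -(eqP freeW) eqWU.
move: (row_base U) freeU eqU; rewrite er => V freeV eqVW.
pose P := V *m pinvmx W; pose Q := W *m pinvmx V.
have PW : P *m W = V by rewrite mulmxKpV // eqVW.
have QV : Q *m V = W by rewrite mulmxKpV // eqVW.
have PQ : P *m Q = 1%:M.
  apply: (row_free_inj freeV); rewrite -mulmxA QV PW mul1mx //.
have -> : V *m X *m pinvmx V = P *m Y *m Q.
  by rewrite -{1}PW -(mulmxA P) WX !mulmxA.
rewrite !det_mulmx mulrAC -det_mulmx PQ det1 mul1r //.
Qed.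

Lemma restrict_det1 n (X : 'M[F]_n) : restrict_det X (1%:M : 'M_n) = \det X.
Proof.
apply: (@restrict_detE _ _ _ _ _ 1%:M) => //; last by rewrite mulmx1 mul1mx.
by rewrite row_free_unit unitmx1.
Qed.

Lemma restrict_det0 n (X : 'M[F]_n) : restrict_det X (0 : 'M_n) = 1.
Proof.
rewrite (@restrict_detE _ _ _ _ 0 0 0) ?det_mx00 //; last by rewrite !mul0mx.
  by rewrite -row_leq_rank.
by apply/eqmxP; rewrite !sub0mx.
Qed.

Lemma restrict_stable k n (X : 'M[F]_n) (U : 'M_(k, n)) :
  stablemx U X -> row_base U *m X = restrictmx U X *m row_base U.
Proof. by move=> UX; rewrite mulmxKpV // stablemx_row_base. Qed.

Lemma eq_restrict_det k l n (X : 'M[F]_n) (U : 'M_(k, n)) (V : 'M_(l, n)) :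
  stablemx V X -> (U :=: V)%MS -> restrict_det X U = restrict_det X V.
Proof.
move=> VX eqUV; apply: restrict_detE (row_base_free V) _ (restrict_stable VX).
exact: eqmx_trans (eq_row_base V) (eqmx_sym eqUV).
Qed.

(** As [X] commutes with [B], it is block triangular in a basis made of a basis of U cap ker B and
    of lifts of a basis of the image U B. *)
Lemma restrict_det_mul_ker k n (X B : 'M[F]_n) (U : 'M_(k, n)) :
  stablemx U X -> comm_mx X B ->
  restrict_det X U = restrict_det X (U :&: kermx B)%MS * restrict_det X (U *m B).
Proof.
move=> UX XB.
set Z0 := (U :&: kermx B)%MS; set W0 := U *m B.
have ZX : stablemx Z0 X.
  rewrite sub_capmx (submx_trans (submxMr _ (capmxSl _ _))) //=.
  rewrite sub_kermx -mulmxA XB mulmxA.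
  have /sub_kermxP-> : (Z0 <= kermx B)%MS by exact: capmxSr.
  by rewrite mul0mx.
have WX : stablemx W0 X by rewrite -mulmxA -XB mulmxA submxMr.
pose Z := row_base Z0; pose W := row_base W0.
have /submxP[S WE] : (W <= U *m B)%MS by rewrite eq_row_base.
pose L := S *m U; have LB : L *m B = W by rewrite -mulmxA -WE.
have ZB : Z *m B = 0.
  by apply/sub_kermxP; rewrite eq_row_base; exact: capmxSr.
pose V := col_mx Z L.
have freeZ : row_free Z := row_base_free _.
have freeW : row_free W := row_base_free _.
have freeV : row_free V.
  apply: inj_row_free => x; rewrite -[x]hsubmxK mul_row_col.
  set a := lsubmx x; set b := rsubmx x => x0.
  have b0 : b = 0.
    have /eqP := congr1 (mulmx^~ B) x0.
    rewrite /= mulmxDl -(mulmxA a Z B) -(mulmxA b L B) ZB LB mulmx0 add0r mul0mx.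
    by rewrite mulmx_free_eq0 // => /eqP.
  move: x0; rewrite b0 mul0mx addr0 => /eqP.
  by rewrite mulmx_free_eq0 // => /eqP->; rewrite row_mx0.
have VU : (V <= U)%MS.
  by rewrite col_mx_sub submxMl andbT eq_row_base capmxSl.
have eqVU : (V :=: U)%MS.
  apply/eqmxP; rewrite VU -(geq_leqif (mxrank_leqif_sup VU)) (eqP freeV).
  by rewrite andTb -(mxrank_mul_ker U B) addnC.
have /submxP[cd LX] : (L *m X <= V)%MS.
  by rewrite eqVU (submx_trans _ UX) // submxMr // submxMl.
rewrite -[cd]hsubmxK mul_row_col in LX; set c := lsubmx cd in LX.
set e := rsubmx cd in LX.
have WeX : W *m X = e *m W.
  rewrite -{1}LB -(mulmxA L B X) -XB (mulmxA L X B) LX mulmxDl.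
  by rewrite -(mulmxA c Z B) -(mulmxA e L B) ZB LB mulmx0 add0r.
have ZyX := restrict_stable ZX.
rewrite (@restrict_detE _ _ _ _ _ V (block_mx (restrictmx Z0 X) 0 c e)) //; last first.
  by rewrite mul_col_mx mul_block_col mul0mx addr0 LX -ZyX.
rewrite det_lblock; congr (_ * _); apply/esym.
by apply: (restrict_detE freeW _ WeX); exact: eq_row_base.
Qed.

(* [restrict_det X (ker p(A) cap im p(A)^k)] depends only on [k %/ d]. *)
Lemma det_comm_power n (A X : 'M[F]_n) p N d : (0 < d)%N -> comm_mx A X ->
    polymx A (p ^+ N) = 0 ->
    (forall i, ~~ (d %| i.+1)%N ->
      \rank (polymx A (p ^+ i)) + \rank (polymx A (p ^+ i.+2))
        = (\rank (polymx A (p ^+ i.+1))).*2)%N ->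
  exists c, \det X = c ^+ d.
Proof.
move=> d_gt0 AX pN0 rankE.
have XA q : comm_mx X (polymx A q).
  by apply/esym/polymx_intertwine.
pose I k := polymx A (p ^+ k); pose B := polymx A p.
pose Z k := (I k :&: kermx B)%MS.
have IS k : I k *m B = I k.+1 by rewrite /I exprSr polymxM.
have IX k : stablemx (I k) X by rewrite -XA submxMl.
have ZX k : stablemx (Z k) X.
  rewrite sub_capmx (submx_trans (submxMr _ (capmxSl _ _))) //=.
  rewrite sub_kermx -mulmxA XA mulmxA.
  have /sub_kermxP-> : (Z k <= kermx B)%MS by exact: capmxSr.
  by rewrite mul0mx.
pose g k := restrict_det X (Z k).
have gI k : restrict_det X (I k) = g k * restrict_det X (I k.+1).
  by rewrite (restrict_det_mul_ker (IX k) (XA p)) IS.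
have detX M : \det X = (\prod_(0 <= k < M) g k) * restrict_det X (I M).
  elim: M => [|M IH].
    by rewrite big_geq // mul1r /I expr0 polymx1 restrict_det1.
  by rewrite big_nat_recr //= -mulrA -gI.
(* The dimension of [Z k] is the rank drop from [I k] to [I k.+1], so [rankE] says that [Z k.+1],
   contained in [Z k], has the same dimension. *)
have gS k : ~~ (d %| k.+1)%N -> g k.+1 = g k.
  move=> nd; apply: eq_restrict_det (ZX k) _; apply/eqmxP.
  have sub : (Z k.+1 <= Z k)%MS.
    rewrite capmxS // /I exprS polymxM submxMl //.
  rewrite sub /= -(geq_leqif (mxrank_leqif_sup sub)).
  have := mxrank_mul_ker (I k) B; have := mxrank_mul_ker (I k.+1) B.
  rewrite !IS -/(Z _) -/(Z _); have := rankE k nd; rewrite -/(I _) -/(I _) -/(I _).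
  move: (\rank (I k)) (\rank (I k.+1)) (\rank (I k.+2)) (\rank (Z k)) (\rank (Z k.+1)).
  clear; lia.
have gD m j : (j < d)%N -> g (m * d + j)%N = g (m * d)%N.
  elim: j => [|j IH] lt_jd; first by rewrite addn0.
  rewrite addnS gS; first by rewrite IH // ltnW.
  by rewrite -addnS dvdn_addr ?dvdn_mull // gtnNdvd.
exists (\prod_(0 <= m < N) g (m * d)%N).
(* Going up to N d, where the power of p(A) is still zero, exhausts the space by N full blocks of d
   equal layers. *)
rewrite (detX (N * d)%N).
have -> : I (N * d)%N = 0 by rewrite /I exprM polymxXn pN0 expr0n eqn0Ngt d_gt0.
rewrite restrict_det0 mulr1; elim: (N) => [|M IH].
  by rewrite mul0n !big_geq // expr1n.
rewrite mulSnr (big_cat_nat (n := (M * d)%N)) ?leq_addr //= IH big_nat_recr //= exprMn.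
congr (_ * _); rewrite -{1}[(M * d)%N]add0n big_addn addKn.
transitivity (\prod_(0 <= j < d) g (M * d)%N); last first.
  by rewrite big_mkord prodr_const card_ord.
by apply: eq_big_nat => j /andP[_ lt_j]; rewrite addnC gD.
Qed.

End RestrictedDet.

(** * Degrees of gcds with powers of a squarefree polynomial *)

Section GcdDegree.

Variable F : fieldType.
Implicit Types (a b e f D : {poly F}).

Lemma gcdp_mulr_coprime D a b : coprimep a b ->
  gcdp D (a * b) %= gcdp D a * gcdp D b.
Proof.
move=> cop; rewrite /eqp; apply/andP; split; last first.
  rewrite dvdp_gcd Gauss_dvdp ?dvdp_gcdl //= ?dvdp_mul ?dvdp_gcdr //.
  exact: coprimep_dvdl (dvdp_gcdr _ _) (coprimep_dvdr (dvdp_gcdr _ _) cop).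
have [[u v] /= e1] := Bezoutp D a; have [[u' v'] /= e2] := Bezoutp D b.
rewrite -(eqp_dvdr _ (eqp_trans (eqp_mulr _ e1) (eqp_mull _ e2))).
set g := gcdp D (a * b); have gD : g %| D := dvdp_gcdl _ _.
have gab : g %| a * b := dvdp_gcdr _ _.
rewrite mulrDl dvdp_add //; first by rewrite -mulrA dvdp_mull // dvdp_mulr.
rewrite mulrDr dvdp_add //; first by rewrite dvdp_mull // dvdp_mull.
by rewrite mulrACA dvdp_mull.
Qed.

Lemma size_gcdp_mulr_coprime D a b : D != 0 -> coprimep a b ->
  (size (gcdp D (a * b))).-1 = ((size (gcdp D a)).-1 + (size (gcdp D b)).-1)%N.
Proof.
move=> nzD cop; rewrite (eqp_size (gcdp_mulr_coprime D cop)).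
have nzg c : (0 < size (gcdp D c))%N by rewrite size_poly_gt0 gcdp_eq0 (negPf nzD).
rewrite size_mul -?size_poly_gt0 //; move: (nzg a) (nzg b).
by move: (size (gcdp D a)) (size (gcdp D b)); clear; lia.
Qed.

Lemma size_gcdp_expf f r m i : irreducible_poly f -> ~~ (f %| r) ->
  (size (gcdp (f ^+ m * r) (f ^+ i))).-1 = ((size f).-1 * minn m i)%N.
Proof.
move=> irf nfr; have nzf := irredp_neq0 irf.
rewrite -size_exp; congr _.-1; apply: eqp_size.
have cop : coprimep (f ^+ i) r by rewrite coprimep_expl // irreducible_poly_coprime.
apply: eqp_trans (gcdpC _ _) _; apply: eqp_trans (Gauss_gcdpl _ cop) _.
case: leqP => [le|/ltnW le].
  by apply: eqp_trans (gcdpC _ _) _; apply: dvdp_gcd_idl; exact: dvdp_exp2l.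
by apply: dvdp_gcd_idl; exact: dvdp_exp2l.
Qed.

End GcdDegree.

Section PowerInvariants.

Variable F : finFieldType.
Implicit Types (a b e f p D : {poly F}).

Definition prime_seq (fs : seq {poly F}) :=
  uniq fs /\ {in fs, forall f, irreducible_poly f /\ f \is monic}.

Lemma prime_seq_cons f fs : prime_seq (f :: fs) ->
  [/\ irreducible_poly f, f \is monic, prime_seq fs & coprimep f (\prod_(g <- fs) g)].
Proof.
move=> [/= /andP[nf ufs] ir]; have [irf mf] := ir f (mem_head _ _).
have irs : {in fs, forall f, irreducible_poly f /\ f \is monic}.
  by move=> g gfs; apply: ir; rewrite inE gfs orbT.
split=> //.
elim: fs nf irs {ufs ir} => [|g fs IH] nf irs; first by rewrite big_nil coprimep1.
rewrite big_cons coprimepMr IH //; last 2 first.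
- by move: nf; rewrite inE negb_or => /andP[].
- by move=> h hfs; apply: irs; rewrite inE hfs orbT.
have [irg mg] := irs g (mem_head _ _).
rewrite andbT coprimep_irreducible //.
by apply: contraNneq nf => ->; rewrite mem_head.
Qed.

(** Supplies the squarefree [p] whose powers filter the space: some power of it is a multiple of the
    characteristic polynomial. *)
Lemma exists_radical a : a != 0 ->
  exists2 fs, prime_seq fs & exists N, a %| (\prod_(f <- fs) f) ^+ N.
Proof.
have [m] := ubnP (size a); elim: m a => // m IH a le_m nza.
have [a_le1|a_gt1] := leqP (size a) 1.
  exists [::]; first by split.
  exists 0%N; rewrite expr0 dvdp1 eqn_leq a_le1 size_poly_gt0 //.
have [f [irf mf fa]] := irreducible_divisor a_gt1.
have f_gt1 : (1 < size f)%N by case: irf.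
have /dvdpP[b aE] := fa.
have nzb : b != 0 by apply: contraNneq nza => e; rewrite aE e mul0r.
have sza : size a = (size b + size f).-1 by rewrite aE size_mul // irredp_neq0.
have [||fs [ufs irs] [N bN]] := IH b; first 2 last.
- have [ffs|nffs] := boolP (f \in fs).
    exists fs; first by split.
    exists N.+1; rewrite aE exprSr dvdp_mul //.
    by rewrite (big_rem f) //= dvdp_mulIl.
  exists (f :: fs).
    split=> [|g]; first by rewrite /= nffs.
    by rewrite inE => /predU1P[->|/irs].
  exists N.+1; rewrite aE exprSr big_cons dvdp_mul ?dvdp_mulIl //.
  by rewrite exprMn dvdp_mull.
- by move: le_m sza f_gt1; move: (size a) (size b) (size f); clear; lia.
- by [].
Qed.

(** For one prime f of multiplicity k in e, the degree is deg f * min(k d, i). As a function of i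
    its only kink is at k d, a multiple of d, so the second difference centred at i + 1 vanishes. *)
Lemma size_gcdp_power_convex e fs d i : e != 0 -> prime_seq fs ->
    ~~ (d %| i.+1)%N ->
  ((size (gcdp (e ^+ d) ((\prod_(f <- fs) f) ^+ i))).-1
   + (size (gcdp (e ^+ d) ((\prod_(f <- fs) f) ^+ i.+2))).-1
   = ((size (gcdp (e ^+ d) ((\prod_(f <- fs) f) ^+ i.+1))).-1).*2)%N.
Proof.
move=> nze; have nzed : e ^+ d != 0 by rewrite expf_neq0.
elim: fs => [|f fs IH] pfs nd; first by rewrite big_nil !expr1n (eqp_size (gcdp1 _)) size_poly1.
have [irf mf pfs' cop] := prime_seq_cons pfs.
set p := \prod_(g <- fs) g in IH cop *; rewrite big_cons -/p.
have E j : (size (gcdp (e ^+ d) ((f * p) ^+ j))).-1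
    = ((size (gcdp (e ^+ d) (f ^+ j))).-1 + (size (gcdp (e ^+ d) (p ^+ j))).-1)%N.
  by rewrite exprMn size_gcdp_mulr_coprime // coprimep_expr // coprimep_expl.
rewrite !E addnACA IH // doubleD; congr (_ + _)%N.
have [k [r [-> nfr]]] := prime_power_factor irf nze.
have nfrd : ~~ (f %| r ^+ d).
  by rewrite -irreducible_poly_coprime // coprimep_expr // irreducible_poly_coprime.
rewrite exprMn -exprM !size_gcdp_expf //.
rewrite -mulnDr -mul2n mulnCA; congr (_ * _)%N.
have : (k * d != i.+1)%N by apply: contraNneq nd => <-; exact: dvdn_mull.
by move: (k * d)%N; clear; lia.
Qed.

Lemma det_comm_dpower n (A X : 'M[F]_n) s d : (0 < d)%N -> comm_mx A X ->
    simmx A (frobmx s) -> {in s, forall D, D \is monic} ->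
    {in s, forall D, exists e, D = e ^+ d} ->
  exists c, \det X = c ^+ d.
Proof.
move=> d_gt0 AX simA ms ds.
have [fs pfs [N NP]] := exists_radical (monic_neq0 (char_poly_monic A)).
apply: (det_comm_power (p := \prod_(f <- fs) f) (N := N) d_gt0 AX).
  by have /dvdpP[q ->] := NP; rewrite polymxM polymx_char_poly mulmx0.
move=> i nd; set p := \prod_(f <- fs) f.
have corank j : (\rank (polymx A (p ^+ j)) + \sum_(D <- s) (size (gcdp D (p ^+ j))).-1
                 = frobdim s)%N.
  by rewrite (simmx_rank_polymx _ simA) corank_frobmx.
have : (\sum_(D <- s) (size (gcdp D (p ^+ i))).-1
        + \sum_(D <- s) (size (gcdp D (p ^+ i.+2))).-1
        = (\sum_(D <- s) (size (gcdp D (p ^+ i.+1))).-1).*2)%N.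
  rewrite -big_split -mul2n big_distrr /=; apply: eq_big_seq => D Ds.
  have [e De] := ds D Ds; rewrite De mul2n size_gcdp_power_convex //.
  apply: contraTneq (monic_neq0 (ms D Ds)) => e0.
  by rewrite De e0 expr0n eqn0Ngt d_gt0 eqxx.
move: (corank i) (corank i.+1) (corank i.+2).
move: (\rank (polymx A (p ^+ i))) (\rank (polymx A (p ^+ i.+1))) (\rank (polymx A (p ^+ i.+2))).
do 3!move: (\sum_(D <- s) _)%N => ?; clear; lia.
Qed.

End PowerInvariants.

(** * Norms *)

Section CompanionNorm.

Variable F : fieldType.
Implicit Types (p y D : {poly F}).

Lemma modp_mul2r D p m : D != 0 -> m != 0 -> (p * m) %% (D * m) = (p %% D) * m.
Proof.
move=> nzD nzm; rewrite {1}(divp_eq p D) mulrDl -mulrA modpD modp_mull add0r.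
rewrite modp_small //; have [->|nzr] := eqVneq (p %% D) 0.
  by rewrite mul0r size_poly0 size_poly_gt0 mulf_neq0.
rewrite !size_mul //; have := ltn_modp p D; rewrite nzD.
move: nzm; rewrite -size_poly_gt0.
by move: (size m) (size D) (size (p %% D)); clear; lia.
Qed.

(* The determinant of multiplication by [y] on F[X]/(D). *)
Definition cnorm D y : F := \det (polymx (companionmx D) y).

Lemma cnorm1 y : cnorm 1 y = 1.
Proof.
rewrite /cnorm; move: (polymx _ _); rewrite size_poly1 /= => M.
exact: det_mx00.
Qed.

Lemma cnorm_mod D y y' : D \is monic -> D %| y - y' -> cnorm D y = cnorm D y'.
Proof.
move=> mD; rewrite -polymx_companion_eq0 // => /eqP e.
by rewrite /cnorm -(subrK y' y) polymxD e add0r.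
Qed.

Lemma cnormr1 D : cnorm D 1 = 1.
Proof. by rewrite /cnorm polymx1 det1. Qed.

(** Multiplication by D1 on F[X]/(D1 D2) has kernel the ideal (D2), isomorphic to F[X]/(D1), and
    image the ideal (D1), isomorphic to F[X]/(D2); [restrict_det_mul_ker] splits the determinant
    accordingly. *)
Lemma cnorm_mull D1 D2 y : D1 \is monic -> D2 \is monic ->
  cnorm (D1 * D2) y = cnorm D1 y * cnorm D2 y.
Proof.
move=> m1 m2; pose D := D1 * D2; have mD : D \is monic by rewrite monicMl.
have [nz1 nz2] := (monic_neq0 m1, monic_neq0 m2).
pose k1 := (size D1).-1; pose k2 := (size D2).-1; pose k := (size D).-1.
have s1 : size D1 = k1.+1 := size_monicS m1.
have s2 : size D2 = k2.+1 := size_monicS m2.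
have kE : k = (k1 + k2)%N by rewrite /k size_mul // s1 s2 addSn addnS.
pose C := companionmx D; pose X := polymx C y; pose B := polymx C D1.
(* The ideal generated by [G] in F[X]/(G * H) is isomorphic to F[X]/(H). *)
have embed G H : G \is monic -> H \is monic -> H * G = D ->
    exists W : 'M[F]_((size H).-1, k),
      [/\ row_free W, W *m X = polymx (companionmx H) y *m W & (W <= polymx C G)%MS].
  move=> mG mH GH; have [nzG nzH] := (monic_neq0 mG, monic_neq0 mH).
  have [sG sH] := (size_monicS mG, size_monicS mH).
  have kE' : k = ((size H).-1 + (size G).-1)%N.
    by rewrite /k -GH size_mul // sG sH addSn addnS.
  pose f (u : 'rV[F]_(size H).-1) : 'rV[F]_k := poly_rV (rVpoly u * G).
  have sz_f u : rVpoly (f u) = rVpoly u * G.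
    have szu : (size (rVpoly u) <= (size H).-1)%N by rewrite size_poly.
    rewrite poly_rV_K // kE'.
    have [->|nzu] := eqVneq (rVpoly u) 0; first by rewrite mul0r size_poly0.
    by rewrite size_mul // sG addnS /= leq_add2r.
  pose W := lin1_mx f; have WE u : u *m W = f u.
    by apply: mul_lin1 => c a b; rewrite /f !linearP /= mulrDl -scalerAl linearP.
  exists W; split.
  - apply: inj_row_free => u; rewrite WE => /(congr1 rVpoly).
    rewrite sz_f linear0 => /eqP; rewrite mulf_eq0 (negPf nzG) orbF => /eqP u0.
    by rewrite -[u]rVpolyK u0 linear0.
  - apply/row_matrixP => i; rewrite !row_mul !rowE !WE.
    apply: (can_inj rVpolyK); rewrite rVpoly_mul_polymx // !sz_f rVpoly_mul_polymx //.
    by rewrite -modp_mul2r // -GH mulrAC.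
  apply/row_subP => i; rewrite rowE WE.
  have [k0|k_gt0] := posnP k.
    suff -> : f (delta_mx 0 i) = 0 by exact: sub0mx.
    by move: (f _); rewrite k0 => z; exact: thinmx0.
  suff -> : f (delta_mx 0 i) = poly_rV (rVpoly (delta_mx 0 i : 'rV_(size H).-1)) *m polymx C G.
    exact: submxMl.
  apply: (can_inj rVpolyK); rewrite sz_f rVpoly_mul_polymx // poly_rV_K; last first.
    apply: leq_trans (size_poly _ _) _.
    by rewrite -[X in (_ <= X)%N]/k kE' leq_addr.
  rewrite modp_small // -sz_f (leq_ltn_trans (size_poly _ _)) //.
  by rewrite (size_monicS mD).
have [W1 [free1 W1X W1B]] := embed D1 D2 m1 m2 (mulrC _ _).
have [W2 [free2 W2X W2B]] := embed D2 D1 m2 m1 (erefl _).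
have rankB : \rank B = k2.
  have := rank_polymx_companion mD D1.
  have -> : size (gcdp D D1) = size D1.
    by apply: eqp_size; apply: eqp_trans (gcdpC _ _) _; apply/dvdp_gcd_idl/dvdp_mulIl.
  by rewrite s1 /= -/C -/B => e; move: kE; rewrite -[k in LHS]e addnC => /addnI.
rewrite /cnorm -/D -/C -/X -(restrict_det1 X) (@restrict_det_mul_ker _ _ _ X B) ?submx1 //; last first.
  exact: polymx_comm.
congr (_ * _).
  have sub : (W2 <= (1%:M :&: kermx B))%MS.
    have /eqP CD0 : polymx C (D2 * D1) == 0.
      by rewrite polymx_companion_eq0 // [D2 * D1]mulrC.
    rewrite sub_capmx submx1 sub_kermx; have /submxP[S ->] := W2B.
    by rewrite -mulmxA -polymxM CD0 mulmx0 eqxx.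
  apply: (restrict_detE free2 _ W2X); apply/eqmxP.
  rewrite sub -(geq_leqif (mxrank_leqif_sup sub)) (eqP free2).
  rewrite -(leq_add2l (\rank (1%:M *m B))) mxrank_mul_ker mxrank1 mul1mx rankB.
  by rewrite andTb -[X in (X <= _)%N]/k kE addnC.
have sub : (W1 <= 1%:M *m B)%MS by rewrite mul1mx.
apply: (restrict_detE free1 _ W1X); apply/eqmxP.
by rewrite sub -(geq_leqif (mxrank_leqif_sup sub)) (eqP free1) mul1mx rankB /=.
Qed.

Lemma cnorm_exp D a y : D \is monic -> cnorm (D ^+ a) y = cnorm D y ^+ a.
Proof.
move=> mD; elim: a => [|a IH]; first by rewrite !expr0 cnorm1.
by rewrite !exprS cnorm_mull ?monic_exp // IH.
Qed.

End CompanionNorm.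

Section PrimitiveNorm.

Lemma finField_primitive_elt (K : finFieldType) :
  exists2 x : K, x != 0 & forall m, x ^+ m = 1 -> (#|K|.-1 %| m)%N.
Proof.
have /cyclicP[g gE] := field_unit_group_cyclic [group of [set: {unit K}]].
exists (val g); first by rewrite -unitfE (valP g).
move=> m gm; have : (g ^+ m = 1)%g by apply: val_inj; rewrite FinRing.val_unitX.
by move/eqP; rewrite -order_dvdn orderE -gE card_finField_unit.
Qed.

Variables (F K : finFieldType) (phi : {rmorphism F -> K}).

Lemma finField_char_nat : [pchar K].-nat #|F|.
Proof.
have [p pr_p pF] := finPcharP F; have pK := rmorph_pchar phi pF.
rewrite (eq_pnat _ (pcharf_eq pK)).
by have := pprimeChar_pgroup pF; rewrite /pgroup cardsT.
Qed.

Lemma horner_frobenius (chi : {poly F}) (x : K) :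
  (map_poly phi chi).[x ^+ #|F|] = (map_poly phi chi).[x] ^+ #|F|.
Proof.
elim/poly_ind: chi => [|p c IH].
  by rewrite rmorph0 !horner0 expr0n eqn0Ngt (ltnW (finNzRing_gt1 F)).
rewrite rmorphD rmorphM /= map_polyX map_polyC !hornerMXaddC IH.
by rewrite exprDn_pchar ?finField_char_nat // exprMn -rmorphXn expf_card.
Qed.

(* The roots of [chi] are the conjugates [x ^+ (q ^ i)], [i < k]. *)
Lemma primitive_conjugates (chi : {poly F}) (x : K) k :
    chi \is monic -> size chi = k.+1 -> #|K| = (#|F| ^ k)%N -> x != 0 ->
    (forall m, x ^+ m = 1 -> (#|K|.-1 %| m)%N) -> root (map_poly phi chi) x ->
  phi chi`_0 = (-1) ^+ k * x ^+ (\sum_(i < k) #|F| ^ i).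
Proof.
move=> mchi szchi cardK nzx x_prim rx; set q := #|F| in cardK *.
have q_gt1 : (1 < q)%N := finNzRing_gt1 F.
have rxi i : root (map_poly phi chi) (x ^+ (q ^ i)).
  elim: i => [|i]; first by rewrite expn0 expr1.
  rewrite !rootE expnSr exprM horner_frobenius => /eqP ->.
  by rewrite expr0n eqn0Ngt (ltnW q_gt1).
have distinct i j : (i < j < k)%N -> x ^+ (q ^ i) != x ^+ (q ^ j).
  move=> /andP[lt_ij lt_jk]; apply/eqP => e.
  have lt_q : (q ^ i < q ^ j)%N by rewrite ltn_exp2l.
  have : x ^+ (q ^ j - q ^ i) = 1.
    apply: (mulfI (expf_neq0 (q ^ i) nzx)).
    by rewrite -exprD subnKC ?mulr1 // ltnW.
  move/x_prim/dvdn_leq; rewrite subn_gt0 => /(_ lt_q); rewrite cardK.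
  have : (q ^ j < q ^ k)%N by rewrite ltn_exp2l.
  have : (0 < q ^ i)%N by rewrite expn_gt0 ltnW.
  by move: lt_q;  move: (q ^ i)%N (q ^ j)%N (q ^ k)%N; clear; lia.
pose rs := [seq x ^+ (q ^ i) | i <- iota 0 k].
have Urs : uniq rs.
  rewrite map_inj_in_uniq ?iota_uniq // => i j; rewrite !mem_iota /= add0n => ik jk e.
  case: (ltngtP i j) => // [lt|lt].
    by have := distinct i j; rewrite lt jk e eqxx => /(_ isT).
  by have := distinct j i; rewrite lt ik e eqxx => /(_ isT).
have := @all_roots_prod_XsubC _ (map_poly phi chi) rs.
rewrite size_map_poly szchi size_map size_iota uniq_rootsE => /(_ erefl _ Urs) e.
have -> : phi chi`_0 = (map_poly phi chi)`_0 by rewrite coef_map.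
rewrite e; last by apply/allP => _ /mapP[i _ ->].
rewrite lead_coef_map (monicP mchi) rmorph1 scale1r -horner_coef0 horner_prod.
rewrite big_map -[k in (-1) ^+ k]card_ord -prodr_const.
rewrite -{1}[k]subn0 -/(index_iota 0 k) big_mkord -prodrXr -big_split /=.
by apply: eq_bigr => i _; rewrite hornerXsubC sub0r mulN1r.
Qed.

End PrimitiveNorm.

(** * Which powers contain all determinants of the centralizer *)

Section CentralizerDet.

Variable F : finFieldType.
Implicit Types (f p y D e : {poly F}) (s : seq {poly F}).

Lemma polymx_comp n (A : 'M[F]_n) p y : polymx A (p \Po y) = polymx (polymx A y) p.
Proof.
elim/poly_ind: p => [|p c IH]; first by rewrite comp_poly0 !polymx0.
by rewrite comp_poly_MXaddC !polymxD !polymxM !polymxC !polymxX IH.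
Qed.

(** Take for y a generator of the units of K = F[X]/(f), with k = deg f. Its norm is its power of
    exponent 1 + q + ... + q^(k-1) = (q^k - 1)/(q - 1), hence has order q - 1. *)
Lemma primitive_cnorm f : irreducible_poly f -> f \is monic ->
  exists2 y, cnorm f y != 0 & forall m, cnorm f y ^+ m = 1 -> (#|F|.-1 %| m)%N.
Proof.
move=> irf mf; have hI : monic_irreducible_poly f by [].
pose K : finFieldType := {poly %/ f with hI}; pose q := #|F|.
pose k := (size f).-1.
have [th nz_th th_prim] := finField_primitive_elt K.
have cardK : #|K| = (q ^ k)%N := card_qfpoly hI.
pose y : {poly F} := val th.
pose chi := char_poly (polymx (companionmx f) y).
pose phi : {rmorphism F -> K} := qfpoly_const hI.
have in_y : in_qpoly f y = th.
  apply: val_inj; apply: in_qpoly_small.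
  exact: size_mk_monic (th : {poly %/ f}).
(* By Cayley-Hamilton for multiplication by [y], the composite of [chi] with [y] is divisible by
   [f], that is, zero in K. *)
have r_th : root (map_poly phi chi) th.
  rewrite rootE -in_y; apply/eqP; apply: etrans (esym (in_qpoly_comp_horner f chi y)) _.
  have : f %| chi \Po y.
    by rewrite -polymx_companion_eq0 // polymx_comp polymx_char_poly.
  case/dvdpP => g ->; rewrite rmorphM /=.
  suff -> : in_qpoly f f = 0 by rewrite mulr0.
  apply: val_inj; rewrite /= mk_monicE //.
  exact: Pdiv.RingMonic.rmodpp.
have q_gt1 : (1 < q)%N := finNzRing_gt1 F.
have := primitive_conjugates (char_poly_monic _) (size_char_poly _) cardK nz_th th_prim r_th.
rewrite -/chi char_poly_det rmorphM rmorphXn rmorphN1 /= => /(mulfI _) e.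
have {}e : phi (cnorm f y) = th ^+ (\sum_(i < k) q ^ i).
  by apply: e; rewrite expf_neq0 // oppr_eq0 oner_eq0.
exists y => [|m nm].
  by rewrite -(fmorph_eq0 phi) e expf_neq0.
have : th ^+ ((\sum_(i < k) q ^ i) * m) = 1 by rewrite exprM -e -rmorphXn nm rmorph1.
move/th_prim; rewrite cardK -/q.
have S : (q.-1 * \sum_(i < k) q ^ i)%N = (q ^ k).-1 by rewrite predn_exp.
rewrite -S mulnC dvdn_pmul2l //.
have k_gt0 : (0 < k)%N by have := irf.1; rewrite /k; case: (size f) => [|[]].
by rewrite -(prednK k_gt0) big_ord_recl expn0.
Qed.

(* By the Chinese remainder theorem [y] can be chosen to have a primitive norm
   modulo [f] and to be [1] modulo [r]. *)
Lemma cnorm_power_exponent f a r d : irreducible_poly f -> f \is monic ->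
    r \is monic -> ~~ (f %| r) -> (d %| #|F|.-1)%N ->
    (forall y, cnorm (f ^+ a * r) y != 0 ->
       exists c : F, cnorm (f ^+ a * r) y = c ^+ d) ->
  (d %| a)%N.
Proof.
move=> irf mf mr nfr dq pow.
have [y0 nz0 prim0] := primitive_cnorm irf mf.
have cop : coprimep f r by rewrite irreducible_poly_coprime.
have [[u v] /= /eqpP[[c1 c2] /= /andP[nz1 nz2]]] := Bezoutp f r.
have [c nzc ->] : exists2 c : F, c != 0 & gcdp f r = c%:P.
  by move: cop; rewrite /coprimep => /size_poly1P [c nzc ->]; exists c.
move=> bez; pose b := c1 / (c2 * c).
have {bez} bez : (b *: u) * f + (b *: v) * r = 1.
  rewrite -!scalerAl -scalerDr /b mulrC -scalerA bez scale_polyC.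
  by rewrite scale_polyC mulVf ?mulf_neq0.
move: (b *: u) (b *: v) bez => {}u {}v bez.
pose y := y0 * (v * r) + u * f.
have yf : cnorm f y = cnorm f y0.
  apply: cnorm_mod => //; suff -> : y - y0 = (u - y0 * u) * f by exact: dvdp_mulIr.
  by rewrite /y -[y0 in _ - y0]mulr1 -bez; ring.
have yr : cnorm r y = 1.
  rewrite -(cnormr1 r); apply: cnorm_mod => //.
  suff -> : y - 1 = (y0 * v - v) * r by exact: dvdp_mulIr.
  by rewrite /y -bez; ring.
have normE : cnorm (f ^+ a * r) y = cnorm f y0 ^+ a.
  by rewrite cnorm_mull ?monic_exp // cnorm_exp // yr mulr1 yf.
have [|c0] := pow y; first by rewrite normE expf_neq0.
rewrite normE => e.
have /dvdnP[m qE] := dq; have q_gt0 : (0 < #|F|.-1)%N.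
  by have := finNzRing_gt1 F; case: #|F| => [|[]].
have d_gt0 : (0 < d)%N by move: q_gt0; rewrite qE muln_gt0 => /andP[].
have m_gt0 : (0 < m)%N by move: q_gt0; rewrite qE muln_gt0 => /andP[].
have nzc0 : c0 != 0.
  have : c0 ^+ d != 0 by rewrite -e expf_neq0.
  by rewrite expf_eq0 d_gt0.
have c0q : c0 ^+ #|F|.-1 = 1.
  apply: (mulfI nzc0); rewrite -exprS prednK ?mulr1 ?expf_card //.
  exact: ltnW (finNzRing_gt1 F).
have : cnorm f y0 ^+ (a * m) = 1 by rewrite exprM e -exprM mulnC -qE.
by move/prim0; rewrite qE [(a * m)%N]mulnC dvdn_pmul2l.
Qed.

Lemma dpower_exponents D d : (0 < d)%N -> D \is monic ->
    (forall f a r, irreducible_poly f -> f \is monic -> r \is monic ->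
      ~~ (f %| r) -> D = f ^+ a * r -> (d %| a)%N) ->
  exists2 e, e \is monic & D = e ^+ d.
Proof.
move=> d_gt0; have [m] := ubnP (size D); elim: m D => // m IH D le_m mD expD.
have [D_le1|D_gt1] := leqP (size D) 1.
  exists 1; first exact: monic1.
  have : size D == 1%N by rewrite eqn_leq D_le1 size_poly_gt0 monic_neq0.
  by rewrite size_poly_eq1 eqp_monic ?monic1 // => /eqP ->; rewrite expr1n.
have [f [irf mf fD]] := irreducible_divisor D_gt1.
have [a [r [DE nfr]]] := prime_power_factor irf (monic_neq0 mD).
have mr : r \is monic by rewrite -(monicMl _ (monic_exp a mf)) -DE.
have /dvdnP[b aE] := expD f a r irf mf mr nfr DE.
have a_gt0 : (0 < a)%N by rewrite lt0n; apply: contraNneq nfr => a0; move: fD; rewrite DE a0 mul1r.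
have f_gt1 : (1 < size f)%N by case: irf.
have szD : (size r < size D)%N.
  rewrite DE size_mul ?expf_neq0 ?monic_neq0 //.
  have : (1 < size (f ^+ a))%N.
    by rewrite -(prednK (n := size (f ^+ a))) ?size_poly_gt0 ?expf_neq0 ?monic_neq0 // ltnS size_exp muln_gt0 a_gt0; move: f_gt1; case: (size f) => [|[]].
  have : (0 < size r)%N by rewrite size_poly_gt0 monic_neq0.
  by move: (size (f ^+ a)) (size r); clear; lia.
have [||e me rE] := IH r _ mr.
- exact: leq_trans szD _.
- move=> g c r' irg mg mr' ngr' rE.
  have [efg|nefg] := eqVneq f g.
    case: c rE => [|c] rE //; case/negP: nfr; rewrite rE efg exprS.
    by rewrite -mulrA dvdp_mulIl.
  apply: (expD g c (f ^+ a * r') irg mg); rewrite ?monicMl ?monic_exp //.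
    rewrite Gauss_dvdpr // coprimep_expr // coprimep_irreducible //.
    by rewrite eq_sym.
  by rewrite DE rE mulrCA.
exists (f ^+ b * e); first by rewrite monicMl ?monic_exp.
by rewrite DE rE aE exprMn -exprM.
Qed.

Lemma det_conj_rect m n (P : 'M[F]_(m, n)) (Q : 'M_(n, m)) (X : 'M_n) :
  P *m Q = 1%:M -> Q *m P = 1%:M -> \det (P *m X *m Q) = \det X.
Proof.
move=> PQ QP; have e : m = n.
  by apply: (@simmx_size F _ _ (0 : 'M_m) (0 : 'M_n)); exists P, Q; rewrite mul0mx mulmx0.
subst m; rewrite !det_mulmx mulrAC -det_mulmx PQ det1 mul1r //.
Qed.

Lemma frobmx_comm_cnorm s D y : D \in s ->
  exists X, comm_mx (frobmx s) X /\ \det X = cnorm D y.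
Proof.
elim: s => // E s IH; rewrite inE => /predU1P[->|/IH[X [BX dX]]].
  exists (block_mx (polymx (companionmx E) y) 0 0 1%:M); split.
    rewrite /comm_mx /= !mulmx_block !mulmx0 !mul0mx !addr0 !add0r mulmx1 mul1mx.
    by have := polymx_comm (companionmx E) 'X y; rewrite polymxX => ->.
  by rewrite det_ublock det1 mulr1.
exists (block_mx 1%:M 0 0 X); split.
  rewrite /comm_mx /= !mulmx_block !mulmx0 !mul0mx !addr0 !add0r mulmx1 mul1mx.
  by rewrite BX.
by rewrite det_ublock det1 mul1r.
Qed.

(** From right to left this is [det_comm_dpower]. From left to right, every nonzero [cnorm D y] is
    the determinant of an invertible matrix commuting with [A], which tests the exponent of each
    prime of [D]. *)
Lemma centralizer_det_dpower n (A : 'M[F]_n) s d : (0 < d)%N -> (d %| #|F|.-1)%N ->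
    simmx A (frobmx s) -> {in s, forall D, D \is monic} ->
  (forall X, comm_mx A X -> X \in unitmx -> exists c, \det X = c ^+ d) <->
  {in s, forall D, exists2 e, e \is monic & D = e ^+ d}.
Proof.
move=> d_gt0 dq simA ms; split=> [pow D Ds|ds X AX _]; last first.
  by apply: det_comm_dpower AX simA ms _ => // D /ds[e _ ->]; exists e.
apply: dpower_exponents (ms D Ds) _ => // f a r irf mf mr nfr DE.
apply: cnorm_power_exponent irf mf mr nfr dq _ => y; rewrite -DE => nzy.
have [X [BX dX]] := frobmx_comm_cnorm y Ds.
have [P [Q [PQ QP AP]]] := simA.
have dX' := det_conj_rect X PQ QP.
rewrite -dX -dX'; apply: pow; last first.
  by rewrite unitmxE unitfE dX' dX.
have QA : Q *m A = frobmx s *m Q.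
  rewrite -[LHS]mulmx1 -PQ mulmxA -(mulmxA Q A P) AP (mulmxA Q P) QP.
  by rewrite mul1mx.
rewrite /comm_mx !mulmxA AP -(mulmxA P (frobmx s)) BX -(mulmxA (P *m X) Q A) QA.
by rewrite !mulmxA.
Qed.

End CentralizerDet.

(** * Reciprocal polynomials and reversing matrices *)

Section Reciprocal.

Variable F : fieldType.
Implicit Types (a b p D : {poly F}) (s : seq {poly F}).

(* X^m p(1/X), for [p] of degree at most [m]. *)
Definition revp m p : {poly F} := \poly_(i < m.+1) p`_(m - i).

Lemma revp_is_linear m : linear (revp m).
Proof.
move=> c x y; apply/polyP=> i; rewrite coefD coefZ !coef_poly.
by case: ifP => _; rewrite ?coefD ?coefZ // mulr0 addr0.
Qed.

HB.instance Definition _ m := GRing.isLinear.Build F {poly F} {poly F} _ (revp m)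
  (revp_is_linear m).

Lemma revpXn m i : (i <= m)%N -> revp m 'X^i = 'X^(m - i).
Proof.
move=> le_im; apply/polyP=> j; rewrite coef_poly !coefXn.
case: ltnP => [lt_jm|lt_mj].
  by congr (_ %:R); congr (nat_of_bool _); apply/eqP/eqP; lia.
by case: eqP => // e; move: lt_mj; rewrite e; lia.
Qed.

Lemma revpM m n (p q : {poly F}) : (size p <= m.+1)%N -> (size q <= n.+1)%N ->
  revp (m + n) (p * q) = revp m p * revp n q.
Proof.
have expand k (r : {poly F}) : (size r <= k.+1)%N -> r = \sum_(i < k.+1) r`_i *: 'X^i.
  move=> szr; rewrite -poly_def; apply/polyP => i; rewrite coef_poly.
  by case: ltnP => // le; rewrite nth_default // (leq_trans szr).
move=> /expand pE /expand qE; rewrite {1}pE {1}qE [in RHS]pE [in RHS]qE.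
rewrite mulr_suml !linear_sum /= mulr_suml; apply: eq_bigr => i _.
rewrite mulr_sumr mulr_sumr linear_sum /=; apply: eq_bigr => j _.
have le_i : (i <= m)%N by rewrite -ltnS ltn_ord.
have le_j : (j <= n)%N by rewrite -ltnS ltn_ord.
rewrite -scalerAl -scalerAr -exprD !linearZ /= !revpXn ?leq_add //.
rewrite -scalerAl -scalerAr -exprD; congr (_ *: (_ *: 'X^_)).
by move: le_i le_j; move: (nat_of_ord i) (nat_of_ord j); clear; lia.
Qed.

(** The scalar makes the reciprocal polynomial monic when D(0) is nonzero; its roots are then the
    inverses of those of [D]. *)
Definition recip D : {poly F} := (D`_0)^-1 *: revp (size D).-1 D.

Lemma recip1 : recip 1 = 1.
Proof.
rewrite /recip coef1 /= invr1 scale1r size_poly1 /=.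
by have := @revpXn 0 0 (leqnn _); rewrite expr0.
Qed.

Lemma recipM a b : a != 0 -> b != 0 -> recip (a * b) = recip a * recip b.
Proof.
move=> nza nzb; rewrite /recip coefM big_ord1 subn0 /= invfM mulrC.
rewrite -scalerAl -scalerAr scalerA mulrC; congr (_ *: _).
rewrite -revpM; last 2 first; try by rewrite prednK // size_poly_gt0.
congr (revp _ _); rewrite size_mul //; move: nza nzb; rewrite -!size_poly_gt0.
by move: (size a) (size b); clear; lia.
Qed.

Lemma size_recip D : D`_0 != 0 -> size (recip D) = size D.
Proof.
move=> nz0; have nzD : D != 0 by apply: contraNneq nz0 => ->; rewrite coef0.
have szD : size D = (size D).-1.+1 by rewrite prednK // size_poly_gt0.
by rewrite size_scale ?invr_eq0 // size_poly_eq ?subnn.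
Qed.

Lemma coef_recip D i : (i <= (size D).-1)%N ->
  (recip D)`_i = (D`_0)^-1 * D`_((size D).-1 - i).
Proof. by move=> le_i; rewrite coefZ coef_poly ltnS le_i. Qed.

Lemma recip_monic D : D`_0 != 0 -> recip D \is monic.
Proof.
move=> nz0; rewrite monicE lead_coefE size_recip // coef_recip // subnn.
by rewrite mulVf.
Qed.

Lemma recip_dvd a b : b != 0 -> a %| b -> recip a %| recip b.
Proof.
move=> nzb /dvdpP[c bE]; rewrite bE; move: nzb; rewrite bE mulf_eq0 negb_or.
by move=> /andP[nzc nza]; rewrite recipM // dvdp_mulIr.
Qed.

(** Rectangular because the companion matrices of [D] and [recip D] have orders that are only
    provably equal. *)
Definition revmx m n : 'M[F]_(m, n) := \matrix_(i, j) ((i + j).+1 == n)%:R.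

Lemma revmxK n : revmx n n *m revmx n n = 1%:M.
Proof.
apply/matrixP => i j; rewrite !mxE (bigD1 (rev_ord i)) //= !mxE /=.
have lt_i := ltn_ord i; have lt_j := ltn_ord j.
have -> : (i + (n - i.+1)).+1 == n by apply/eqP; lia.
rewrite mul1r big1 ?addr0 => [|k ne].
  congr (_ %:R); congr (nat_of_bool _); rewrite -val_eqE /=.
  by apply/eqP/eqP; lia.
rewrite !mxE; case: eqP => [e|]; last by rewrite mul0r.
by case/eqP: ne; apply: val_inj => /=; lia.
Qed.

(** Reversing the basis 1, X, ..., X^(k-1) turns multiplication by X modulo [D] into multiplication
    by the inverse of X modulo [recip D]. *)
Lemma revmx_companion D : D \is monic -> D`_0 != 0 ->
  let k := (size D).-1 in let k' := (size (recip D)).-1 in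
  companionmx D *m revmx k k' *m companionmx (recip D) = revmx k k'.
Proof.
move=> mD nz0; move: (size_recip nz0) (@coef_recip D); rewrite /companionmx.
move: (recip D) => D' -> /=; have := monicP mD; rewrite lead_coefE.
set k := (size D).-1 => Dk D'E.
apply/matrixP => i j; have lt_i := ltn_ord i; have lt_j := ltn_ord j.
have mulJ (M : 'M[F]_k) x y : (M *m revmx k k) x y = M x (rev_ord y).
  rewrite !mxE (bigD1 (rev_ord y)) //= !mxE /=.
  have lt_y := ltn_ord y.
  have -> : (k - y.+1 + y).+1 == k by apply/eqP; lia.
  rewrite mulr1 big1 ?addr0 // => z ne; rewrite !mxE.
  case: eqP => [e|]; last by rewrite mulr0.
  by case/eqP: ne; apply: val_inj => /=; have := ltn_ord z; lia.
rewrite mxE; under eq_bigr do rewrite mulJ !mxE /=.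
rewrite [RHS]mxE; have k_gt0 : (0 < k)%N by apply: leq_ltn_trans lt_i.
have lt_z : (k.-1 < k)%N by rewrite prednK.
pose z := Ordinal lt_z.
have [ik|nik] := eqVneq (i : nat) k.-1.
  rewrite (bigD1 z) //= !eqxx /= prednK // subnn mulrNN D'E 1?ltnW //.
  rewrite mulrA mulfV // mul1r ik addnC -addnS prednK //.
  have [j0|j_gt0] := posnP j.
    rewrite j0 subn0 Dk eqxx big1 ?addr0 // => l /negPf nlz.
    rewrite [l == _ :> nat]nlz; case: eqP => // _; by rewrite mulr0.
  have lt_j1 : (j.-1 < k)%N by lia.
  rewrite (bigD1 (Ordinal lt_j1)) /=; last by rewrite -val_eqE /= neq_ltn; lia.
  have -> : (j.-1 == k.-1) = false by apply/eqP; lia.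
  rewrite prednK // eqxx mulr1 big1 => [|l /andP[nlz nlj]].
    rewrite addr0 subrr; case: eqP => //; lia.
  rewrite [l == _ :> nat](negPf nlz); case: eqP => [e|_]; last by rewrite mulr0.
  by case/eqP: nlj; apply: val_inj; rewrite /= -e.
have lt_l : (k - i.+2 < k)%N by lia.
rewrite (bigD1 (Ordinal lt_l)) //=.
have -> : i.+1 == (k - (k - i.+2).+1)%N by apply/eqP; lia.
have -> : (k - i.+2 == k.-1)%N = false by apply/eqP; lia.
rewrite mul1r big1 ?addr0 => [|l nl].
  by congr (_ %:R); congr (nat_of_bool _); apply/eqP/eqP; lia.
case: eqP => [e|]; last by rewrite mul0r.
by case/eqP: nl; apply: val_inj => /=; have := ltn_ord l; lia.
Qed.

End Reciprocal.

(** * Reversing a Frobenius form, and the determinant of the reversing matrix *)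

Section Reversers.

Variable F : finFieldType.
Implicit Types (p D : {poly F}) (s : seq {poly F}).

Lemma det_companion D : D \is monic ->
  \det (companionmx D) = (-1) ^+ (size D).-1 * D`_0.
Proof.
move=> mD; have := char_poly_det (companionmx D).
by rewrite companionmxK // => ->; rewrite signrMK.
Qed.

(** The determinant of the companion matrix of a monic [D]; on self-reciprocal polynomials it is a
    sign. *)
Definition dsign D : F := (-1) ^+ (size D).-1 * D`_0.

Lemma det_frobmx s : {in s, forall D, D \is monic} ->
  \det (frobmx s) = \prod_(D <- s) dsign D.
Proof.
elim: s => [|D s IH] ms; first by rewrite big_nil det_mx00.
rewrite big_cons /= det_ublock det_companion ?ms ?mem_head // IH // => E Es.
by rewrite ms // inE Es orbT.
Qed.

Lemma simmx_det m n (A : 'M[F]_m) (B : 'M_n) : simmx A B -> \det A = \det B.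
Proof.
move=> [P [Q [PQ QP AP]]]; rewrite -(det_conj_rect B PQ QP) -AP.
by rewrite -mulmxA PQ mulmx1.
Qed.

Lemma frobmx_coef0_neq0 s : {in s, forall D, D \is monic} -> \det (frobmx s) != 0 ->
  {in s, forall D, D`_0 != 0}.
Proof.
move=> ms; rewrite det_frobmx // => nz D Ds; apply: contraNneq nz => D0.
by rewrite (big_rem D) //= /dsign D0 mulr0 mul0r.
Qed.

Lemma frobmx_reverser s : {in s, forall D, D \is monic} -> {in s, forall D, D`_0 != 0} ->
  exists P, exists Q, [/\ P *m Q = 1%:M, Q *m P = 1%:M &
    frobmx s *m P *m frobmx ([seq recip D | D <- s]) = P].
Proof.
elim: s => [|D s IH] ms s0.
  by exists 1%:M, 1%:M; rewrite !mulmx1; split=> //; by apply/matrixP => -[].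
have [||P [Q [PQ QP sP]]] := IH.
- by move=> E Es; rewrite ms // inE Es orbT.
- by move=> E Es; rewrite s0 // inE Es orbT.
have [mD D0] : D \is monic /\ D`_0 != 0 by rewrite ms ?s0 ?mem_head.
have := revmx_companion mD D0; rewrite /= => JD.
have JJ : forall k', k' = (size D).-1 -> revmx F (size D).-1 k' *m revmx F k' (size D).-1 = 1%:M
  /\ revmx F k' (size D).-1 *m revmx F (size D).-1 k' = 1%:M.
  by move=> k' ->; rewrite revmxK.
have [J1 J2] := JJ _ (congr1 predn (size_recip D0)).
exists (block_mx (revmx _ _ _) 0 0 P), (block_mx (revmx _ _ _) 0 0 Q).
by split; rewrite /= !mulmx_block !mulmx0 !mul0mx !addr0 !add0r ?J1 ?J2 ?PQ ?QP ?JD ?sP -?scalar_mx_block ?mul0mx.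
Qed.

Lemma det_swap_block m : \det (block_mx 0 1%:M 1%:M 0 : 'M[F]_(m + m)) = (-1) ^+ m.
Proof.
pose E1 : 'M[F]_(m + m) := block_mx 1%:M 1%:M 0 1%:M.
pose E2 : 'M[F]_(m + m) := block_mx 1%:M 0 (- 1%:M) 1%:M.
pose E3 : 'M[F]_(m + m) := block_mx 1%:M 0 0 (- 1%:M).
have -> : block_mx 0 1%:M 1%:M 0 = E3 *m (E1 *m E2 *m E1).
  rewrite !mulmx_block.
  do 3!rewrite ?(mulmx0, mul0mx, mulmx1, mul1mx, addr0, add0r, addrN, addNr).
  by rewrite mulNmx mul1mx opprK.
rewrite !det_mulmx !det_ublock det_lblock !det1 !mulr1 !mul1r.
by rewrite -scaleN1r detZ det1 mulr1.
Qed.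

Lemma det_revmx_even m : \det (revmx F (m + m) (m + m)) = (-1) ^+ m.
Proof.
have -> : revmx F (m + m) (m + m) =
    block_mx (revmx F m m) 0 0 (revmx F m m) *m block_mx 0 1%:M 1%:M 0.
  rewrite mulmx_block !mulmx0 !mul0mx !mulmx1 !addr0 !add0r.
  rewrite -[LHS]submxK; congr block_mx; apply/matrixP => i j; rewrite !mxE /=;
    have := ltn_ord i; have := ltn_ord j; case: eqP => //; try case: eqP => //; lia.
rewrite det_mulmx det_ublock det_swap_block -det_mulmx revmxK det1 mul1r //.
Qed.

(** Odd size means even degree, which is the case of squares; there an antidiagonal block of order k
    has determinant (-1)^(k/2). *)
Lemma frobmx_self_reverser s : {in s, forall D, D \is monic} -> {in s, forall D, D`_0 != 0} ->
    {in s, forall D, recip D = D} ->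
  exists P, [/\ P \in unitmx, frobmx s *m P *m frobmx s = P &
    {in s, forall D, odd (size D)} -> \det P = (-1) ^+ (frobdim s)./2].
Proof.
elim: s => [|D s IH] ms s0 sr.
  exists 1%:M; rewrite unitmx1 det1; split=> //; by apply/matrixP => -[].
have [|||P [uP sP dP]] := IH.
- by move=> E Es; rewrite ms // inE Es orbT.
- by move=> E Es; rewrite s0 // inE Es orbT.
- by move=> E Es; rewrite sr // inE Es orbT.
have [mD D0] : D \is monic /\ D`_0 != 0 by rewrite ms ?s0 ?mem_head.
have := revmx_companion mD D0; rewrite (sr D (mem_head _ _)) /= => JD.
set k := (size D).-1 in JD; have JJ := revmxK F k.
exists (block_mx (revmx F k k) 0 0 P); split.
- rewrite unitmxE det_ublock unitrM -!unitmxE uP andbT.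
  by have [] := mulmx1_unit JJ.
- by rewrite /= !mulmx_block !mulmx0 !mul0mx !addr0 !add0r JD sP ?mul0mx.
move=> ods; rewrite det_ublock dP => [|E Es]; last by rewrite ods // inE Es orbT.
have kE : k = (k./2 + k./2)%N.
  have := ods D (mem_head _ _); rewrite (size_monicS mD) -/k /= => ek.
  by rewrite addnn even_halfK.
have -> : \det (revmx F k k) = (-1) ^+ k./2 by rewrite [in LHS]kE det_revmx_even.
rewrite -exprD; congr (_ ^+ _); rewrite /= -/k kE; move: (k./2) (frobdim s); clear; lia.
Qed.

Lemma simmx_self_reverser n (A : 'M[F]_n) s : A \in unitmx -> simmx A (frobmx s) ->
    {in s, forall D, D \is monic} -> {in s, forall D, recip D = D} ->
  exists P, [/\ P \in unitmx, A *m P *m A = P &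
    {in s, forall D, odd (size D)} -> \det P = (-1) ^+ n./2].
Proof.
move=> uA simA ms sr.
have s0 : {in s, forall D, D`_0 != 0}.
  by apply: frobmx_coef0_neq0 => //; rewrite -(simmx_det simA) -unitfE -unitmxE.
have [R [uR sR dR]] := frobmx_self_reverser ms s0 sr.
have [P [Q [PQ QP APQ]]] := simA.
have QA : Q *m A = frobmx s *m Q.
  rewrite -[LHS]mulmx1 -PQ mulmxA -(mulmxA Q A P) APQ (mulmxA Q P) QP.
  by rewrite mul1mx.
exists (P *m R *m Q); split.
- by rewrite unitmxE (det_conj_rect _ PQ QP) -unitmxE.
- by rewrite !mulmxA APQ -(mulmxA _ Q A) QA -!mulmxA (mulmxA R) (mulmxA (frobmx s)) (mulmxA (frobmx s)) sR.
by move=> /dR; rewrite (det_conj_rect _ PQ QP) (simmx_size simA).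
Qed.

(** A P A = P says that A is similar to its inverse, whose invariant factors are the reciprocals of
    those of A; uniqueness of the chain then equates them term by term. *)
Lemma reversible_iff n (A : 'M[F]_n) s : A \in unitmx -> simmx A (frobmx s) ->
    {in s, forall D, D \is monic} -> dvd_chain s ->
  (exists2 P, P \in unitmx & A *m P *m A = P) <-> {in s, forall D, recip D = D}.
Proof.
move=> uA simA ms cs.
have s0 : {in s, forall D, D`_0 != 0}.
  by apply: frobmx_coef0_neq0 => //; rewrite -(simmx_det simA) -unitfE -unitmxE.
split=> [[P uP AP]|sr]; last first.
  by have [P [uP AP _]] := simmx_self_reverser uA simA ms sr; exists P.
have rs : [seq recip D | D <- s] = s.
  apply: simmx_frobmx_uniq => //.
  - by move=> _ /mapP[D Ds ->]; apply: recip_monic; exact: s0.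
  - elim: s cs s0 {ms simA} => //= D [|E s] IH //= /andP[ED cs] s0.
    rewrite recip_dvd //=; last first.
      by apply: contraNneq (s0 D (mem_head _ _)) => ->; rewrite coef0.
    by apply: IH => // G Gs; apply: s0; rewrite inE Gs orbT.
  - by rewrite size_map.
  have [R [R' [RR' R'R sR]]] := frobmx_reverser ms s0.
  have [P1 [Q1 [PQ1 QP1 AP1]]] := simA.
  apply: simmx_sym; apply: simmx_trans (simmx_sym simA) _.
  exists (invmx P *m P1 *m R), (R' *m Q1 *m P); split.
  - by rewrite !mulmxA -(mulmxA _ R) RR' mulmx1 -(mulmxA _ P1) PQ1 mulmx1 mulVmx.
  - by rewrite !mulmxA -(mulmxA _ P) mulmxV // mulmx1 -(mulmxA R') QP1 mulmx1 R'R.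
  have uAP : A *m P \in unitmx by rewrite unitmx_mul uA.
  apply: (can_inj (mulKmx uAP)).
  rewrite !mulmxA AP mulmxV // mul1mx -(mulmxA A P) mulmxV // mulmx1 AP1.
  by rewrite -!mulmxA (mulmxA (frobmx s)) sR.
move=> D Ds; have := congr1 (fun t => nth 0 t (index D s)) rs.
by rewrite (nth_map 0) ?index_mem // nth_index.
Qed.

End Reversers.

(** The index i lies in the inner range for j = 1, ..., i: this is the origin of the weight i in the
    sums and products over the quotients of a chain. *)
Lemma big_triangle (R : Type) (idx : R) (op : Monoid.com_law idx) n (f : nat -> R) :
  \big[op/idx]_(1 <= j < n.+1) \big[op/idx]_(j <= i < n.+1) f i =
  \big[op/idx]_(1 <= i < n.+1) iter i (op (f i)) idx.
Proof.
elim: n => [|n IH]; first by rewrite !big_geq.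
rewrite !(@big_nat_recr _ _ _ n.+1 1) //= -IH.
rewrite (@eq_big_nat _ _ _ _ _ _
  (fun j => op (\big[op/idx]_(j <= i < n.+1) f i) (f n.+1))); last first.
  by move=> j /andP[_ le_j]; rewrite big_nat_recr // ltnW.
rewrite big_split /= -Monoid.mulmA; apply: (congr1 (op _)).
by rewrite big_const_nat subn1 /= big_nat1 Monoid.mulmC.
Qed.

(** * Chains of invariant factors and their quotients *)

Section Chains.

Variable F : finFieldType.
Implicit Types (a b p e D : {poly F}) (u : nat -> {poly F}).

Definition tailprod n u j : {poly F} := \prod_(j <= i < n.+1) u i.

(* Writing the invariant factors as D_1, ..., D_n with D_(j+1) %| D_j, the
   quotients u_j = D_j / D_(j+1) are arbitrary monic polynomials. *)
Definition chain n u := [seq tailprod n u j | j <- iota 1 n].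

Lemma tailprodS n u j : (j <= n)%N -> tailprod n u j = u j * tailprod n u j.+1.
Proof. by move=> le_jn; rewrite /tailprod big_ltn. Qed.

Lemma tailprod_end n u : tailprod n u n.+1 = 1.
Proof. by rewrite /tailprod big_geq. Qed.

Lemma tailprod_monic n u j : (forall i, u i \is monic) -> tailprod n u j \is monic.
Proof. by move=> mu; apply: rpred_prod => i _. Qed.

Lemma chain_monic n u : (forall i, u i \is monic) ->
  {in chain n u, forall D, D \is monic}.
Proof. by move=> mu _ /mapP[j _ ->]; apply: tailprod_monic. Qed.

Lemma size_chain n u : size (chain n u) = n.
Proof. by rewrite size_map size_iota. Qed.

Lemma nth_chain n u j : (j < n)%N -> (chain n u)`_j = tailprod n u j.+1.
Proof. by move=> lt_jn; rewrite (nth_map 0%N) ?size_iota // nth_iota. Qed.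

Lemma chain_dvd n u : dvd_chain (chain n u).
Proof.
apply: (@path_sorted _ _ (tailprod n u 0)); apply/(pathP 0) => i.
rewrite size_chain => lt_in; case: i lt_in => [|i] lt_in /=.
  by rewrite nth_chain // [X in _ %| X]tailprodS // dvdp_mulIr.
rewrite !nth_chain //; last exact: ltnW.
by rewrite [X in _ %| X]tailprodS ?dvdp_mulIr // ltnW.
Qed.

Lemma chain_inj n u v : (forall i, u i \is monic) -> chain n u = chain n v ->
  forall i, (0 < i <= n)%N -> u i = v i.
Proof.
move=> mu e; have eD j : (0 < j <= n.+1)%N -> tailprod n u j = tailprod n v j.
  case: j => // j; rewrite ltnS /= leq_eqVlt => /predU1P[->|lt_jn].
    by rewrite !tailprod_end.
  by rewrite -!nth_chain // e.
move=> i /andP[i_gt0 le_in]; have := eD i.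
rewrite i_gt0 leqW // (tailprodS u le_in) (tailprodS v le_in).
rewrite -(eD i.+1) ?ltnS // => /(_ isT); apply: mulIf.
by rewrite monic_neq0 // tailprod_monic.
Qed.

Lemma chain_exists n s : size s = n -> {in s, forall D, D \is monic} -> dvd_chain s ->
  exists2 u : nat -> {poly F}, (forall i, u i \is monic) /\ u 0%N = 1 & chain n u = s.
Proof.
(* Indices start at 1, and the default 1 provides the term after the last invariant factor. *)
move=> <- ms cs; pose D j := nth 1 s j.-1.
have mD j : D j \is monic.
  by rewrite /D; case: (ltnP j.-1 (size s)) => [/(mem_nth 1)/ms|/(nth_default 1) ->] //; exact: monic1.
have dD j : (0 < j)%N -> D j.+1 %| D j.
  case: j => // j _; rewrite /D /=; case: (ltnP j.+1 (size s)) => [lt|/(nth_default 1) ->].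
    by move/(sortedP 1): cs; apply.
  exact: dvd1p.
pose u j := if j == 0%N then 1 else D j %/ D j.+1.
have uE j : (0 < j)%N -> u j * D j.+1 = D j.
  by move=> j_gt0; rewrite /u eqn0Ngt j_gt0 /= divpK // dD.
have mu j : u j \is monic.
  rewrite /u; case: eqP => [_|/eqP]; first exact: monic1.
  rewrite -lt0n => j_gt0; rewrite -(monicMr _ (mD j.+1)) divpK ?dD //.
exists u => //.
have tD k j : (0 < j)%N -> (j + k = (size s).+1)%N -> tailprod (size s) u j = D j.
  elim: k j => [|k IH] j j_gt0 ek.
    move: ek; rewrite addn0 => ->; rewrite tailprod_end /D /= nth_default //.
  rewrite tailprodS ?(IH j.+1) ?uE //; first by lia.
  by lia.
apply: (@eq_from_nth _ 1); rewrite ?size_chain // => j lt_j.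
rewrite (nth_map 0%N) ?size_iota // nth_iota // (tD (size s - j)%N) //.
by lia.
Qed.

(** Stability under products and under exact division lets a property pass between the invariant
    factors and their quotients; it is applied to self-reciprocal polynomials and to d-th powers. *)
Lemma chain_all n u (P : {poly F} -> Prop) : (forall i, u i \is monic) ->
    P 1 -> (forall a b, P a -> P b -> P (a * b)) ->
    (forall a b, a \is monic -> b \is monic -> P (a * b) -> P b -> P a) ->
  {in chain n u, forall D, P D} <-> (forall i, (0 < i <= n)%N -> P (u i)).
Proof.
move=> mu P1 PM PV; split=> [cP i /andP[i_gt0 le_in]|uP D /mapP[j]].
  have cP' j : (0 < j <= n.+1)%N -> P (tailprod n u j).
    case: j => // j; rewrite ltnS /= leq_eqVlt => /predU1P[->|lt_jn].
      by rewrite tailprod_end.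
    by apply: cP; apply/mapP; exists j.+1; rewrite // mem_iota /= add1n ltnS.
  apply: (PV _ (tailprod n u i.+1)) => //; first exact: tailprod_monic.
    by rewrite -tailprodS //; apply: cP'; rewrite i_gt0 leqW.
  exact: cP'.
rewrite mem_iota add1n => /andP[j_gt0 _] ->; rewrite /tailprod big_nat_cond.
apply: big_ind => // i; rewrite andbT => /andP[le_ji lt_in].
by apply: uP; rewrite (leq_trans j_gt0).
Qed.

Lemma big_chain (R : Type) (idx : R) (op : Monoid.com_law idx) n u (f : {poly F} -> R) :
    (forall i, u i \is monic) -> f 1 = idx ->
    (forall a b, a \is monic -> b \is monic -> f (a * b) = op (f a) (f b)) ->
  \big[op/idx]_(D <- chain n u) f D =
  \big[op/idx]_(1 <= i < n.+1) iter i (op (f (u i))) idx.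
Proof.
move=> mu f1 fM; rewrite big_map -big_triangle.
have -> : iota 1 n = index_iota 1 n.+1 by rewrite /index_iota subn1.
apply: eq_bigr => j _; rewrite /tailprod.
elim: (index_iota j n.+1) => [|i r IH]; first by rewrite !big_nil.
by rewrite !big_cons fM ?IH // rpred_prod.
Qed.

Lemma frobdim_chain n u : (forall i, u i \is monic) ->
  frobdim (chain n u) = (\sum_(1 <= i < n.+1) i * (size (u i)).-1)%N.
Proof.
move=> mu; rewrite frobdimE big_chain //; first last.
- by move=> a b ma mb; rewrite size_mul ?monic_neq0 // (size_monicS ma) (size_monicS mb) addSn addnS.
- by rewrite size_poly1.
by apply: eq_bigr => i _; rewrite iter_addn addn0 mulnC.
Qed.

Lemma dsignM a b : a != 0 -> b != 0 -> dsign (a * b) = dsign a * dsign b.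
Proof.
move=> nza nzb; rewrite /dsign coefM big_ord1 subn0 mulrACA -exprD.
congr (_ ^+ _ * _); rewrite size_mul //; move: nza nzb; rewrite -!size_poly_gt0.
by move: (size a) (size b); clear; lia.
Qed.

Lemma dsign1 : dsign 1 = 1 :> F.
Proof. by rewrite /dsign size_poly1 coef1 mulr1. Qed.

Lemma det_frobmx_chain n u : (forall i, u i \is monic) ->
  \det (frobmx (chain n u)) = \prod_(1 <= i < n.+1) dsign (u i) ^+ i.
Proof.
move=> mu; rewrite det_frobmx; last exact: chain_monic.
rewrite big_chain //; first last.
- by move=> a b ma mb; rewrite dsignM ?monic_neq0.
- exact: dsign1.
by apply: eq_bigr => i _; rewrite -Monoid.iteropE.
Qed.

Definition srec p := (p`_0 != 0) && (recip p == p).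

Lemma srec1 : srec 1.
Proof. by rewrite /srec coef1 oner_eq0 recip1 eqxx. Qed.

Lemma coef0M p q : (p * q)`_0 = p`_0 * q`_0 :> F.
Proof. by rewrite coefM big_ord1 subn0. Qed.

Lemma srecM a b : srec a -> srec b -> srec (a * b).
Proof.
have nz p : p`_0 != 0 -> p != 0 by apply: contraNneq => ->; rewrite coef0.
move=> /andP[a0 /eqP ra] /andP[b0 /eqP rb]; rewrite /srec coef0M mulf_neq0 //.
by rewrite recipM ?nz // ra rb eqxx.
Qed.

Lemma srec_divl a b : a \is monic -> b \is monic -> srec (a * b) -> srec b -> srec a.
Proof.
move=> ma mb /andP[ab0 /eqP rab] /andP[b0 /eqP rb]; rewrite /srec.
move: ab0; rewrite coef0M mulf_eq0 negb_or => /andP[-> _] /=.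
move: rab; rewrite recipM ?monic_neq0 // rb => /(mulIf (monic_neq0 mb)) ->.
exact: eqxx.
Qed.

Definition dpower d p := exists2 e, e \is monic & p = e ^+ d.

Lemma dpower1 d : dpower d 1.
Proof. by exists 1; rewrite ?monic1 ?expr1n. Qed.

Lemma dpowerM d a b : dpower d a -> dpower d b -> dpower d (a * b).
Proof.
by move=> [e me ->] [f mf ->]; exists (e * f); rewrite ?rpredM // exprMn.
Qed.

Lemma dpower_divl d a b : (0 < d)%N -> a \is monic -> b \is monic ->
  dpower d (a * b) -> dpower d b -> dpower d a.
Proof.
move=> d_gt0 ma mb [e me abE] [f mf bE].
have : f ^+ d %| e ^+ d by rewrite -abE -bE dvdp_mulIr.
rewrite dvdp_pexp2r // => /dvdpP[g eE].
exists g; first by rewrite -(monicMr _ mf) -eE.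
apply: (mulIf (monic_neq0 mb)); rewrite abE eE exprMn bE //.
Qed.

Lemma monic_expr_inj d a b : (0 < d)%N -> a \is monic -> b \is monic ->
  a ^+ d = b ^+ d -> a = b.
Proof.
move=> d_gt0 ma mb e; apply/eqP; rewrite -eqp_monic // /eqp.
by rewrite -(dvdp_pexp2r a b d_gt0) -(dvdp_pexp2r b a d_gt0) e dvdpp.
Qed.

End Chains.

(** * Conjugacy classes of SL *)

Section CyclicIndex.
Local Open Scope group_scope.

(** When d divides the order of a cyclic group, the d-th powers form its subgroup of index d, and
    inclusion of subgroups is divisibility of orders. *)
Lemma cyclic_dvd_index (gT : finGroupType) (G H : {group gT}) d :
    cyclic G -> H \subset G -> (d %| #|G|)%N ->
  (d %| #|G : H|)%N = [forall x in H, exists y in G, x == y ^+ d].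
Proof.
move=> cG HG dG; have /cyclicP[g gE] := cG.
have G_gt0 : (0 < #|G|)%N := cardG_gt0 G.
have d_gt0 : (0 < d)%N := dvdn_gt0 G_gt0 dG.
have powE x : (x \in <[g ^+ d]>) = [exists y in G, x == y ^+ d].
  apply/cycleP/existsP => [[k ->]|[y /andP[]]].
    by exists (g ^+ k); rewrite gE mem_cycle -!expgM mulnC eqxx.
  by rewrite gE => /cycleP[k ->] /eqP ->; exists k; rewrite -!expgM mulnC.
have sub : <[g ^+ d]> \subset G by rewrite gE cycle_subG mem_cycle.
have og : #[g] = #|G| by rewrite gE.
have -> : [forall x in H, exists y in G, x == y ^+ d] = (H \subset <[g ^+ d]>).
  apply/forall_inP/subsetP => h x xH; first by rewrite powE h.
  by rewrite -powE h.
rewrite -(cardSg_cyclic cG HG sub) -orderE orderXdiv og //.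
have -> : (d %| #|G : H|)%N = (#|H| * d %| #|G|)%N.
  by rewrite -(Lagrange HG) dvdn_pmul2l ?cardG_gt0.
by rewrite -[in LHS](divnK dG) dvdn_pmul2r.
Qed.

Lemma abelian_expg_index (gT : finGroupType) (G H : {group gT}) x :
  abelian G -> H \subset G -> x \in G -> x ^+ #|G : H| \in H.
Proof.
move=> abG HG xG; have nHG : G \subset 'N(H).
  by apply: sub_abelian_norm.
have xN := subsetP nHG x xG.
apply: coset_idr; first by rewrite groupX.
rewrite morphX // -card_quotient // expg_cardG //.
exact: mem_quotient.
Qed.

End CyclicIndex.

Section Determinant.
Variables (F : finFieldType) (m : nat).
Local Notation gT := {'GL_m.+1[F]}.
Implicit Types (g h : gT).

Lemma GL_det_unit g : \det (GLval g) \is a GRing.unit.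
Proof. by rewrite unitfE GL_det. Qed.

Definition GLdet g : {unit F} := FinRing.unit F (GL_det_unit g).

Lemma GLdetM : {in [set: gT] &, {morph GLdet : x y / (x * y)%g}}.
Proof. by move=> x y _ _; apply: val_inj; apply: det_mulmx. Qed.

Canonical GLdet_morphism := Morphism GLdetM.

Lemma ker_GLdet : ('ker GLdet_morphism = SL m.+1 F)%g.
Proof.
apply/setP=> g; rewrite inE (in_setT g) /= !inE.
by apply/eqP/eqP => [/(congr1 val)|] e //; apply: val_inj.
Qed.

Lemma im_GLdet : (GLdet_morphism @* [set: gT] = [set: {unit F}])%g.
Proof.
apply/setP=> x; rewrite inE; apply/morphimP.
pose M : 'M[F]_m.+1 := diag_mx (\row_i if i == 0 then val x else 1).
have dM : \det M = val x.
  rewrite det_diag (bigD1 0) //= mxE eqxx big1 ?mulr1 // => i /negPf ni.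
  by rewrite mxE ni.
have uM : M \is a GRing.unit.
  by rewrite -[_ \is a _]/(M \in unitmx) unitmxE dM (valP x).
exists (FinRing.unit _ uM); rewrite ?inE //.
by apply: val_inj; rewrite /= dM.
Qed.

Definition det_index g := #|[set: {unit F}] : (GLdet_morphism @* 'C[g])|%g.

Lemma card_SL_det (K : {group gT}) :
  #|K| = (#|(K :&: SL m.+1 F)%g| * #|(GLdet_morphism @* K)%g|)%N.
Proof.
rewrite card_morphim setTI -ker_GLdet.
exact/esym/LagrangeI.
Qed.

(** Orbit-stabilizer in both groups: the determinant factors the order of GL through SL and the
    units of F, and that of C(g) through C(g) cap SL and det C(g). *)
Lemma card_class_SL g :
  #|(g ^: [set: gT])%g| = (#|(g ^: SL m.+1 F)%g| * det_index g)%N.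
Proof.
rewrite -!index_cent1 /det_index setTI.
have C1 : (0 < #|('C_(SL m.+1 F)[g])%g| * #|(GLdet_morphism @* 'C[g])%g|)%N.
  by rewrite muln_gt0 !cardG_gt0.
apply/eqP; rewrite -(eqn_pmul2l C1); apply/eqP.
have := card_SL_det 'C[g]; rewrite setIC => eC.
rewrite -[X in (X * _)%N = _]eC Lagrange ?subsetT //.
rewrite card_SL_det setTI im_GLdet mulnACA.
by rewrite Lagrange ?subsetIl // Lagrange ?subsetT.
Qed.

Lemma cyclic_units : cyclic [set: {unit F}].
Proof. exact: field_unit_group_cyclic. Qed.

Lemma det_index_gt0 g : (0 < det_index g)%N.
Proof. exact: indexg_gt0. Qed.

Lemma det_index_dvd_card g : (det_index g %| #|F|.-1)%N.
Proof. by rewrite -card_finField_unit dvdn_indexg. Qed.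

Lemma det_index_dvd g s d : (d %| #|F|.-1)%N -> simmx (GLval g) (frobmx s) ->
    {in s, forall D, D \is monic} ->
  (d %| det_index g)%N <-> {in s, forall D, dpower d D}.
Proof.
move=> dq simA ms; have q_gt0 : (0 < #|F|.-1)%N.
  by have := finNzRing_gt1 F; case: #|F| => [|[]].
have d_gt0 := dvdn_gt0 q_gt0 dq.
have Ucyc := cyclic_units.
rewrite cyclic_dvd_index ?subsetT ?card_finField_unit //.
apply: iff_trans (centralizer_det_dpower d_gt0 dq simA ms).
split=> [/forall_inP h X AX uX|h].
  pose x : gT := FinRing.unit _ (uX : X \is a GRing.unit).
  have xC : x \in 'C[g]%g.
    by apply/cent1P; apply: val_inj; rewrite /= -[LHS]AX.
  have /existsP[y /andP[_ /eqP e]] := h _ (mem_morphim GLdet_morphism (in_setT x) xC).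
  by exists (val y); rewrite -FinRing.val_unitX -e.
apply/forall_inP => _ /morphimP[x _ /cent1P xC ->].
have [|c cE] := h (GLval x) _ (GL_unitmx x).
  by have := congr1 val xC; rewrite /= => e; exact: (esym e).
have uc : c \is a GRing.unit.
  rewrite unitfE; apply: contraTneq (GL_det x) => c0.
  by rewrite cE c0 expr0n eqn0Ngt d_gt0 eqxx.
apply/existsP; exists (FinRing.unit _ uc); rewrite inE /=.
by apply/eqP/val_inj; rewrite FinRing.val_unitX.
Qed.

End Determinant.

(** * Classes of GL as tuples of monic polynomials *)

Section Invariants.
Variables (F : finFieldType) (m : nat).
Local Notation n := m.+1.
Local Notation gT := {'GL_m.+1[F]}.
Local Notation q := #|F|.
Implicit Types (g h : gT).

(** A finite type, to be summed over: degrees are at most n, and the indices are those of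
    [multiplicities], with a dummy index 0. *)
Definition polytuple := {ffun 'I_n.+1 -> {poly_n.+1 F}}.
Implicit Types (w : polytuple).

(** Beyond n, [inord] falls back to index 0, so that a tuple with dummy value 1 continues by 1. *)
Definition wseq w (i : nat) : {poly F} := w (inord i).

Definition wmonic w :=
  (polyn (w ord0) == 1) && [forall i, polyn (w i) \is monic].

(* [w] (with the dummy value [w 0 = 1]) lists the quotients of consecutive
   invariant factors of [g]. *)
Definition inv_of g w := wmonic w &&
  [exists P : 'M[F]_(n, frobdim (chain n (wseq w))),
   exists Q : 'M[F]_(frobdim (chain n (wseq w)), n),
   [&& P *m Q == 1%:M, Q *m P == 1%:M &
       (GLval g : 'M_n) *m P == P *m frobmx (chain n (wseq w))]].

Lemma inv_ofP g w : reflect (wmonic w /\ simmx (GLval g : 'M_n) (frobmx (chain n (wseq w))))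
  (inv_of g w).
Proof.
apply: (iffP andP) => [[-> /existsP[P /existsP[Q /and3P[/eqP PQ /eqP QP /eqP AP]]]]|].
  by split=> //; exists P, Q.
move=> [-> [P [Q [PQ QP AP]]]]; split=> //.
by apply/existsP; exists P; apply/existsP; exists Q; rewrite PQ QP AP !eqxx.
Qed.

Lemma wmonic_seq w : wmonic w -> forall i, wseq w i \is monic.
Proof. by move=> /andP[_ /forallP mw] i; exact: mw. Qed.

Lemma wseqE w (i : 'I_n.+1) : wseq w i = w i.
Proof. by rewrite /wseq inord_val. Qed.

Lemma inv_of_uniq g w w' : inv_of g w -> inv_of g w' -> w = w'.
Proof.
move=> /inv_ofP[mw sw] /inv_ofP[mw' sw'].
have e : chain n (wseq w) = chain n (wseq w').
  apply: simmx_frobmx_uniq; try exact: chain_dvd; try exact/chain_monic/wmonic_seq.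
    by rewrite !size_chain.
  exact: simmx_trans (simmx_sym sw) sw'.
apply/ffunP => i; apply: val_inj => /=; rewrite -!wseqE.
have [i0|i_gt0] := posnP i.
  have -> : i = ord0 by apply: val_inj.
  by rewrite !wseqE; case/andP: mw => /eqP -> _; case/andP: mw' => /eqP -> _.
apply: (chain_inj (wmonic_seq mw) e); rewrite i_gt0 -ltnS ltn_ord //.
Qed.

Lemma inv_of_exists g : exists w, inv_of g w.
Proof.
have [s [ms cs szs simA _]] := invariant_factors (GLval g : 'M_n).
pose t := s ++ nseq (n - size s) 1.
have mt : {in t, forall D, D \is monic}.
  move=> D; rewrite mem_cat => /orP[/ms //|/nseqP[-> _]]; exact: monic1.
have szt : size t = n by rewrite size_cat size_nseq subnKC.
have simt : simmx (GLval g : 'M_n) (frobmx t).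
  by apply: simmx_trans simA (simmx_sym _); exact: simmx_frobmx_cat1.
have ct : dvd_chain t.
  have path1 k (E : {poly F}) : path (fun a b => b %| a) E (nseq k 1).
    by elim: k E => //= k IH E; rewrite dvd1p IH.
  rewrite /dvd_chain /t; case: (s) cs => [|D s'] cs.
    exact: path_sorted (path1 _ 1).
  by rewrite /= cat_path path1 andbT.
have [u [mu u0] uE] := chain_exists szt mt ct.
have dim : (\sum_(1 <= i < n.+1) i * (size (u i)).-1)%N = n.
  by rewrite -frobdim_chain // uE -(simmx_size simt).
have sz_u i : (i < n.+1)%N -> (size (u i) <= n.+1)%N.
  case: i => [|i] lt_i; first by rewrite u0 size_poly1.
  have le : (i.+1 * (size (u i.+1)).-1 <= n)%N.
    rewrite -[X in (_ <= X)%N]dim (bigD1_seq i.+1) ?iota_uniq //= ?leq_addr //.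
    by rewrite mem_index_iota.
  have : ((size (u i.+1)).-1 <= n)%N by apply: leq_trans le; rewrite leq_pmull.
  by move: (size _); clear; lia.
pose w : polytuple := [ffun i : 'I_n.+1 => npolyp n.+1 (u i)].
have wE i : (i < n.+1)%N -> wseq w i = u i.
  by move=> lt_i; rewrite /wseq ffunE inordK // npolypK // sz_u.
exists w; apply/inv_ofP; split.
  apply/andP; split; first by rewrite -wseqE wE // u0.
  by apply/forallP => i; rewrite -wseqE wE.
suff -> : chain n (wseq w) = chain n u by rewrite uE.
apply/eq_in_map => j; rewrite mem_iota => /andP[_ lt_j].
by apply: eq_big_nat => i /andP[_ lt_i]; rewrite wE.
Qed.

Lemma inv_of_class g h w : inv_of g w -> inv_of h w = (h \in g ^: [set: gT])%g.
Proof.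
move=> gw; have /inv_ofP[mw sg] := gw.
apply/idP/imsetP => [/inv_ofP[_ sh]|[x _ ->]].
  have [P uP AP] := simmx_conj (simmx_trans sg (simmx_sym sh)).
  pose x : gT := FinRing.unit _ (uP : P \is a GRing.unit).
  exists x; rewrite ?inE //; apply: (mulgI x).
  by rewrite conjgE !mulgA mulgV mul1g; apply: val_inj; exact: esym AP.
apply/inv_ofP; split=> //; apply: simmx_trans sg.
apply: (@conj_sim _ _ _ _ (invmx (GLval x))); first by rewrite unitmx_inv GL_unitmx.
have -> : GLval (g ^ x)%g = invmx (GLval x) *m (GLval g *m GLval x) by rewrite conjgE.
by rewrite -!mulmxA mulmxV ?GL_unitmx // mulmx1.
Qed.

Lemma inv_of_unit_exists w : wmonic w ->
    (\sum_(i < n.+1) i * (size (w i)).-1)%N = n ->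
    (forall i, (w i)`_0 != 0) -> exists g, inv_of g w.
Proof.
move=> mw dim nz.
have dimE : frobdim (chain n (wseq w)) = n.
  rewrite frobdim_chain; last exact: wmonic_seq.
  transitivity (\sum_(i < n.+1) i * (size (wseq w i)).-1)%N.
    by rewrite [RHS]big_ord_recl mul0n add0n big_add1 /= big_mkord.
  by rewrite -[RHS]dim; apply: eq_bigr => i _; rewrite wseqE.
have detB : \det (frobmx (chain n (wseq w))) != 0.
  rewrite det_frobmx_chain; last exact: wmonic_seq.
  rewrite prodf_seq_neq0; apply/allP => i _ /=.
  by rewrite expf_neq0 // /dsign mulf_neq0 ?signr_eq0 ?nz.
have cast k (B : 'M[F]_k) : k = n -> \det B != 0 ->
    exists2 B' : 'M[F]_n, B' \in unitmx & simmx B' B.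
  move=> kn; subst k; exists B; last exact: simmx_refl.
  by rewrite unitmxE unitfE.
have [B uB simB] := cast _ _ dimE detB.
by exists (FinRing.unit _ (uB : B \is a GRing.unit)); apply/inv_ofP.
Qed.

End Invariants.

Section RealClassesSum.
Local Open Scope group_scope.
Variables (gT : finGroupType) (S : {group gT}).

Lemma real_elt_conj g x : x \in S -> real_elt S g -> real_elt S (g ^ x).
Proof.
move=> xS /exists_inP[h hS /eqP e]; apply/exists_inP; exists (h ^ x).
  by rewrite groupJ.
by rewrite -conjVg -!conjMg e conjVg.
Qed.

(** Weighting each real element by the inverse of its class size replaces a count of SL-classes by a
    sum over elements, which can be regrouped by GL-classes. *)
Lemma card_real_classes :
  (#|real_classes S|%:R = \sum_(g in S | real_elt S g) (#|g ^: S|%:R)^-1 :> rat)%R.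
Proof.
pose A := [set g in S | real_elt S g].
have cA g : g \in A -> g ^: S \subset A.
  rewrite inE => /andP[gS rg]; apply/subsetP => _ /imsetP[x xS ->].
  by rewrite inE groupJ ?real_elt_conj.
have -> : real_classes S = [set g ^: S | g in A].
  apply/setP => C; rewrite inE; apply/andP/imsetP => [[/imsetP[g gS ->] /forall_inP rC]|[g gA ->]].
    by exists g; rewrite // inE gS rC ?class_refl.
  split; first by apply: mem_classes; move: gA; rewrite inE => /andP[].
  apply/forall_inP => x /(subsetP (cA g gA)); by rewrite inE => /andP[].
transitivity (\sum_(g in A) (#|g ^: S|%:R)^-1 : rat)%R; last first.
  by apply: eq_bigl => g; rewrite inE.
rewrite (partition_big_imset (fun g => g ^: S)) /= -sum1_card GRing.natr_sum.
apply: eq_bigr => _ /imsetP[g gA ->].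
transitivity (\sum_(i in g ^: S) (#|g ^: S|%:R)^-1 : rat)%R.
  rewrite GRing.sumr_const -[RHS]GRing.mulr_natl GRing.mulfV //.
  rewrite Num.Theory.pnatr_eq0 -lt0n; apply/card_gt0P; exists g; exact: class_refl.
apply: eq_big => [x|x /class_eqP -> //].
apply/idP/andP => [xg|[_ /eqP <-]]; last exact: class_refl.
by rewrite (subsetP (cA g gA)) //; split=> //; apply/eqP/class_eqP.
Qed.

End RealClassesSum.

Section RealInvariants.
Variables (F : finFieldType) (m : nat).
Local Notation n := m.+1.
Local Notation gT := {'GL_m.+1[F]}.
Local Notation q := #|F|.
Local Notation polytuple := (polytuple F m).
Implicit Types (g h : gT) (w : polytuple).

Definition wsrec w := [forall i, srec (w i)].

Definition wpow d w :=
  [forall i, [exists e : {poly_n.+1 F}, (polyn e \is monic) && (polyn (w i) == polyn e ^+ d)]].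

Definition wdet w : F := \prod_(i < n.+1) dsign (w i) ^+ i.

Definition wdim w := (\sum_(i < n.+1) i * (size (w i)).-1)%N.

Lemma dpowerP d (p : {poly_n.+1 F}) : (0 < d)%N -> polyn p \is monic ->
  reflect (dpower d (polyn p))
    [exists e : {poly_n.+1 F}, (polyn e \is monic) && (polyn p == polyn e ^+ d)].
Proof.
move=> d_gt0 mp; apply: (iffP existsP) => [[e /andP[me /eqP pe]]|[e me pe]].
  by exists e.
have sz_e : (size e <= n.+1)%N.
  apply: leq_trans (size_npoly p); apply: dvdp_leq; first exact: monic_neq0.
  by rewrite pe -[X in X %| _]expr1 dvdp_exp2l.
by exists (npolyp n.+1 e); rewrite npolypK // me pe eqxx.
Qed.

Lemma wpowP d w : (0 < d)%N -> wmonic w ->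
  reflect (forall i, dpower d (polyn (w i))) (wpow d w).
Proof.
move=> d_gt0 /andP[_ /forallP mw].
apply: (iffP forallP) => h i; first exact/(dpowerP d_gt0).
exact/(dpowerP d_gt0).
Qed.

Lemma wall (P : {poly F} -> Prop) w : wmonic w -> P 1 ->
  (forall i, P (polyn (w i))) <-> (forall i, (0 < i <= n)%N -> P (wseq w i)).
Proof.
move=> /andP[/eqP w0 _] P1; split=> [h i _|h i]; first exact: h.
have [i0|i_gt0] := posnP i.
  have -> : i = ord0 by exact: val_inj.
  by rewrite w0.
by rewrite -wseqE; apply: h; rewrite i_gt0 -ltnS ltn_ord.
Qed.

Lemma inv_of_dim g w : inv_of g w -> wdim w = n.
Proof.
move=> /inv_ofP[mw sg]; have := simmx_size sg.
rewrite frobdim_chain; last exact: wmonic_seq.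
move=> ->; rewrite /wdim big_ord_recl mul0n add0n big_add1 /= big_mkord.
by apply: eq_bigr => i _; rewrite -wseqE.
Qed.

Lemma inv_of_det g w : inv_of g w -> \det (GLval g) = wdet w.
Proof.
move=> /inv_ofP[mw sg]; rewrite (simmx_det sg) det_frobmx_chain; last exact: wmonic_seq.
rewrite /wdet big_ord_recl expr0 mul1r big_add1 /= big_mkord.
by apply: eq_bigr => i _; rewrite -wseqE.
Qed.

Lemma pred_card_gt0 : (0 < q.-1)%N.
Proof. by have := finNzRing_gt1 F; case: q => [|[]]. Qed.

Lemma det_index_wpow g w d : inv_of g w -> (d %| q.-1)%N -> (d %| det_index g)%N = wpow d w.
Proof.
move=> /inv_ofP[mw sg] dq; have d_gt0 := dvdn_gt0 pred_card_gt0 dq.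
have mu := wmonic_seq mw.
have iff1 := det_index_dvd dq sg (chain_monic mu).
have iff2 := chain_all n mu (dpower1 F d) (@dpowerM F d) (fun a b => @dpower_divl F d a b d_gt0).
have iff3 := wall mw (dpower1 F d).
apply/idP/(wpowP d_gt0 mw) => [/iff1/iff2/iff3 //|].
by move=> /iff3/iff2/iff1.
Qed.

Lemma det_index_totient g w : inv_of g w ->
  det_index g = (\sum_(d < q | (d %| q.-1) && wpow d w) totient d)%N.
Proof.
move=> gw; rewrite -[LHS]sum_totient_dvd.
have le : ((det_index g).+1 <= q)%N.
  have := dvdn_leq pred_card_gt0 (det_index_dvd_card g).
  by have := pred_card_gt0; case: q.
rewrite (big_ord_widen_cond q (fun d => d %| det_index g)%N totient) //.
apply: eq_bigl => d; apply/andP/andP => [[dh _]|[dq dw]].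
  have dq := dvdn_trans dh (det_index_dvd_card g).
  by rewrite dq -(det_index_wpow gw).
have dh : (d %| det_index g)%N by rewrite (det_index_wpow gw).
by rewrite dh ltnS dvdn_leq ?det_index_gt0.
Qed.

Lemma real_eltP (S : {group gT}) g :
  reflect (exists2 h, h \in S & g * h * g = h)%g (real_elt S g).
Proof.
apply: (iffP exists_inP) => [[h hS /eqP e]|[h hS e]].
  by exists h => //; rewrite -mulgA -[(h * g)%g](mulgKV h) e mulgA mulgV mul1g.
by exists h => //; apply/eqP/(mulgI g); rewrite mulgV !mulgA e mulgV.
Qed.

Lemma wsrecP w : reflect (forall i, srec (polyn (w i))) (wsrec w).
Proof. exact: forallP. Qed.

Lemma inv_of_reversible g w : inv_of g w ->
  wsrec w <-> (exists2 P : 'M[F]_n, P \in unitmx & GLval g *m P *m GLval g = P).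
Proof.
move=> /inv_ofP[mw sg]; have mu := wmonic_seq mw; have mc := @chain_monic F n _ mu.
have iff1 := reversible_iff (GL_unitmx g) sg mc (@chain_dvd F n (wseq w)).
have s0 : {in chain n (wseq w), forall D : {poly F}, D`_0 != 0}.
  by apply: frobmx_coef0_neq0 => //; rewrite -(simmx_det sg); exact: (GL_det g).
have iff2 := @chain_all F n _ (fun p => srec p) mu (srec1 F) (@srecM F) (@srec_divl F).
have iff3 := @wall (fun p => srec p) w mw (srec1 F).
split=> [/wsrecP/iff3/iff2 h|/iff1 h].
  by apply/iff1 => D /h /andP[_ /eqP].
by apply/wsrecP/iff3/iff2 => D Ds; rewrite /srec s0 //= h.
Qed.

End RealInvariants.

(** * The matrices reversing A form a coset of its centralizer *)

Section MatrixReversers.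
Variables (F : fieldType) (n : nat) (A P X : 'M[F]_n).
Hypothesis AP : A *m P *m A = P.

Lemma reverser_div_comm : A \in unitmx -> P \in unitmx -> A *m X *m A = X ->
  comm_mx A (invmx P *m X).
Proof.
move=> uA uP AX; have uAP : A *m P \in unitmx by rewrite unitmx_mul uA.
apply: (can_inj (mulKmx uAP)).
by rewrite !mulmxA AP mulmxV // mul1mx -(mulmxA A P) mulmxV // mulmx1 AX.
Qed.

Lemma reverser_sqr_comm : P *m P *m A = A *m (P *m P).
Proof.
transitivity (A *m P *m (A *m P *m A)); first by rewrite !mulmxA AP.
by rewrite AP mulmxA.
Qed.

Lemma reverser_mul_comm : X *m A = A *m X -> A *m (P *m X) *m A = P *m X.
Proof. by move=> XA; rewrite -!mulmxA XA !mulmxA AP. Qed.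

End MatrixReversers.

Section RealSL.
Variables (F : finFieldType) (m : nat).
Local Notation n := m.+1.
Local Notation gT := {'GL_m.+1[F]}.
Local Notation q := #|F|.
Local Notation polytuple := (polytuple F m).
Implicit Types (g h : gT) (w : polytuple).

Hypothesis n_mod4 : (n = 2 %[mod 4])%N.
Hypothesis q_mod4 : (q = 3 %[mod 4])%N.

Lemma oppr1_neq1 : (-1 : F) != 1.
Proof.
apply/negP => /eqP e; have p2 : 2%N \in [pchar F].
  by rewrite inE /= mulr2n -{1}e addNr.
have := finField_char_nat (idfun : {rmorphism F -> F}).
rewrite (eq_pnat _ (pcharf_eq p2)) => /p_natP[k qE].
have q_gt1 := finNzRing_gt1 F; move: q_mod4 q_gt1; rewrite qE.
case: k {qE} => [|k] //; rewrite expnS => h _.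
by move: h; move: (2 ^ k)%N; clear; lia.
Qed.

Lemma dvd2_pred_card : (2 %| q.-1)%N.
Proof. by move: q_mod4; move: q; clear; lia. Qed.

(** (q - 1)/2 is odd, so y^2 = -1 would give y^(q-1) = -1. *)
Lemma oppr1_nonsquare (y : F) : y ^+ 2 != -1.
Proof.
apply/negP => /eqP e; have nzy : y != 0.
  by apply: contra_eq_neq e => ->; rewrite expr0n /= eq_sym oppr_eq0 oner_eq0.
have : y ^+ q.-1 = 1.
  by apply: (mulfI nzy); rewrite -exprS prednK ?expf_card ?mulr1 // ltnW // finNzRing_gt1.
have -> : q.-1 = (2 * (q.-1)./2)%N.
  by have := dvd2_pred_card; rewrite mul2n dvdn2 => /even_halfK.
rewrite exprM e -signr_odd.
have -> : odd (q.-1)./2 by move: q_mod4; move: q; clear; lia.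
by rewrite expr1 => /eqP; rewrite (negPf oppr1_neq1).
Qed.

Lemma real_eltE g w : g \in SL n F -> inv_of g w ->
  real_elt (SL n F) g = wsrec w && ~~ wpow 2 w.
Proof.
move=> gSL gw; have /inv_ofP[mw sg] := gw; have mu := wmonic_seq mw.
have rev := inv_of_reversible gw.
pose H := (GLdet_morphism F m @* 'C[g])%G.
apply/(@real_eltP _ _ [group of SL n F])/andP => [[h hSL ghg]|[/rev[P uP gP] nsq]].
  have srw : wsrec w.
    apply/rev; exists (GLval h); first exact: (GL_unitmx h).
    by have e := congr1 val ghg; exact: e.
  split=> //; apply/negP => sqw.
  have sq2 : forall i, dpower 2 (polyn (w i)) by apply/wpowP.
  have sD : {in chain n (wseq w), forall D, dpower 2 D}.
    have iff2 := @chain_all F n _ _ mu (dpower1 F 2) (@dpowerM F 2)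
      (fun a b => @dpower_divl F 2 a b isT).
    by apply/iff2/(wall mw (dpower1 F 2)).
  have rD : {in chain n (wseq w), forall D, recip D = D}.
    by apply/(reversible_iff (GL_unitmx g) sg (@chain_monic F n _ mu) (@chain_dvd F n (wseq w)))/rev.
  have [P [uP gP dP]] := simmx_self_reverser (GL_unitmx g) sg (@chain_monic F n _ mu) rD.
  have {}dP : \det P = -1.
    rewrite dP => [|D /sD[e me ->]].
      rewrite -signr_odd; have -> : odd n./2 by move: n_mod4; clear; lia.
      by rewrite expr1.
    rewrite (size_monicS (monic_exp 2 me)) size_exp /= oddM andbF //.
  have gh : GLval g *m GLval h *m GLval g = GLval h.
    by have e := congr1 val ghg; exact: e.
  have C := reverser_div_comm gP (GL_unitmx g) uP gh.
  have sqC := centralizer_det_dpower (isT : 0 < 2)%N dvd2_pred_card sg (@chain_monic F n _ mu).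
  have [|y] := sqC.2 sD _ C.
    by rewrite unitmx_mul unitmx_inv uP; exact: (GL_unitmx h).
  rewrite det_mulmx det_inv dP invrN1.
  have -> : \det (GLval h) = 1 by move: hSL; rewrite inE => /eqP.
  by rewrite mulr1 => /esym/eqP; rewrite (negPf (oppr1_nonsquare y)).
have [h0 h0E] : exists h0 : gT, GLval h0 = P.
  by exists (FinRing.unit _ (uP : P \is a GRing.unit)).
rewrite -h0E in gP => {P uP h0E}.
have h02 : (h0 ^+ 2 \in 'C[g])%g 
  by apply/cent1P; apply: val_inj; exact: reverser_sqr_comm gP.
have hodd : odd (det_index g).
  by move: nsq; rewrite -(det_index_wpow gw dvd2_pred_card) dvdn2 negbK.
pose x := GLdet h0.
have abU : abelian [set: {unit F}] := cyclic_abelian (cyclic_units F).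
have xh : (x ^+ det_index g \in H)%g by apply: abelian_expg_index; rewrite ?subsetT ?inE.
have x2 : (x ^+ 2 \in H)%g.
  have := mem_morphim (GLdet_morphism F m) (in_setT _) h02.
  by rewrite morphX ?inE.
have xH : x \in H.
  have := odd_double_half (det_index g); rewrite hodd add1n => e.
  (* Write the odd index as 2 k + 1; both factors lie in H. *)
  have -> : (x = x ^+ det_index g * ((x ^+ 2) ^+ (det_index g)./2)^-1)%g.
    by rewrite -{1}e expgS -expgM mul2n mulgK.
  exact: groupM xh (groupVr (groupX _ x2)).
have /morphimP[c _ cC xc] := xH.
exists (h0 * c^-1)%g.
  have -> : [group of SL n F] = ('ker (GLdet_morphism F m))%G.
    by apply: val_inj; rewrite /= ker_GLdet.
  apply/kerP; rewrite ?inE // morphM ?inE // morphV ?inE //=.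
  by rewrite -xc mulgV.
apply: val_inj; apply: (reverser_mul_comm gP).
have /cent1P/(congr1 val) e : (c^-1 \in 'C[g])%g by rewrite groupV.
exact: e.
Qed.

End RealSL.

Section ClassSum.
Variables (F : finFieldType) (m : nat).
Local Notation n := m.+1.
Local Notation gT := {'GL_m.+1[F]}.
Local Notation q := #|F|.
Local Notation polytuple := (polytuple F m).
Implicit Types (g h : gT) (w : polytuple).

Definition wgood w := [&& wmonic w, wsrec w, wdim w == n & wdet w == 1].

Definition winv g : polytuple := xchoose (inv_of_exists g).

Lemma winvP g : inv_of g (winv g).
Proof. exact: xchooseP. Qed.

Lemma winv_eq g w : (winv g == w) = inv_of g w.
Proof.
apply/eqP/idP => [<-|gw]; first exact: winvP.
exact: inv_of_uniq (winvP g) gw.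
Qed.

(** Over the GL-class K of a tuple, every SL-class has size |K| / h, so the weights h / |K| add up
    to h. *)
Lemma real_classes_sum : (n = 2 %[mod 4])%N -> (q = 3 %[mod 4])%N ->
  #|real_classes (SL n F)| =
  (\sum_(w | wgood w && ~~ wpow 2 w) \sum_(d < q | (d %| q.-1) && wpow d w) totient d)%N.
Proof.
move=> n_mod4 q_mod4.
have condE g w : inv_of g w ->
    (g \in SL n F) && real_elt (SL n F) g = wgood w && ~~ wpow 2 w.
  move=> gw; have gSL : (g \in SL n F) = (wdet w == 1).
    by rewrite inE -(inv_of_det gw).
  have [sl|nsl] := boolP (g \in SL n F).
    rewrite (real_eltE n_mod4 q_mod4 sl gw) /wgood -gSL sl (inv_of_dim gw) eqxx.
    by have /inv_ofP[-> _] := gw; rewrite /= andbT.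
  by rewrite /wgood -gSL (negPf nsl) !andbF.
apply/eqP; rewrite -(@Num.Theory.eqr_nat rat); apply/eqP.
rewrite (card_real_classes (SL_group n F)) natr_sum /=.
rewrite (partition_big winv (fun w => wgood w && ~~ wpow 2 w)) /=; last first.
  by move=> g; rewrite (condE g _ (winvP g)).
apply: eq_bigr => w gdw; have := gdw.
rewrite /wgood => /andP[/and4P[mw sw /eqP dw _] _].
have [g0 g0w] : exists g, inv_of g w.
  by apply: inv_of_unit_exists => // i; have /wsrecP/(_ i)/andP[] := sw.
pose K := (g0 ^: [set: gT])%g.
have cK : (#|K|%:R != 0 :> rat).
  rewrite Num.Theory.pnatr_eq0 -lt0n; apply/card_gt0P; exists g0; exact: class_refl.
transitivity (\sum_(g in K) (det_index g0)%:R / #|K|%:R : rat); last first.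
  by rewrite sumr_const -[LHS]mulr_natl mulrC divfK // (det_index_totient g0w).
apply: eq_big => [g|g /andP[_]].
  rewrite winv_eq -(inv_of_class _ g0w).
  by apply: andb_idl => gw; rewrite (condE g w gw).
rewrite winv_eq => gw; have gK : g \in K by rewrite -(inv_of_class _ g0w).
have hE : det_index g = det_index g0 by rewrite (det_index_totient g0w) (det_index_totient gw).
have KE : K = (g ^: [set: gT])%g by apply/esym/class_eqP.
have := card_class_SL g; rewrite -KE hE => ->.
rewrite natrM invfM mulrCA mulrV ?mulr1 // unitfE.
by rewrite Num.Theory.pnatr_eq0 -lt0n det_index_gt0.
Qed.

End ClassSum.

(** Keeping the range N for j is harmless: f (d j) is trivial once d j >= N. *)
Lemma big_multiples (R : Type) (idx : R) (op : Monoid.law idx) d N (f : nat -> R) :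
    (0 < d)%N -> (forall i, ~~ (d %| i)%N -> f i = idx) ->
    (forall i, (N <= i)%N -> f i = idx) ->
  \big[op/idx]_(i < N) f i = \big[op/idx]_(j < N) f (d * j)%N.
Proof.
move=> d_gt0 f_mul f_big.
have block M : \big[op/idx]_(0 <= i < d * M) f i = \big[op/idx]_(0 <= j < M) f (d * j)%N.
  elim: M => [|M IH]; first by rewrite muln0 !big_geq.
  rewrite mulnS addnC (big_cat_nat (n := (d * M)%N)) ?leq_addr //= IH.
  rewrite big_nat_recr //=; congr (op _ _).
  rewrite big_ltn; last by rewrite -addn1 leq_add2l.
  rewrite big_nat_cond big1 ?Monoid.mulm1 // => i; rewrite andbT => /andP[lt_i i_lt].
  apply: f_mul; rewrite -(subnKC (ltnW lt_i)) dvdn_addr ?dvdn_mulr //.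
  by rewrite gtnNdvd ?subn_gt0 // ltn_subLR // ltnW.
rewrite -(big_mkord xpredT f) -(big_mkord xpredT (fun j => f (d * j)%N)) -block [RHS](big_cat_nat (n := N)) ?leq_pmull //=.
by rewrite [X in op _ X]big_nat_cond [X in op _ X]big1 ?Monoid.mulm1 // => i /andP[/andP[/f_big]].
Qed.

(** * Powers and supports *)

Section PowerSupport.
Variables (F : finFieldType) (m : nat).
Local Notation n := m.+1.
Local Notation q := #|F|.
Local Notation polytuple := (polytuple F m).
Implicit Types (u w : polytuple) (p : {poly F}).

Definition wsupp d u := [forall i, (polyn (u i) != 1) ==> (d %| i)%N].

Lemma wsuppP d u :
  reflect (forall i : 'I_n.+1, ~~ (d %| i)%N -> polyn (u i) = 1) (wsupp d u).
Proof.
apply: (iffP forallP) => h i; last by apply/implyP; apply: contraR => /h ->.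
by move=> nd; apply/eqP; move: nd; apply: contraR => ui; apply: (implyP (h i)).
Qed.

Lemma srec_exp d p : srec p -> srec (p ^+ d).
Proof.
move=> sp; elim: d => [|d IH]; first by rewrite expr0 srec1.
by rewrite exprS srecM.
Qed.

Lemma recip_exp d p : p != 0 -> recip (p ^+ d) = recip p ^+ d.
Proof.
move=> nzp; elim: d => [|d IH]; first by rewrite !expr0 recip1.
by rewrite !exprS recipM ?expf_neq0 // IH.
Qed.

Lemma srec_root d p : (0 < d)%N -> p \is monic -> srec (p ^+ d) -> srec p.
Proof.
move=> d_gt0 mp /andP[nz /eqP r]; have nz0 : p`_0 != 0.
  by apply: contraNneq nz => p0; rewrite -(prednK d_gt0) exprS coef0M p0 mul0r.
rewrite /srec nz0 /=; apply/eqP/(monic_expr_inj d_gt0) => //.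
  exact: recip_monic.
by rewrite -recip_exp ?monic_neq0.
Qed.

Lemma dsign_exp d p : p != 0 -> dsign (p ^+ d) = dsign p ^+ d.
Proof.
move=> nzp; elim: d => [|d IH]; first by rewrite !expr0 dsign1.
by rewrite !exprS dsignM ?expf_neq0 // IH.
Qed.

Lemma wseq_end u i : wmonic u -> (n < i)%N -> wseq u i = 1.
Proof.
move=> /andP[/eqP u0 _] lt_i; rewrite /wseq.
suff -> : inord i = ord0 :> 'I_n.+1 by [].
by apply: val_inj; rewrite /inord /insubd insubF // ltnS leqNgt lt_i.
Qed.

Lemma wseq0 u : wmonic u -> wseq u 0 = 1.
Proof. by move=> /andP[/eqP <- _]; rewrite -wseqE. Qed.

Definition wexp d u : polytuple := [ffun j : 'I_n.+1 => npolyp n.+1 (wseq u (d * j) ^+ d)].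

Section Transfer.
Variables (d : nat) (u : polytuple).
Hypotheses (d_gt0 : (0 < d)%N) (mu : wmonic u) (su : wsupp d u).
Hypothesis sz_u : forall j : 'I_n.+1, (size (wseq u (d * j) ^+ d) <= n.+1)%N.

Lemma wexpE (j : 'I_n.+1) : wexp d u j = wseq u (d * j) ^+ d :> {poly F}.
Proof. by rewrite ffunE npolypK. Qed.

Let useq i : ~~ (d %| i)%N -> wseq u i = 1.
Proof.
move=> nd; have [lt_i|] := ltnP n i; first exact: wseq_end.
by rewrite -ltnS => lt_i; rewrite /wseq; apply: (wsuppP _ _ su); rewrite inordK.
Qed.

Lemma wexp_monic : wmonic (wexp d u).
Proof.
apply/andP; split.
  by rewrite wexpE muln0 wseq0 // expr1n.
by apply/forallP => j; rewrite wexpE monic_exp // wmonic_seq.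
Qed.

Lemma wexp_dim : wdim (wexp d u) = wdim u.
Proof.
rewrite /wdim; pose f i := (i * (size (wseq u i)).-1)%N.
transitivity (\sum_(i < n.+1) f i)%N; last by apply: eq_bigr => i _; rewrite /f wseqE.
rewrite (big_multiples _ d_gt0 (f := f)).
- apply: eq_bigr => j _; rewrite wexpE /f size_exp.
  by rewrite [(d * j)%N]mulnC -mulnA [(d * _)%N in RHS]mulnC.
- by move=> i nd; rewrite /f useq // size_poly1 muln0.
- by move=> i lt_i; rewrite /f wseq_end // size_poly1 muln0.
Qed.

Lemma wexp_det : wdet (wexp d u) = wdet u.
Proof.
rewrite /wdet; pose f i := dsign (wseq u i) ^+ i.
transitivity (\prod_(i < n.+1) f i); last by apply: eq_bigr => i _; rewrite /f wseqE.
rewrite (big_multiples _ d_gt0 (f := f)).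
- apply: eq_bigr => j _; rewrite wexpE /f dsign_exp -?exprM //.
  by rewrite monic_neq0 // wmonic_seq.
- by move=> i nd; rewrite /f useq // dsign1 expr1n.
- by move=> i lt_i; rewrite /f wseq_end // dsign1 expr1n.
Qed.

Lemma wexp_srec : wsrec (wexp d u) = wsrec u.
Proof.
apply/wsrecP/wsrecP => h i; last first.
  by rewrite wexpE srec_exp // /wseq h.
have [di|nd] := boolP (d %| i)%N; last by rewrite -wseqE useq // srec1.
have lt_j : (i %/ d < n.+1)%N by apply: leq_ltn_trans (leq_div _ _) (ltn_ord i).
have := h (Ordinal lt_j); rewrite wexpE /= mulnC divnK // => /(srec_root d_gt0).
by rewrite wseqE; apply; rewrite -wseqE wmonic_seq.
Qed.

Lemma wexp_good : wgood (wexp d u) = wgood u.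
Proof. by rewrite /wgood wexp_monic wexp_srec wexp_dim wexp_det mu. Qed.

End Transfer.

(** Ensures that nothing is truncated in [wexp]: for 0 < d j <= n, d deg u_(d j) <= d j deg u_(d j)
    <= n. *)
Lemma wgood_size d u : (0 < d)%N -> wgood u ->
  forall j : 'I_n.+1, (size (wseq u (d * j) ^+ d) <= n.+1)%N.
Proof.
move=> d_gt0 /and4P[mu _ /eqP dimu _] j.
have [j0|j_gt0] := posnP j.
  by rewrite j0 muln0 wseq0 // expr1n size_poly1.
have [lt_n|le_n] := ltnP n (d * j); first by rewrite wseq_end // expr1n size_poly1.
have szE := size_exp (wseq u (d * j)) d.
have : ((d * j) * (size (wseq u (d * j))).-1 <= n)%N.
  rewrite -{3}dimu /wdim (bigD1 (inord (d * j))) //= inordK //.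
  exact: leq_addr.
move=> le; move: szE; move: (size (wseq u (d * j)%N ^+ d)) => a aE.
have : (a.-1 <= n)%N.
  by rewrite aE mulnC; apply: leq_trans le; rewrite leq_mul2r leq_pmulr ?orbT.
by move: a {aE le}; clear; lia.
Qed.

Lemma card_wpow_wsupp d : (0 < d)%N ->
  #|[set w : polytuple | wgood w && wpow d w]| =
  #|[set u : polytuple | wgood u && wsupp d u]|.
Proof.
move=> d_gt0; have gm u : wgood u -> wmonic u by case/andP.
rewrite -[RHS](@card_in_imset _ _ (wexp d)) => [|u v]; last first.
  rewrite !inE => /andP[gu su] /andP[gv sv] /ffunP e; apply/ffunP => i.
  apply: val_inj => /=.
  have [di|nd] := boolP (d %| i)%N; last by rewrite (wsuppP _ _ su) // (wsuppP _ _ sv).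
  have lt_j : (i %/ d < n.+1)%N by apply: leq_ltn_trans (leq_div _ _) (ltn_ord i).
  have := congr1 val (e (Ordinal lt_j)); rewrite /= !wexpE; try exact: wgood_size.
  rewrite /= mulnC divnK // !wseqE; apply: monic_expr_inj => //.
    by rewrite -wseqE wmonic_seq ?gm.
  by rewrite -wseqE wmonic_seq ?gm.
apply: eq_card => w; rewrite inE; apply/andP/imsetP => [[gw pw]|[u]]; last first.
  rewrite inE => /andP[gu su] ->; have szu := wgood_size d_gt0 gu.
  rewrite wexp_good ?gm //; split=> //; apply/wpowP => //.
    exact: wexp_monic (gm _ gu) szu.
  by move=> j; rewrite wexpE //; exists (wseq u (d * j)); rewrite ?wmonic_seq ?gm.
have mw := gm _ gw; have /(wpowP d_gt0 mw) rootw := pw.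
pose v (j : 'I_n.+1) : {poly_n.+1 F} :=
  odflt (npolyp n.+1 1) [pick e : {poly_n.+1 F} | (polyn e \is monic) && (polyn (w j) == polyn e ^+ d)].
have vP j : polyn (v j) \is monic /\ polyn (w j) = polyn (v j) ^+ d.
  rewrite /v; case: pickP => [e /andP[me /eqP we] //|no].
  have /(dpowerP d_gt0) : dpower d (polyn (w j)) by exact: rootw.
  by rewrite -wseqE wmonic_seq // => /(_ isT)/existsP[e]; rewrite wseqE no.
pose u : polytuple := [ffun i : 'I_n.+1 =>
  if (d %| i)%N then v (inord (i %/ d)) else npolyp n.+1 1].
have poly1K : polyn (npolyp n.+1 1) = 1 :> {poly F} by rewrite npolypK // size_poly1.
have uE (j : 'I_n.+1) : (d * j <= n)%N -> wseq u (d * j) = v j.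
  by move=> le; rewrite /wseq ffunE inordK // dvdn_mulr // mulKn // inord_val.
have v0 : polyn (v ord0) = 1.
  apply: (monic_expr_inj d_gt0); rewrite ?monic1 ?(vP ord0).1 //.
  by rewrite -(vP ord0).2 expr1n; case/andP: mw => /eqP.
have mu : wmonic u.
  apply/andP; split.
    by rewrite -wseqE -[X in wseq u X](muln0 d) (uE ord0) ?muln0 // v0.
  apply/forallP => i; rewrite ffunE; case: ifP => _; last by rewrite poly1K monic1.
  exact: (vP _).1.
have su : wsupp d u.
  by apply/wsuppP => i /negPf nd; rewrite ffunE nd poly1K.
have uw (j : 'I_n.+1) : wseq u (d * j) ^+ d = w j.
  have [lt_n|le_n] := ltnP n (d * j); last by rewrite uE // (vP j).2.
  (* The tuple [u] has no place for the root [v j] when d j > n, but then d j deg v_j <= n forces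
     [v j] to be 1. *)
  rewrite wseq_end // expr1n (vP j).2; suff -> : polyn (v j) = 1 by rewrite expr1n.
  apply/eqP; rewrite -eqp_monic ?monic1 ?(vP j).1 // -size_poly_eq1.
  rewrite (size_monicS (vP j).1) eqSS -leqn0 leqNgt; apply/negP => sv.
  case/and4P: gw => _ _ /eqP dimw _; move: lt_n; rewrite ltnNge => /negP; apply.
  rewrite -[X in (_ <= X)%N]dimw /wdim (bigD1 j) //= (vP j).2 size_exp.
  by rewrite (leq_trans _ (leq_addr _ _)) // mulnC leq_mul2l mulnC leq_pmulr ?orbT.
have szu (j : 'I_n.+1) : (size (wseq u (d * j) ^+ d) <= n.+1)%N.
  by rewrite uw size_npoly.
have wE : w = wexp d u.
  by apply/ffunP => j; apply: val_inj; rewrite /= wexpE // uw.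
exists u => //; rewrite inE su andbT -(wexp_good d_gt0 mu su szu) -wE //.
Qed.

End PowerSupport.

(** * Removing the tuples of squares, divisor by divisor *)

Section PowerSum.
Variables (F : finFieldType) (m : nat).
Local Notation n := m.+1.
Local Notation q := #|F|.
Local Notation polytuple := (polytuple F m).
Implicit Types (u w : polytuple) (p : {poly F}).

Lemma dpower_dvd c d p : (c %| d)%N -> dpower d p -> dpower c p.
Proof.
move=> /dvdnP[k ->] [e me ->]; exists (e ^+ k); first exact: monic_exp.
by rewrite -exprM.
Qed.

(** With d = 2 k + 1 and p = v^d = c^2, v^k divides c, and the quotient g satisfies v = g^2. *)
Lemma dpower_odd_lcm d p : odd d -> dpower d p -> dpower 2 p -> dpower (2 * d) p.
Proof.
move=> od [v mv pv] [c mc pc]; have := odd_double_half d; rewrite od add1n => dE.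
have : (v ^+ d./2) ^+ 2 %| c ^+ 2.
  by rewrite -pc pv -exprM muln2 -{2}dE exprS dvdp_mulIr.
rewrite dvdp_pexp2r // => /dvdpP[g cE].
have mg : g \is monic by rewrite -(monicMr _ (monic_exp d./2 mv)) -cE.
have vE : v = g ^+ 2.
  apply: (mulIf (expf_neq0 (d./2).*2 (monic_neq0 mv))).
  by rewrite -exprS dE -pv pc cE exprMn -exprM muln2.
by exists g; rewrite // pv vE -exprM.
Qed.

Let lcm2 d := if odd d then (2 * d)%N else d.

Let dvd_lcm2 d i : (lcm2 d %| i)%N = (d %| i)%N && (2 %| i)%N.
Proof.
rewrite /lcm2; case: ifP => [od|/negbT ed].
  by rewrite Gauss_dvd ?coprime2n // andbC.
by apply/idP/andP => [di|[]] //; split=> //; apply: dvdn_trans di; rewrite dvdn2.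
Qed.

Lemma wpow_lcm2 d w : (0 < d)%N -> wmonic w ->
  wpow (lcm2 d) w = wpow d w && wpow 2 w.
Proof.
move=> d_gt0 mw; have l_gt0 : (0 < lcm2 d)%N by rewrite /lcm2; case: ifP => _; rewrite ?muln_gt0.
have := dvdnn (lcm2 d); rewrite dvd_lcm2 => /andP[dl twol].
have two := @wpowP F m 2 w isT mw.
apply/(wpowP l_gt0 mw)/andP => [h|[/(wpowP d_gt0 mw) hd /two h2] i].
  by split; [apply/(wpowP d_gt0 mw) | apply/two] => i; apply: dpower_dvd (h i).
by rewrite /lcm2; case: ifP => od //; apply: dpower_odd_lcm.
Qed.

Lemma wsupp_lcm2 d u : wsupp (lcm2 d) u = wsupp d u && wsupp 2 u.
Proof.
rewrite /wsupp; apply/forallP/andP => [h|[/forallP hd /forallP h2] i].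
  by split; apply/forallP => i; apply/implyP => /(implyP (h i)); rewrite dvd_lcm2 => /andP[].
by apply/implyP => ui; rewrite dvd_lcm2 (implyP (hd i)) // (implyP (h2 i)).
Qed.

Lemma card_wpow_wsupp_odd d : (0 < d)%N ->
  #|[set w : polytuple | [&& wgood w, ~~ wpow 2 w & wpow d w]]| =
  #|[set u : polytuple | [&& wgood u, ~~ wsupp 2 u & wsupp d u]]|.
Proof.
move=> d_gt0; have l_gt0 : (0 < lcm2 d)%N by rewrite /lcm2; case: ifP => _; rewrite ?muln_gt0.
have split_card (P2 Pd Pl : pred polytuple) :
    (forall w, wgood w -> Pl w = Pd w && P2 w) ->
    (#|[set w | [&& wgood w, ~~ P2 w & Pd w]]| + #|[set w | wgood w && Pl w]|
     = #|[set w | wgood w && Pd w]|)%N.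
  move=> PlE; rewrite -(cardsID [set w | P2 w] [set w | wgood w && Pd w]) addnC.
  congr (_ + _)%N; apply: eq_card => w; rewrite !inE.
    by case: (boolP (wgood w)) => // /PlE ->; rewrite /= andbC.
  by case: (wgood w); case: (P2 w); case: (Pd w).
have gm w : wgood w -> wpow (lcm2 d) w = wpow d w && wpow 2 w.
  by move=> /andP[mw _]; exact: wpow_lcm2.
have e1 := split_card (wpow 2) (wpow d) (wpow (lcm2 d)) gm.
have e2 := split_card (wsupp 2) (wsupp d) (wsupp (lcm2 d)) (fun u _ => wsupp_lcm2 d u).
apply/eqP; rewrite -(eqn_add2r #|[set w : polytuple | wgood w && wpow (lcm2 d) w]|).
by rewrite e1 !card_wpow_wsupp // -e2.
Qed.

Lemma sum_wpow_wsupp :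
  (\sum_(w : polytuple | wgood w && ~~ wpow 2 w)
      \sum_(d < q | (d %| q.-1) && wpow d w) totient d =
   \sum_(u : polytuple | wgood u && ~~ wsupp 2 u)
      \sum_(d < q | (d %| q.-1) && wsupp d u) totient d)%N.
Proof.
have swap (P2 : pred polytuple) (Pd : nat -> pred polytuple) :
    (\sum_(w : polytuple | wgood w && ~~ P2 w)
       \sum_(d < q | (d %| q.-1) && Pd d w) totient d =
     \sum_(d < q | d %| q.-1) #|[set w | [&& wgood w, ~~ P2 w & Pd d w]]| * totient d)%N.
  rewrite (exchange_big_dep (fun d : 'I_q => d %| q.-1)%N) /=; last first.
    by move=> w d _ /andP[].
  apply: eq_bigr => d dq; rewrite -sum_nat_const; apply: eq_bigl => w.
  by rewrite inE dq /= andbA.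
rewrite !swap; apply: eq_bigr => d dq; congr (_ * _)%N.
exact: card_wpow_wsupp_odd (dvdn_gt0 (pred_card_gt0 F) dq).
Qed.

End PowerSum.

(** * Counting self-reciprocal polynomials *)

Section SelfReciprocalCount.
Variables (F : finFieldType) (N : nat).
Local Notation q := #|F|.
Implicit Types (p : {poly F}) (c : F).

Lemma srec_coef p c d : size p = d.+1 -> p \is monic -> p`_0 = c -> c * c = 1 ->
  srec p <-> (forall i, (i <= d)%N -> p`_i = c * p`_(d - i)).
Proof.
move=> szp mp p0 cc; have nzc : c != 0.
  by apply: contra_eq_neq cc => ->; rewrite mul0r eq_sym oner_eq0.
have cV : c^-1 = c by apply: (mulfI nzc); rewrite mulfV.
rewrite /srec p0 nzc /=; split=> [/eqP rp i le_i|h].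
  by rewrite -{1}rp coef_recip szp //= p0 cV.
apply/eqP/polyP => i; have [le_i|lt_i] := leqP i d.
  by rewrite coef_recip szp //= p0 cV -h.
by rewrite !nth_default // ?size_recip ?szp ?p0.
Qed.

Lemma srec_coef0 p : srec p -> p \is monic -> (p`_0 == 1) || (p`_0 == -1).
Proof.
move=> /andP[nz /eqP rp] mp; rewrite -eqf_sqr expr1n expr2.
have := coef_recip (leq0n (size p).-1); rewrite rp subn0 -lead_coefE (monicP mp).
by move=> /(congr1 (fun x => p`_0 * x)); rewrite mulr1 mulfV // => ->.
Qed.

Definition srec_set d : {set {poly_N F}} :=
  [set p : {poly_N F} | [&& size p == d.+1, polyn p \is monic & srec p]].

Section FixedConstantTerm.
Variables (d r : nat) (c : F).
Hypotheses (d_gt0 : (0 < d)%N) (d_lt : (d < N)%N) (cc : c * c = 1).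
(** Three cases are treated at once: d = 2 r, where c = 1 and the middle coefficient is free; d = 2
    r + 1, without middle coefficient; d = 2 r + 2, where the middle coefficient satisfies x = c x
    and must vanish. *)
Hypotheses (le_2r : (2 * r <= d)%N) (c1 : (2 * r)%N = d -> c = 1).
Hypothesis le_d : (d <= 2 * r + 2)%N.
Hypothesis cN : d = (2 * r + 2)%N -> forall x : F, x = c * x -> x = 0.

(* The coefficients of index [1 .. r] are free, the others are forced by
   [p`_i = c * p`_(d - i)]. *)
Definition srec_fill (t : {poly_r F}) : {poly F} :=
  \poly_(j < d.+1) (if j == 0%N then c else if j == d then 1
    else if (j <= r)%N then t`_j.-1 else if (d - j <= r)%N then c * t`_(d - j).-1 else 0).

Lemma coef_srec_fill t j : (j <= d)%N -> (srec_fill t)`_j =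
  if j == 0%N then c else if j == d then 1
    else if (j <= r)%N then t`_j.-1 else if (d - j <= r)%N then c * t`_(d - j).-1 else 0.
Proof. by move=> le_j; rewrite coef_poly ltnS le_j. Qed.

Lemma size_srec_fill t : size (srec_fill t) = d.+1.
Proof. by rewrite size_poly_eq // eqn0Ngt d_gt0 eqxx oner_eq0. Qed.

Lemma srec_fillK t : npolyp N (srec_fill t) = srec_fill t :> {poly F}.
Proof. by rewrite npolypK // size_srec_fill. Qed.

Lemma card_srec_const : #|[set p in srec_set d | (polyn p)`_0 == c]| = (q ^ r)%N.
Proof.
have lt_rd : (r < d)%N by move: le_2r d_gt0; clear; lia.
rewrite -(card_npoly F r) -(@card_imset _ _ (fun t => npolyp N (srec_fill t))); last first.
  move=> t t' /(congr1 val) /=; rewrite !srec_fillK => e; apply/npolyP => k.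
  have [lt_k|le_k] := ltnP k r; last by rewrite !big_coef_npoly.
  have := congr1 (fun p : {poly F} => p`_k.+1) e.
  have lt_kd : (k.+1 < d)%N by apply: leq_ltn_trans lt_rd.
  have cE u : (srec_fill u)`_k.+1 = u`_k.
    by rewrite coef_srec_fill ?(ltnW lt_kd) // (ltn_eqF lt_kd) lt_k.
  by rewrite /= !cE.
apply: eq_card => p; rewrite !inE; apply/andP/imsetP => [[/and3P[/eqP szp mp sp] /eqP p0]|[t _ ->]].
  have pE := (srec_coef szp mp p0 cc).1 sp.
  exists (npolyp r (\poly_(k < r) p`_k.+1)) => //; apply: val_inj; rewrite /= srec_fillK.
  have tE k : (npolyp r (\poly_(k < r) p`_k.+1))`_k = if (k < r)%N then p`_k.+1 else 0.
    by rewrite npolypK ?size_poly // coef_poly.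
  apply/polyP => j; have [le_j|lt_j] := leqP j d; last first.
    by rewrite !nth_default ?size_srec_fill ?szp.
  rewrite coef_srec_fill //; have [->|j_gt0] := eqVneq j 0%N; first by [].
  have [->|ne_d] := eqVneq j d.
    by move/monicP: mp; rewrite lead_coefE szp.
  have [le_r|gt_r] := leqP j r.
    by rewrite tE prednK ?lt0n // le_r.
  have [le_r'|gt_r'] := leqP (d - j) r.
    have dj : (0 < d - j)%N by rewrite subn_gt0 ltn_neqAle ne_d.
    by rewrite tE prednK // le_r' -pE.
  have dE : d = (2 * r + 2)%N by move: le_d le_j gt_r gt_r'; clear; lia.
  apply: (cN dE); rewrite {1}pE //; congr (_ * p`_ _).
  by move: le_d le_j gt_r gt_r'; clear; lia.
have szt := size_srec_fill t; rewrite srec_fillK szt eqxx /=.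
have mt : srec_fill t \is monic.
  by rewrite monicE lead_coefE szt /= coef_srec_fill // eqn0Ngt d_gt0 eqxx.
have t0 : (srec_fill t)`_0 = c by rewrite coef_srec_fill.
rewrite mt t0 eqxx; split=> //; apply/(srec_coef szt mt t0 cc) => i le_i.
rewrite !coef_srec_fill ?leq_subr //.
have [->|i0] := eqVneq i 0%N; first by rewrite subn0 eqn0Ngt d_gt0 eqxx mulr1.
have [->|id] := eqVneq i d; first by rewrite subnn cc.
have -> : (d - i == 0)%N = false by apply/eqP; move: le_i id; clear; lia.
have -> : (d - i == d)%N = false by apply/eqP; move: le_i i0; clear; lia.
rewrite subKn //.
have [le_r|gt_r] := leqP i r; have [le_r'|gt_r'] := leqP (d - i) r.
- have dE : (2 * r)%N = d by move: le_i le_r le_r' le_2r; clear; lia.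
  rewrite (c1 dE) mul1r; congr (_`_ _).
  by move: le_i le_r le_r' dE; clear; lia.
- by rewrite mulrA cc mul1r.
- by [].
by rewrite mulr0.
Qed.

End FixedConstantTerm.

Hypothesis neg1 : (-1 : F) != 1.

Lemma card_srec_pos d : (0 < d < N)%N ->
  #|[set p in srec_set d | (polyn p)`_0 == 1]| = (q ^ d./2)%N.
Proof.
move=> /andP[d_gt0 lt_d]; apply: card_srec_const => //; rewrite ?mulr1 //.
- by move: d_gt0; clear; lia.
- by move: d_gt0; clear; lia.
by move=> dE; move: dE; clear; lia.
Qed.

Lemma card_srec_neg d : (0 < d < N)%N ->
  #|[set p in srec_set d | (polyn p)`_0 == -1]| = (q ^ d.-1./2)%N.
Proof.
move=> /andP[d_gt0 lt_d]; apply: card_srec_const => //.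
- by rewrite mulrNN mulr1.
- by move: d_gt0; clear; lia.
- by move=> dE; move: dE d_gt0; clear; lia.
- by move: d_gt0; clear; lia.
move=> _ x; rewrite mulN1r => xN; apply/eqP; move: neg1; apply: contraR => nzx.
by rewrite -(inj_eq (mulfI nzx)) mulrN1 mulr1 -xN.
Qed.

Definition negp p := dsign p != 1.

Lemma dsign_negp p : srec p -> p \is monic -> dsign p = (-1) ^+ negp p.
Proof.
move=> sp mp; rewrite /negp /dsign.
have := srec_coef0 sp mp; rewrite -signr_odd.
by case: odd; rewrite ?expr0 ?expr1 ?mul1r ?mulN1r => /orP[] /eqP ->;
  rewrite ?opprK ?eqxx ?(negPf neg1) ?neg1 /= ?expr0 ?expr1.
Qed.

(** The q^(d/2) polynomials with constant term 1 have sign (-1)^d and the q^((d-1)/2) ones with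
    constant term -1 have the opposite sign, exponents being rounded down. *)
Lemma sum_srec d (i : nat) : (0 < d < N)%N ->
  \sum_(p in srec_set d) ((-1) ^+ negp (polyn p)) ^+ i =
  (-1) ^+ (d * i) * (q%:R ^+ d./2 + (-1) ^+ i * q%:R ^+ d.-1./2) :> rat.
Proof.
move=> dN; have sgE (p : {poly_N F}) (c : F) : c \in [:: 1; -1] -> p \in srec_set d -> (polyn p)`_0 = c ->
    (-1) ^+ negp (polyn p) = (-1) ^+ d * (-1) ^+ (c != 1) :> rat.
  rewrite !inE => c1 /and3P[/eqP szp mp sp] p0.
  rewrite /negp /dsign szp p0 /= -!(signr_odd _ d).
  by case: odd; move: c1 => /orP[] /eqP ->; rewrite ?expr1 ?expr0 ?mul1r ?mulN1r ?opprK ?eqxx ?(negPf neg1) ?neg1 /= ?expr1 ?expr0.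
rewrite (bigID (fun p : {poly_N F} => (polyn p)`_0 == 1)) /=.
have e1 : \sum_(p in srec_set d | (polyn p)`_0 == 1) ((-1) ^+ negp (polyn p)) ^+ i
   = (-1) ^+ (d * i) * q%:R ^+ d./2 :> rat.
  rewrite (eq_bigr (fun=> (-1) ^+ (d * i) : rat)) => [|p /andP[pd /eqP p0]]; last first.
    have c1 : (1 : F) \in [:: 1; -1] by rewrite inE eqxx.
    by rewrite (sgE p 1 c1 pd p0) eqxx expr0 mulr1 exprM.
  rewrite sumr_const -[LHS]mulr_natr -natrX -(card_srec_pos dN); congr (_ * _%:R).
  by apply: eq_card => p; rewrite [RHS]in_set.
have e2 : \sum_(p in srec_set d | (polyn p)`_0 != 1) ((-1) ^+ negp (polyn p)) ^+ i
   = (-1) ^+ (d * i) * ((-1) ^+ i * q%:R ^+ d.-1./2) :> rat.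
  have cond (p : {poly_N F}) : (p \in srec_set d) && ((polyn p)`_0 != 1) = (p \in srec_set d) && ((polyn p)`_0 == -1).
    apply: andb_id2l; rewrite inE => /and3P[_ mp sp].
    have := srec_coef0 sp mp; case: eqP => [->|_] /=; last by move=> /eqP ->; rewrite eqxx.
    by rewrite eq_sym (negPf neg1).
  rewrite (eq_bigl _ _ cond).
  rewrite (eq_bigr (fun=> (-1) ^+ (d * i) * (-1) ^+ i : rat)) => [|p /andP[pd /eqP p0]]; last first.
    have c1 : (-1 : F) \in [:: 1; -1] by rewrite !inE eqxx orbT.
    by rewrite (sgE p _ c1 pd p0) neg1 expr1 exprMn exprM.
  rewrite sumr_const -[LHS]mulr_natr -natrX -(card_srec_neg dN) mulrA; congr (_ * _%:R).
  by apply: eq_card => p; rewrite [RHS]in_set.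
by rewrite e1 e2 -mulrDr.
Qed.

Lemma sum_srec0 (i : nat) : (0 < N)%N ->
  \sum_(p in srec_set 0) ((-1) ^+ negp (polyn p)) ^+ i = 1 :> rat.
Proof.
move=> N_gt0; have s1 : srec_set 0 = [set npolyp N 1].
  apply/setP => p; rewrite !inE; apply/and3P/eqP => [[/eqP sz mp _]|->].
    apply: val_inj; rewrite /= npolypK ?size_poly1 //.
    by apply/eqP; rewrite -eqp_monic ?monic1 // -size_poly_eq1 sz.
  by rewrite npolypK ?size_poly1 // monic1 srec1.
by rewrite s1 big_set1 npolypK ?size_poly1 // /negp dsign1 eqxx expr0 expr1n.
Qed.

End SelfReciprocalCount.

(** Puts both parities in the form of the count of self-reciprocal polynomials by constant term, 1
    or -1. *)
Lemma n_srE q d : (0 < d)%N -> n_sr q d = (q ^ d./2 + q ^ d.-1./2)%N.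
Proof.
move=> d_gt0; rewrite /n_sr; case: ifP => [od|/negbT ed].
  have -> : ((d - 1) %/ 2 = d./2)%N by move: od; clear; lia.
  have -> : d.-1./2 = d./2 by move: od; clear; lia.
  by rewrite mul2n addnn.
have -> : (d %/ 2 - 1 = d.-1./2)%N by move: d_gt0 ed; clear; lia.
have -> : d./2 = (d.-1./2).+1 by move: d_gt0 ed; clear; lia.
by rewrite expnS mulnDl mul1n.
Qed.

(** * Counting the tuples with prescribed degrees *)

Section Fibers.
Variables (F : finFieldType) (m : nat).
Local Notation n := m.+1.
Local Notation q := #|F|.
Local Notation polytuple := (polytuple F m).
Implicit Types (u : polytuple) (nu : multiplicities m.+1).

Hypothesis neg1 : (-1 : F) != 1.

Definition wdeg u : multiplicities m.+1 := [ffun i => inord (size (u i)).-1].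

Lemma wdegE u i : wdeg u i = (size (u i)).-1 :> nat.
Proof.
rewrite ffunE inordK // ltnS; have := size_npoly (u i).
by move: (size (u i)); clear; lia.
Qed.

Lemma wdeg_gt0 u i : wmonic u -> (0 < wdeg u i)%N = (polyn (u i) != 1).
Proof.
move=> /andP[_ /forallP mu]; rewrite wdegE -eqp_monic ?monic1 // -size_poly_eq1.
by rewrite (size_monicS (mu i)) /= lt0n eqSS.
Qed.

Lemma wdeg_intpart u : wgood u -> is_intpart (wdeg u).
Proof.
move=> /and4P[/andP[/eqP u0 _] _ /eqP du _]; rewrite /is_intpart wdegE u0 size_poly1 /=.
by apply/eqP; rewrite -[RHS]du; apply: eq_bigr => i _; rewrite wdegE.
Qed.

Lemma wsupp_even u : wmonic u -> all_parts_even (wdeg u) = wsupp 2 u.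
Proof.
by move=> mu; apply: eq_forallb => i; rewrite wdeg_gt0 // dvdn2.
Qed.

Lemma h_part_totient u : wmonic u ->
  h_part q (wdeg u) = (\sum_(d < q | (d %| q.-1) && wsupp d u) totient d)%N.
Proof.
move=> mu; set h := h_part q (wdeg u); rewrite -[LHS]sum_totient_dvd.
have hq : (h %| q.-1)%N by rewrite -subn1 dvdn_gcdl.
have q1_gt0 := pred_card_gt0 F.
have le : (h.+1 <= q)%N.
  by have := dvdn_leq q1_gt0 hq; have := q1_gt0; case: q.
rewrite (big_ord_widen_cond q (fun d => d %| h)%N totient) //.
apply: eq_bigl => d.
have -> : (d %| h)%N && (d < h.+1)%N = (d %| h)%N.
  by apply: andb_idr => dh; rewrite ltnS dvdn_leq // (dvdn_gt0 q1_gt0).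
rewrite /h /h_part dvdn_gcd subn1; congr (_ && _).
apply/dvdn_biggcdP/forallP => [dv i|dv i].
  by apply/implyP => ui; apply: dv; rewrite wdeg_gt0.
by rewrite wdeg_gt0 // => ui; exact: implyP (dv i) ui.
Qed.

(** The exponent of -1 in [wdet u] for self-reciprocal [u]; as a natural number it transports the
    sign from [F] to [rat]. *)
Definition negsum u := (\sum_(i < n.+1) negp (polyn (u i)) * i)%N.

(** Every condition except the determinant concerns a single u_i, so the fiber is a product set cut
    out by one parity condition. *)
Lemma fiber_family nu u : is_intpart nu ->
  wgood u && (wdeg u == nu) =
  (u \in family (fun i => mem (srec_set F n.+1 (nu i)))) && ~~ odd (negsum u).
Proof.
move=> /andP[/eqP nu0 /eqP dnu].
have detE : (forall i, polyn (u i) \is monic) -> (forall i, srec (polyn (u i))) ->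
    (wdet u == 1) = ~~ odd (negsum u).
  move=> mu su; have -> : wdet u = (-1) ^+ negsum u.
    rewrite -prodrXr; apply: eq_bigr => i _.
    by rewrite (dsign_negp neg1 (su i) (mu i)) exprM.
  by rewrite -signr_odd; case: odd; rewrite ?expr1 ?expr0 ?eqxx ?(negPf neg1).
apply/andP/andP => [[gu /eqP <-]|[/familyP fu od]].
  have /and4P[mu /wsrecP su _ du] := gu.
  have m1 i : polyn (u i) \is monic by rewrite -wseqE wmonic_seq.
  split; last by rewrite -detE.
  by apply/familyP => i; rewrite !inE wdegE m1 su -(size_monicS (m1 i)) eqxx.
have fu' i : [/\ size (u i) = (nu i).+1, polyn (u i) \is monic & srec (polyn (u i))].
  by have := fu i; rewrite !inE => /and3P[/eqP].
have mu i : polyn (u i) \is monic by case: (fu' i).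
have su i : srec (polyn (u i)) by case: (fu' i).
have wE : wdeg u = nu.
  by apply/ffunP => i; apply: val_inj; rewrite /= wdegE; case: (fu' i) => ->.
split; last exact/eqP.
apply/and4P; split.
- apply/andP; split; last exact/forallP.
  rewrite -eqp_monic ?monic1 // -size_poly_eq1.
  by case: (fu' ord0) => -> _ _; rewrite nu0.
- exact/wsrecP.
- by rewrite -[X in _ == X]dnu -wE; apply/eqP/eq_bigr => i _; rewrite wdegE.
- by rewrite detE.
Qed.

Definition srec_sum (d i : nat) : rat :=
  \sum_(p in srec_set F n.+1 d) ((-1) ^+ negp (polyn p)) ^+ i.

(* The indicator of [wdet u = 1] is [(1 + (-1) ^+ negsum u) / 2]. *)
Lemma card_fiber nu : is_intpart nu ->
  #|[set u : polytuple | wgood u && (wdeg u == nu)]|%:R =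
  2^-1 * (\prod_(i < n.+1) srec_sum (nu i) 0 + \prod_(i < n.+1) srec_sum (nu i) i) :> rat.
Proof.
move=> inu; rewrite /srec_sum !bigA_distr_big_dep /= -big_split /= mulr_sumr.
rewrite -sum1_card natr_sum.
rewrite (eq_bigl (fun u => (u \in family (fun i => mem (srec_set F n.+1 (nu i))))
   && ~~ odd (negsum u))) => [|u]; last by rewrite inE fiber_family.
rewrite big_mkcondr; apply: eq_bigr => u _.
rewrite big1 => [|i _]; last by rewrite expr0.
have -> : \prod_(i < n.+1) ((-1) ^+ negp (polyn (u i))) ^+ i = (-1) ^+ negsum u :> rat.
  by rewrite -prodrXr; apply: eq_bigr => i _; rewrite exprM.
by rewrite -signr_odd; case: odd.
Qed.

Lemma srec_sumE d i : (d <= n)%N ->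
  srec_sum d i = if (0 < d)%N then
    (-1) ^+ (d * i) * (q%:R ^+ d./2 + (-1) ^+ i * q%:R ^+ d.-1./2) else 1.
Proof.
move=> le_d; rewrite /srec_sum; case: posnP => [->|d_gt0]; first exact: sum_srec0.
by rewrite sum_srec // d_gt0.
Qed.

Lemma srec_sum_even d i : (d <= n)%N -> ~~ odd i ->
  srec_sum d i = if (0 < d)%N then (n_sr q d)%:R else 1.
Proof.
move=> le_d ei; rewrite srec_sumE //; case: ifP => // d_gt0.
rewrite -[_ ^+ (d * i)]signr_odd -[_ ^+ i]signr_odd oddM (negPf ei) andbF /=.
by rewrite expr0 !mul1r n_srE // natrD !natrX.
Qed.

(** Compare the signed product with the unsigned one. They agree when all parts are even; the signed
    one vanishes as soon as some i n_i is odd, leaving the factor 1/2; otherwise each odd part size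
    changes q + 1 into q - 1, and the average of the two products gives f_nu. *)
Lemma sl_part_fiber nu : is_intpart nu ->
  #|[set u : polytuple | wgood u && (wdeg u == nu)]|%:R = sl_part q nu :> rat.
Proof.
move=> inu; rewrite card_fiber //.
have le_n (i : 'I_n.+1) : (nu i <= n)%N by rewrite -ltnS ltn_ord.
have T1 : \prod_(i < n.+1) srec_sum (nu i) 0 = \prod_(i < n.+1 | (0 < nu i)%N) (n_sr q (nu i))%:R.
  by rewrite [RHS]big_mkcond; apply: eq_bigr => i _; rewrite srec_sum_even.
have half (x : rat) : 2^-1 * (x + x) = x.
  by field.
rewrite /sl_part; case: ifP => [/forallP all0|_].
  rewrite -[RHS]half -T1; congr (_ * (_ + _)); apply: eq_bigr => i _.
  have [oi|ei] := boolP (odd i); last by rewrite !srec_sum_even.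
  by have /implyP/(_ oi)/eqP -> := all0 i; rewrite !srec_sumE.
case: ifP => [/existsP[i oi]|no].
  rewrite T1 [X in _ + X](bigD1 i) //= [X in _ + X * _](_ : _ = 0) ?mul0r ?addr0 //.
  move: oi; rewrite oddM => /andP[oi onu]; rewrite srec_sumE // odd_gt0 //.
  have -> : (nu i).-1./2 = (nu i)./2 by move: onu; clear; lia.
  by rewrite -[_ ^+ i]signr_odd oi expr1 mulN1r subrr mulr0.
have enu (i : 'I_n.+1) : odd i -> ~~ odd (nu i).
  move=> oi; apply: contraFN no => onu; apply/existsP; exists i.
  by rewrite oddM oi onu.
rewrite T1 (bigID (fun i : 'I_n.+1 => odd i)) /=.
rewrite [X in _ + X](bigID (fun i : 'I_n.+1 => odd i)) /=.
have evenE : \prod_(i < n.+1 | ~~ odd i) srec_sum (nu i) i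
    = \prod_(i < n.+1 | ~~ odd i && (0 < nu i)%N) (n_sr q (nu i))%:R.
  by rewrite [RHS]big_mkcondr; apply: eq_bigr => i ei; rewrite srec_sum_even.
have evenE1 : \prod_(i < n.+1 | (0 < nu i)%N && ~~ odd i) (n_sr q (nu i))%:R
    = \prod_(i < n.+1 | ~~ odd i && (0 < nu i)%N) (n_sr q (nu i))%:R :> rat.
  by apply: eq_bigl => i; rewrite andbC.
rewrite evenE evenE1 -mulrDl mulrA; congr (_ * _).
have halfE (i : 'I_n.+1) : odd i -> (0 < nu i)%N ->
    (nu i)./2 = (nu i %/ 2 - 1).+1 /\ (nu i).-1./2 = (nu i %/ 2 - 1)%N.
  by move=> /enu; move: (nat_of_ord (nu i)); clear; lia.
pose r := #|[set i : 'I_n.+1 | odd i & (0 < nu i)%N]|.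
have prodE (c : rat) (f : 'I_n.+1 -> rat) :
    \prod_(i < n.+1 | odd i && (0 < nu i)%N) (c * f i)
      = c ^+ r * \prod_(i < n.+1 | odd i && (0 < nu i)%N) f i.
  rewrite big_split /= prodr_const; congr (_ ^+ _ * _).
  by apply: eq_card => i; rewrite inE.
have odd1 : \prod_(i < n.+1 | (0 < nu i)%N && odd i) (n_sr q (nu i))%:R
    = (q%:R + 1) ^+ r * \prod_(i < n.+1 | odd i && (0 < nu i)%N) q%:R ^+ (nu i %/ 2 - 1) :> rat.
  rewrite -prodE; apply: eq_big => [i|i /andP[gi oi]]; first by rewrite andbC.
  have [e1 e2] := halfE i oi gi.
  by rewrite n_srE // e1 e2 natrD !natrX exprS mulrDl mul1r.
have odd2 : \prod_(i < n.+1 | odd i) srec_sum (nu i) i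
    = (q%:R - 1) ^+ r * \prod_(i < n.+1 | odd i && (0 < nu i)%N) q%:R ^+ (nu i %/ 2 - 1) :> rat.
  rewrite -prodE [RHS]big_mkcondr; apply: eq_bigr => i oi.
  rewrite srec_sumE //; case: ifP => // gi; have [e1 e2] := halfE i oi gi.
  rewrite -[_ ^+ (_ * _)]signr_odd -[_ ^+ i]signr_odd oddM (negPf (enu i oi)) oi /=.
  by rewrite expr0 expr1 mul1r mulN1r e1 e2 exprS mulrBl mul1r.
rewrite odd1 odd2 -mulrDl mulrA /f_part -/r; congr (_ * _).
exact: mulrC.
Qed.

End Fibers.

Local Close Scope ring_scope.

Theorem theorem5p7 (n q : nat) (F : finFieldType) (hn : 0 < n) (hF : #|F| = q)
    (hn4 : n = 2 %[mod 4]) (hq4 : q = 3 %[mod 4]) :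
  (#|real_classes (SL n F)|%:R =
    \sum_(nu : multiplicities n | is_intpart nu)
       (h_part q nu)%:R * sl_part q nu
  - \sum_(mu : multiplicities n | is_intpart mu && all_parts_even mu)
       (h_part q mu)%:R * sl_part q mu :> rat)%R.
Proof.
subst q; case: n hn hn4 => // m _ hn4.
have neg1 := oppr1_neq1 hq4.
(* The subtraction leaves the partitions with an odd part, which correspond to the tuples not
   supported on even indices. *)
rewrite (bigID (fun nu => all_parts_even nu)) /= addrAC subrr add0r.
rewrite real_classes_sum // sum_wpow_wsupp natr_sum.
rewrite (partition_big (@wdeg F m) (fun nu => is_intpart nu && ~~ all_parts_even nu)) /=; last first.
  move=> u /andP[gu nsu]; rewrite wdeg_intpart // wsupp_even //.
  by case/andP: gu.
apply: eq_bigr => nu /andP[inu nev].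
rewrite -(sl_part_fiber neg1 inu) -sum1_card natr_sum mulr_sumr.
apply: eq_big => [u|u /andP[/andP[/andP[mu _] _] /eqP <-]].
  rewrite inE; case: (boolP (wgood u)) => //= gu; case: eqP => [e|]; last by rewrite andbF.
  by rewrite -wsupp_even ?e ?nev //; case/andP: gu.
by rewrite mulr1 h_part_totient.
Qed.
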